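(* Let $n\ge 2$ and let $(\mathbb G,\lVert\cdot\rVert_{\mathrm{sf}})$ be a sub-Finsler free-Carnot group of step $2$ and rank $n$, and let $d_{\mathrm{cc}}$ be its Carnot–Carathéodory distance. Then the unit sphere $$\mathbb S_{\mathrm{cc}}:=\{g\in\mathbb G : d_{\mathrm{cc}}(g,0_{\mathbb G})=1\}$$ is Euclidean $(d-1)$-rectifiable, where $d=n+\binom n2$ is the topological dimension of $\mathbb G$ and $0_{\mathbb G}$ is its identity element.
   Context: Model of the group: $\mathbb G=\mathbb R^n\times\bigwedge^2(\mathbb R^n)$, where $\bigwedge^2(\mathbb R^n)$ is the span of the tensors $v\wedge w:=v\otimes w-w\otimes v$, with product $(x_1,Y_1)*(x_2,Y_2)=(x_1+x_2,\,Y_1+Y_2+\tfrac12 x_1\wedge x_2)$; its identity is $0_{\mathbb G}=(0,0)$. (Every free-Carnot group of step 2 and rank $n$ is isomorphic to this one.) A sub-Finsler structure is a norm $\lVert\cdot\rVert_{\mathrm{sf}}$ on $\mathbb R^n$ (the first layer), extended left-invariantly to the distribution spanned by left-translates of $\mathbb R^n$. For $u\in L^1([0,1],\mathbb R^n)$, the horizontal curve with control $u$ is $\gamma_u(t)=\int_0^t u(s)\,ds+\tfrac12\int_0^t\big(\int_0^s u(\tau)\,d\tau\big)\wedge u(s)\,ds$, and horizontal curves from a point $g$ are left translates $g*\gamma_u$; the length is $\ell(g*\gamma_u)=\int_0^1\lVert u(t)\rVert_{\mathrm{sf}}dt$. The Carnot–Carathéodory distance $d_{\mathrm{cc}}(g,h)$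 is the infimum of lengths of horizontal curves joining $g$ and $h$. A subset $S$ of a smooth $d$-manifold $M$ is Euclidean $k$-rectifiable if, for some (equivalently any, for bounded sets) Riemannian metric on $M$ with $k$-dimensional Hausdorff measure $\mathcal H^k$, one has $\mathcal H^k(S)<\infty$ and there are countably many measurable sets $E_j\subseteq\mathbb R^k$ and Lipschitz maps $f_j:E_j\to M$ with $\mathcal H^k(S\setminus\bigcup_j f_j(E_j))=0$. *)

(* Defs.v *)
From HB Require Import structures.
From mathcomp Require Import all_boot all_order all_algebra.
From mathcomp Require Import all_classical all_reals all_analysis.
Set Implicit Arguments. Unset Strict Implicit. Unset Printing Implicit Defensive.
Import Order.TTheory GRing.Theory Num.Theory.
Import numFieldNormedType.Exports.
Local Open Scope classical_set_scope.
Local Open Scope ring_scope.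

Section Defs.
Variable R : realType.

Section Hausdorff.
Variables (T : Type) (dist : T -> T -> R).

(* diameter (diam of the empty set is 0) *)
Definition diam (A : set T) : \bar R :=
  ereal_sup ([set (dist x y)%:E | x in A & y in A] `|` [set 0%E]).

(* k-dimensional delta-approximating Hausdorff (outer) measure
   (unnormalized: the normalizing constant is irrelevant here) *)
Definition hausdorff_delta (k : nat) (delta : R) (A : set T) : \bar R :=
  ereal_inf [set (\sum_(0 <= i <oo) ((fine (diam (C i))) ^+ k)%:E)%E
            | C in [set C : nat -> set T |
                     A `<=` \bigcup_i C i /\ forall i, (diam (C i) <= delta%:E)%E]].

Definition hausdorff (k : nat) (A : set T) : \bar R :=
  ereal_sup [set hausdorff_delta k delta A | delta in [set d : R | 0 < d]].

Definition hausdorff_measurable (k : nat) (E : set T) : Prop :=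
  forall A : set T, hausdorff k A = (hausdorff k (A `&` E) + hausdorff k (A `\` E))%E.
End Hausdorff.

Definition euclid_dist (k : nat) (x y : 'rV[R]_k) : R :=
  Num.sqrt (\sum_(i < k) (x 0 i - y 0 i) ^+ 2).

(* An element is a pair (x, Y), x in R^n, Y in /\^2 R^n realized as an
   antisymmetric n x n matrix (v /\ w = v (x) w - w (x) v). *)
Definition wedge (n : nat) (v w : 'rV[R]_n) : 'M[R]_n := v^T *m w - w^T *m v.

Definition antisym (n : nat) (Y : 'M[R]_n) : Prop := Y^T = - Y.

Definition Gset (n : nat) : set ('rV[R]_n * 'M[R]_n) := [set g | antisym g.2].

Definition gmul (n : nat) (g h : 'rV[R]_n * 'M[R]_n) : 'rV[R]_n * 'M[R]_n :=
  (g.1 + h.1, g.2 + h.2 + 2^-1 *: wedge g.1 h.1).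

Definition gid (n : nat) : 'rV[R]_n * 'M[R]_n := (0, 0).

Definition Gdist (n : nat) (g h : 'rV[R]_n * 'M[R]_n) : R :=
  Num.sqrt (\sum_(i < n) (g.1 0 i - h.1 0 i) ^+ 2
            + \sum_(i < n) \sum_(j < n) (g.2 i j - h.2 i j) ^+ 2).

Definition is_norm (n : nat) (N : 'rV[R]_n -> R) : Prop :=
  [/\ forall x, N x = 0 -> x = 0,
      forall (a : R) x, N (a *: x) = `|a| * N x
    & forall x y, N (x + y) <= N x + N y].

Definition L1_control (n : nat) (u : R -> 'rV[R]_n) : Prop :=
  forall i : 'I_n,
    (@lebesgue_measure R).-integrable `[0%R, 1%R] (fun t => (u t 0 i)%:E).

Definition prim (n : nat) (u : R -> 'rV[R]_n) (t : R) : 'rV[R]_n :=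
  \row_i Rintegral (@lebesgue_measure R) `[0%R, t] (fun s => u s 0 i).

Definition hcurve (n : nat) (u : R -> 'rV[R]_n) (t : R) : 'rV[R]_n * 'M[R]_n :=
  (prim u t,
   2^-1 *: \matrix_(i, j) Rintegral (@lebesgue_measure R) `[0%R, t]
                            (fun s => wedge (prim u s) (u s) i j)).

Definition hlength (n : nat) (N : 'rV[R]_n -> R) (u : R -> 'rV[R]_n) : \bar R :=
  (\int[@lebesgue_measure R]_(t in `[0%R, 1%R]) (N (u t))%:E)%E.

(* Carnot-Caratheodory distance: infimum of lengths of horizontal curves
   g * gamma_u, t in [0,1], joining g (at t = 0) to h (at t = 1) *)
Definition dcc (n : nat) (N : 'rV[R]_n -> R) (g h : 'rV[R]_n * 'M[R]_n) : \bar R :=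
  ereal_inf [set hlength N u | u in
     [set u : R -> 'rV[R]_n | L1_control u /\ gmul g (hcurve u 1) = h]].

Definition euclid_rectifiable (n k : nat) (S : set ('rV[R]_n * 'M[R]_n)) : Prop :=
  S `<=` @Gset n /\
  (hausdorff (@Gdist n) k S < +oo)%E /\
  exists (E : nat -> set 'rV[R]_k) (f : nat -> 'rV[R]_k -> 'rV[R]_n * 'M[R]_n),
    [/\ forall j, hausdorff_measurable (@euclid_dist k) k (E j),
        forall j, f j @` E j `<=` @Gset n,
        forall j, exists L : R, forall x y, E j x -> E j y ->
            Gdist (f j x) (f j y) <= L * euclid_dist x y
      & hausdorff (@Gdist n) k (S `\` \bigcup_j (f j @` E j)) = 0%E].

Definition cc_sphere (n : nat) (N : 'rV[R]_n -> R) : set ('rV[R]_n * 'M[R]_n) :=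
  [set g | @Gset n g /\ dcc N g (@gid n) = 1%E].

End Defs.

(* Main.v *)
(* Let d be the distance from the identity. A linear map A of R^n induces the automorphism
   (x, Y) |-> (A x, A Y A^T), which increases d at most by the operator norm of A. For the
   transvection A = 1 + w a^T it moves Y by exactly (Y a) /\ w, and conjugation by the
   horizontal vector v moves Y by exactly v /\ x. Hence d is Lipschitz with constant O(1/s) as
   long as the n x (n + 1) matrix [x | Y] is s-far from having rank at most n - 2. After a
   dilation, the sphere is the radial graph of 1/d over the boundary of a cube. Being s-close
   to rank at most n - 2 costs three coordinates (two on a face of the cube) of size s, so among
   the cells of side 2^-L of a face only a proportion O(4^-l) is degenerate at scale
   s = 2^-l, and over a cell that is not the sphere is covered by O(2^l) sets of diameter
   O(2^-L). Summation over l <= L bounds the Hausdorff measure, the cells degenerate at scale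
   2^-L cover a null set as L grows, and every other cell carries a Lipschitz chart. *)
Require Import Defs.
From HB Require Import structures.
From mathcomp Require Import all_boot all_order all_algebra.
From mathcomp Require Import all_classical all_reals all_analysis.
From mathcomp Require Import measurable_realfun.
From mathcomp Require Import ring lra zify.
Set Implicit Arguments. Unset Strict Implicit. Unset Printing Implicit Defensive.
Import Order.TTheory GRing.Theory Num.Theory.
Import numFieldNormedType.Exports.
Local Open Scope ring_scope.

(** * Controls, horizontal curves and the distance from the identity *)

(** The exponents decide the argument. Border [x | Y] to an antisymmetric matrix of size n + 1. A
    single relation has n - 1 free coefficients for n entries, so codimension 1 only, and the series
    over the scales would diverge. Hence the Lipschitz estimate has to survive rank n - 1. It does:
    the moves are f /\ w with f in the column space, and a hyperplane meets the plane of e_k and e_l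
    in some nonzero f, for which f /\ e_l or f /\ e_k is a nonzero multiple of e_k /\ e_l. No
    geodesics or abnormal curves enter, and on cells degenerate at all scales only the boundedness
    of d is used. The coefficients of the relations are discretised with mesh 2^-l, so that the
    codimension becomes a count of integers in windows; complete pivoting bounds these coefficients
    independently of s. *)

Section AffineSubstitution.
Local Open Scope classical_set_scope.
Variable R : realType.
Notation mu := (@lebesgue_measure R).
Variables (c e : R).
Hypothesis c0 : 0 < c.

Let phi (t : measurableTypeR R) : measurableTypeR R := c * t + e.

Let mphi : measurable_fun [set: measurableTypeR R] phi.
Proof.
by apply: measurable_funD => //.
Qed.

Let cnn : {nonneg R} := NngNum (ltW c0).

(** Both sides are measures in A, so by uniqueness of Lebesgue measure it suffices to compare them
    on the intervals ]a, b]. *)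
Lemma lebesgue_measure_affine (A : set (measurableTypeR R)) : measurable A ->
  mu A = (c%:E * mu (phi @^-1` A))%E.
Proof.
move=> mA.
have -> : (c%:E * mu (phi @^-1` A))%E = mscale cnn (pushforward mu (phi : measurableTypeR R -> measurableTypeR R)) A by [].
apply: lebesgue_measure_unique => // _ [[a b]] _ <-.
transitivity (c%:E * mu (phi @^-1` `]a, b]))%E; last by [].
have -> : phi @^-1` `]a, b] = `](a - e) / c, (b - e) / c]%classic.
  apply/seteqP; split => t /=; rewrite !in_itv /= /phi ltr_pdivrMr // ler_pdivlMr // [t * c]mulrC;
    by move=> /andP[h1 h2]; apply/andP; split; lra.
rewrite !lebesgue_measure_itv /= !lte_fin ltr_pM2r ?invr_gt0 // ltrD2r.
case: ifP => _; last by rewrite mule0.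
rewrite -EFinD -EFinM; congr (_%:E).
have cn : c != 0 by rewrite gt_eqF.
by field.
Qed.

Lemma ge0_integral_affine (D : set (measurableTypeR R)) (f : R -> \bar R) :
  measurable D -> measurable_fun D f -> (forall x, D x -> (0 <= f x)%E) ->
  (\int[mu]_(x in D) f x = c%:E * \int[mu]_(x in phi @^-1` D) f (c * x + e)%R)%E.
Proof.
move=> mD mf f0.
have mfp : measurable_fun D f := mf.
have f0' : {in D, forall y, (0 <= f y)%E} by move=> y; rewrite inE; apply: f0.
rewrite -[X in (_ * X)%E](ge0_integral_pushforward mphi mu mD mf f0').
rewrite -[c]/(cnn%:num) -ge0_integral_mscale //.
by apply: eq_measure_integral => A mA _; exact: lebesgue_measure_affine.
Qed.

Lemma measurable_affine_preimage (D : set (measurableTypeR R)) :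
  measurable D -> measurable (phi @^-1` D).
Proof. by move=> mD; rewrite -[X in measurable X]setTI; exact: mphi. Qed.

Lemma measurable_fun_affine (D : set (measurableTypeR R)) (f : R -> R) :
  measurable D -> measurable_fun D f ->
  measurable_fun (phi @^-1` D) (fun x => f (c * x + e)).
Proof.
move=> mD mf.
apply: (@measurable_comp _ _ _ _ _ _ D f _ phi) => //.
- by move=> _ [t Dt <-].
- exact: measurable_funTS.
Qed.

Lemma integrable_affine (D : set (measurableTypeR R)) (f : R -> R) :
  measurable D -> mu.-integrable D (EFin \o f) ->
  mu.-integrable (phi @^-1` D) (EFin \o (fun x => f (c * x + e))).
Proof.
move=> mD /integrableP[mf fi].
have mf' : measurable_fun D f by apply/measurable_EFinP.
apply/integrableP; split.
  by apply/measurable_EFinP; apply: measurable_fun_affine.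
move: fi; rewrite (ge0_integral_affine mD) //; last exact: measurableT_comp.
rewrite -[X in (_ < X -> _)%E](@gt0_muley _ c%:E) ?lte_fin // lte_pmul2l ?lte_fin //.
Qed.

Lemma Rintegral_affine (D : set (measurableTypeR R)) (f : R -> R) :
  measurable D -> mu.-integrable D (EFin \o f) ->
  Rintegral mu D f = Rintegral mu (phi @^-1` D) (fun x => c * f (c * x + e)).
Proof.
move=> mD fi; rewrite (RintegralZl _ (measurable_affine_preimage mD) (integrable_affine mD fi)).
have mf : measurable_fun D (EFin \o f) by case/integrableP: fi.
rewrite /Rintegral integralE [in RHS]integralE.
rewrite (@ge0_integral_affine D (funepos (EFin \o f))) //; last exact: measurable_funepos.
rewrite (@ge0_integral_affine D (funeneg (EFin \o f))) //; last exact: measurable_funeneg.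
have fi' := integrable_affine mD fi.
have hp := integrable_fin_num (measurable_affine_preimage mD) (integrable_funepos (measurable_affine_preimage mD) fi').
have hn := integrable_fin_num (measurable_affine_preimage mD) (integrable_funeneg (measurable_affine_preimage mD) fi').
have Ep : (EFin \o (fun x => f (c * x + e)%R))^\+%E = ((EFin \o f)^\+%E \o phi) := funepos_comp (EFin \o f) phi.
have En : (EFin \o (fun x => f (c * x + e)%R))^\-%E = ((EFin \o f)^\-%E \o phi) := funeneg_comp (EFin \o f) phi.
rewrite -[fun x => (f (c * x + e))%:E]/(EFin \o (fun x => f (c * x + e))).
rewrite Ep in hp *; rewrite En in hn *.
rewrite -muleBr ?fin_num_adde_defl ?fin_numN //.
by rewrite fineM // fin_numB; apply/andP.
Qed.

End AffineSubstitution.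

(** * Primitives, iterated integrals and concatenation of scalar controls *)

Section ScalarControls.
Local Open Scope classical_set_scope.
Variable R : realType.
Notation mu := (@lebesgue_measure R).
Implicit Types f g : R -> R.

Lemma integrable_setU_disj (A B : set (measurableTypeR R)) f :
  measurable A -> measurable B -> [disjoint A & B] ->
  mu.-integrable A (EFin \o f) -> mu.-integrable B (EFin \o f) ->
  mu.-integrable (A `|` B) (EFin \o f).
Proof.
move=> mA mB AB /integrableP[mfA fA] /integrableP[mfB fB].
have mf : measurable_fun (A `|` B) (EFin \o f) by apply/measurable_funU.
apply/integrableP; split => //.
rewrite ge0_integral_setU //; last exact: measurableT_comp.
exact: lte_add_pinfty.
Qed.

Lemma integrable_EFinD (D : set (measurableTypeR R)) f g : measurable D ->
  mu.-integrable D (EFin \o f) -> mu.-integrable D (EFin \o g) ->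
  mu.-integrable D (EFin \o (fun x => f x + g x)).
Proof. by move=> mD fi gi; exact: (@integrableD _ _ _ mu _ mD (EFin \o f) (EFin \o g)). Qed.

Lemma integrable_EFinZl (D : set (measurableTypeR R)) f c : measurable D ->
  mu.-integrable D (EFin \o f) -> mu.-integrable D (EFin \o (fun x => c * f x)).
Proof. by move=> mD fi; exact: (@integrableZl _ _ _ mu _ mD c (EFin \o f)). Qed.

Lemma integrable_EFinZr (D : set (measurableTypeR R)) f c : measurable D ->
  mu.-integrable D (EFin \o f) -> mu.-integrable D (EFin \o (fun x => f x * c)).
Proof. by move=> mD fi; exact: (@integrableZr _ _ _ mu _ mD c (EFin \o f)). Qed.

Lemma integrable_lincomb (D : set (measurableTypeR R)) (I : Type) (r : seq I) (F : I -> R -> R) (a : I -> R) :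
  measurable D -> (forall i, mu.-integrable D (EFin \o F i)) ->
  mu.-integrable D (EFin \o (fun s => \sum_(i <- r) F i s * a i)).
Proof.
move=> mD iF; elim: r => [|i r IH].
  have -> : (fun s => \sum_(i <- [::]) F i s * a i) = cst 0 by apply/funext => s; rewrite big_nil.
  exact: integrable0.
have -> : (fun s => \sum_(j <- i :: r) F j s * a j) = (fun s => F i s * a i + \sum_(j <- r) F j s * a j).
  by apply/funext => s; rewrite big_cons.
by apply: integrable_EFinD => //; exact: integrable_EFinZr.
Qed.

Lemma Rintegral_lincomb (D : set (measurableTypeR R)) (I : Type) (r : seq I) (F : I -> R -> R) (a : I -> R) :
  measurable D -> (forall i, mu.-integrable D (EFin \o F i)) ->
  Rintegral mu D (fun s => \sum_(i <- r) F i s * a i) = \sum_(i <- r) Rintegral mu D (F i) * a i.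
Proof.
move=> mD iF; elim: r => [|i r IH].
  have -> : (fun s => \sum_(i <- [::]) F i s * a i) = cst 0 by apply/funext => s; rewrite big_nil.
  by rewrite big_nil Rintegral_cst // mul0r.
have -> : (fun s => \sum_(j <- i :: r) F j s * a j) = (fun s => F i s * a i + \sum_(j <- r) F j s * a j).
  by apply/funext => s; rewrite big_cons.
rewrite big_cons RintegralD //; [|exact: integrable_EFinZr|exact: integrable_lincomb].
by rewrite RintegralZr // IH.
Qed.

Definition L1_unit f := mu.-integrable `[0%R, 1%R] (EFin \o f).
Definition primitive f (t : R) := Rintegral mu `[0%R, t] f.
(** Second-level term of the signature of a path; half its antisymmetric part is the second layer of
    the end point. *)
Definition iterated_integral f g := Rintegral mu `[0%R, 1%R] (fun s => primitive f s * g s).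

Lemma L1_sub f (D : set (measurableTypeR R)) : measurable D -> D `<=` `[0%R, 1%R] -> L1_unit f -> mu.-integrable D (EFin \o f).
Proof. by move=> mD DS; apply: integrableS. Qed.

Lemma subset_itv01 (t : R) : t <= 1 -> `[0%R, t] `<=` `[0%R, 1%R :> R].
Proof. by move=> t1 x /=; rewrite !in_itv /= => /andP[-> xt] /=; apply: le_trans xt t1. Qed.

Lemma primitive_measurable f : L1_unit f -> measurable_fun (`[0%R, 1%R]%classic : set (measurableTypeR R)) (primitive f).
Proof.
move=> lf; have := parameterized_integral_continuous ler01 lf => cf.
by apply: subspace_continuous_measurable_fun.
Qed.

Lemma primitive_bound f t : L1_unit f -> t <= 1 -> `|primitive f t| <= primitive (fun s => `|f s|) 1.
Proof.
move=> lf t1.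
have lft : mu.-integrable `[0%R, t] (EFin \o f) by apply: L1_sub lf => //; apply: subset_itv01.
apply: le_trans (le_normr_Rintegral _ lft) _ => //.
rewrite /primitive /Rintegral fine_le //.
- exact/integrable_fin_num/integrable_norm.
- exact/integrable_fin_num/integrable_norm.
- apply: ge0_subset_integral => //.
  + apply: (measurable_int mu); exact: integrable_norm.
  + exact: subset_itv01.
Qed.

Lemma iterated_integral_integrable f g : L1_unit f -> L1_unit g -> L1_unit (fun s => primitive f s * g s).
Proof.
move=> lf lg; apply: (@integrableMr _ _ _ mu _ _ (primitive f) (EFin \o g)) => //.
- exact: primitive_measurable.
- exists (primitive (fun s => `|f s|) 1); split; first exact: num_real.
  move=> M hM t /=; rewrite in_itv /= => /andP[_ t1].
  exact: le_trans (primitive_bound lf t1) (ltW hM).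
Qed.

Lemma iterated_integral_bound f g : L1_unit f -> L1_unit g ->
  `|iterated_integral f g| <= primitive (fun s => `|f s|) 1 * primitive (fun s => `|g s|) 1.
Proof.
move=> lf lg; apply: le_trans (le_normr_Rintegral _ (iterated_integral_integrable lf lg)) _ => //.
rewrite /primitive -RintegralZl //; last exact: integrable_norm.
apply: le_Rintegral => //.
- exact/integrable_norm/iterated_integral_integrable.
- apply: integrable_EFinZl => //; exact: integrable_norm.
- move=> x /=; rewrite in_itv /= => /andP[_ x1].
  by rewrite normrM ler_wpM2r // primitive_bound.
Qed.

Lemma primitive_sum (I : Type) (r : seq I) (F : I -> R -> R) (a : I -> R) t : t <= 1 ->
  (forall i, L1_unit (F i)) ->
  primitive (fun s => \sum_(i <- r) F i s * a i) t = \sum_(i <- r) primitive (F i) t * a i.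
Proof.
move=> t1 lF; rewrite /primitive; apply: Rintegral_lincomb => // i.
by apply: L1_sub (lF i) => //; apply: subset_itv01.
Qed.

Lemma iterated_integral_sum (I : Type) (r : seq I) (F : I -> R -> R) (a b : I -> R) :
  (forall i, L1_unit (F i)) ->
  iterated_integral (fun s => \sum_(i <- r) F i s * a i) (fun s => \sum_(i <- r) F i s * b i) =
  \sum_(i <- r) \sum_(j <- r) iterated_integral (F i) (F j) * (a i * b j).
Proof.
move=> lF.
have -> : iterated_integral (fun s => \sum_(i <- r) F i s * a i) (fun s => \sum_(i <- r) F i s * b i) =
   Rintegral mu `[0%R, 1%R] (fun s => \sum_(i <- r) (\sum_(j <- r) (primitive (F i) s * F j s) * b j) * a i).
  apply: eq_Rintegral => s; rewrite inE /= in_itv /= => /andP[s0 s1].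
  rewrite primitive_sum // big_distrl /=; apply: eq_bigr => i _.
  rewrite big_distrr big_distrl /=; apply: eq_bigr => j _; ring.
have H i : mu.-integrable `[0%R, 1%R] (EFin \o (fun s => \sum_(j <- r) (primitive (F i) s * F j s) * b j)).
  by apply: integrable_lincomb => // j; apply: iterated_integral_integrable.
rewrite Rintegral_lincomb //; apply: eq_bigr => i _.
rewrite Rintegral_lincomb //; last by move=> j; apply: iterated_integral_integrable.
rewrite big_distrl /=; apply: eq_bigr => j _; rewrite /iterated_integral; ring.
Qed.

(** Each control runs at double speed on its half, and the factor 2 keeps its integral unchanged. *)
Definition concat_control f g t := if t <= 2^-1 then 2 * f (2 * t) else 2 * g (2 * t - 1).

Let first_half_preimage (t : R) : (fun x : R => 2 * x + 0) @^-1` `[0, t] = `[0, t / 2]%classic.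
Proof. by apply/seteqP; split => x /=; rewrite !in_itv /= => /andP[h1 h2]; apply/andP; split; lra. Qed.

Let second_half_preimage (t : R) : (fun x : R => 2 * x + (-1)) @^-1` `]0, t] = `]2^-1, (t + 1) / 2]%classic.
Proof. by apply/seteqP; split => x /=; rewrite !in_itv /= => /andP[h1 h2]; apply/andP; split; lra. Qed.

Lemma Rintegral_first_half f t : t <= 1 -> L1_unit f ->
  mu.-integrable `[0%R, t / 2] (EFin \o (fun s => 2 * f (2 * s))) /\
  Rintegral mu `[0%R, t / 2] (fun s => 2 * f (2 * s)) = Rintegral mu `[0%R, t] f.
Proof.
move=> t1 lf.
have lft : mu.-integrable `[0%R, t] (EFin \o f) by apply: L1_sub lf => //; apply: subset_itv01.
have m : measurable (`[0%R, t]%classic : set (measurableTypeR R)) by [].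
have p2 : 0 < 2 :> R by [].
split; last first.
  rewrite (Rintegral_affine 0 p2 m lft) first_half_preimage.
  by apply: eq_Rintegral => x _; rewrite addr0.
apply: integrable_EFinZl => //.
have := integrable_affine 0 p2 m lft; rewrite first_half_preimage.
by apply: eq_integrable => // x _; rewrite /= addr0.
Qed.

Lemma Rintegral_second_half f t : t <= 1 -> L1_unit f ->
  mu.-integrable `]2^-1, (t + 1) / 2] (EFin \o (fun s => 2 * f (2 * s - 1))) /\
  Rintegral mu `]2^-1, (t + 1) / 2] (fun s => 2 * f (2 * s - 1)) = Rintegral mu `[0%R, t] f.
Proof.
move=> t1 lf.
(* The half-open interval has a preimage disjoint from the first half; the omitted point 0 is
   null. *)
have lft : mu.-integrable `]0%R, t] (EFin \o f).
  apply: L1_sub lf => // x /=; rewrite !in_itv /= => /andP[x0 xt]; apply/andP; split; lra.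
have m : measurable (`]0%R, t]%classic : set (measurableTypeR R)) by [].
have p2 : 0 < 2 :> R by [].
split; last first.
  by rewrite -Rintegral_itv_obnd_cbnd // (Rintegral_affine (-1) p2 m lft) second_half_preimage.
apply: integrable_EFinZl => //.
have := integrable_affine (-1) p2 m lft; rewrite second_half_preimage.
by apply: eq_integrable.
Qed.

Lemma split_itv (t : R) : 2^-1 <= t -> `[0%R, t]%classic = `[0%R, 2^-1] `|` `]2^-1, t].
Proof.
move=> t2; apply/seteqP; split => x /=; rewrite !in_itv /=.
  by move=> /andP[x0 xt]; case: (leP x (2^-1)) => h; [left|right]; apply/andP; split.
by move=> [] /andP[x0 xt]; apply/andP; split; lra.
Qed.

Lemma disj_itv (t : R) : [disjoint `[0%R, 2^-1]%classic & `]2^-1, t]%classic].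
Proof.
apply/disj_set2P; rewrite -subset0 => x [] /=; rewrite !in_itv /= => /andP[_ h1] /andP[h2 _]; lra.
Qed.

Lemma gluing f1 f2 g t : 2^-1 <= t ->
  (forall s, 0 <= s -> s <= 2^-1 -> g s = f1 s) -> (forall s, 2^-1 < s -> s <= t -> g s = f2 s) ->
  mu.-integrable `[0%R, 2^-1] (EFin \o f1) -> mu.-integrable `]2^-1, t] (EFin \o f2) ->
  mu.-integrable `[0%R, t] (EFin \o g) /\
  Rintegral mu `[0%R, t] g = Rintegral mu `[0%R, 2^-1] f1 + Rintegral mu `]2^-1, t] f2.
Proof.
move=> t2 E1 E2 i1 i2.
have i1' : mu.-integrable `[0%R, 2^-1] (EFin \o g).
  apply: eq_integrable i1 => // x; rewrite inE /= in_itv /= => /andP[h1 h2]; by rewrite E1.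
have i2' : mu.-integrable `]2^-1, t] (EFin \o g).
  apply: eq_integrable i2 => // x; rewrite inE /= in_itv /= => /andP[h1 h2]; by rewrite E2.
have ig : mu.-integrable `[0%R, t] (EFin \o g).
  rewrite (split_itv t2); apply: integrable_setU_disj => //; exact: disj_itv.
split => //; rewrite (split_itv t2) Rintegral_setU //; first last.
- exact: disj_itv.
- by rewrite -split_itv.
congr (_ + _); apply: eq_Rintegral => x; rewrite inE /= in_itv /= => /andP[h1 h2].
  by rewrite E1.
by rewrite E2.
Qed.

Let dbl : (1 : R) / 2 = 2^-1. Proof. by rewrite mul1r. Qed.
Let dbl' : (1 + 1 : R) / 2 = 1. Proof. lra. Qed.

Lemma concat_L1_primitive f1 f2 : L1_unit f1 -> L1_unit f2 ->
  L1_unit (concat_control f1 f2) /\ primitive (concat_control f1 f2) 1 = primitive f1 1 + primitive f2 1.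
Proof.
move=> l1 l2.
have [a1 b1] := Rintegral_first_half (lexx 1) l1.
have [a2 b2] := Rintegral_second_half (lexx 1) l2.
rewrite dbl in a1 b1; rewrite dbl' in a2 b2.
rewrite /primitive -b1 -b2; apply: gluing => //.
- lra.
- by move=> s _ h; rewrite /concat_control h.
- by move=> s h _; rewrite /concat_control leNgt h.
Qed.

Lemma primitive_concat_left f1 f2 t : L1_unit f1 -> 0 <= t -> t <= 2^-1 ->
  primitive (concat_control f1 f2) t = primitive f1 (2 * t).
Proof.
move=> l1 t0 t2.
have t2' : 2 * t <= 1 by lra.
have [_] := Rintegral_first_half t2' l1.
rewrite (_ : 2 * t / 2 = t); last by lra.
rewrite /primitive => <-; apply: eq_Rintegral => x; rewrite inE /= in_itv /= => /andP[h1 h2].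
by rewrite /concat_control ifT //; lra.
Qed.

Lemma primitive_concat_right f1 f2 t : L1_unit f1 -> L1_unit f2 -> 2^-1 < t -> t <= 1 ->
  primitive (concat_control f1 f2) t = primitive f1 1 + primitive f2 (2 * t - 1).
Proof.
move=> l1 l2 t0 t2.
have t2' : 2 * t - 1 <= 1 by lra.
have [a1 b1] := Rintegral_first_half (lexx 1) l1.
have [a2 b2] := Rintegral_second_half t2' l2.
rewrite (_ : (2 * t - 1 + 1) / 2 = t) in a2 b2; last by lra.
rewrite dbl in a1 b1.
rewrite /primitive -b1 -b2; apply: (gluing _ _ _ a1 a2).2 => //.
- lra.
- by move=> s _ h; rewrite /concat_control h.
- by move=> s h _; rewrite /concat_control leNgt h.
Qed.

(** Chen's identity at level two: during the second half the first primitive has the constant extra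
    value [primitive f1 1]. After antisymmetrisation the product term becomes the wedge in the group
    law. *)
Lemma iterated_integral_concat f1 f2 g1 g2 : L1_unit f1 -> L1_unit f2 -> L1_unit g1 -> L1_unit g2 ->
  iterated_integral (concat_control f1 f2) (concat_control g1 g2) = iterated_integral f1 g1 + iterated_integral f2 g2 + primitive f1 1 * primitive g2 1.
Proof.
move=> lf1 lf2 lg1 lg2.
have l1 := iterated_integral_integrable lf1 lg1.
have l2 : L1_unit (fun s => primitive f1 1 * g2 s + primitive f2 s * g2 s).
  apply: integrable_EFinD => //; last exact: iterated_integral_integrable.
  exact: integrable_EFinZl.
have [a1 b1] := Rintegral_first_half (lexx 1) l1.
have [a2 b2] := Rintegral_second_half (lexx 1) l2.
rewrite dbl in a1 b1; rewrite dbl' in a2 b2.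
have -> : iterated_integral f1 g1 + iterated_integral f2 g2 + primitive f1 1 * primitive g2 1 = iterated_integral f1 g1 + Rintegral mu `[0%R, 1] (fun s => primitive f1 1 * g2 s + primitive f2 s * g2 s).
  rewrite RintegralD //; last exact: iterated_integral_integrable.
    by rewrite RintegralZl // -addrA [_ + iterated_integral f2 g2]addrC [iterated_integral f2 g2 + _]addrC.
  exact: integrable_EFinZl.
rewrite {2}/iterated_integral -b1 -b2; apply: (gluing _ _ _ a1 a2).2 => //.
- lra.
- by move=> s h0 h; rewrite primitive_concat_left // /concat_control h mulrCA.
- move=> s h h1; rewrite primitive_concat_right // /concat_control leNgt h /=; ring.
Qed.

End ScalarControls.

Lemma sum_le_card (R : numDomainType) (I : finType) (F : I -> R) (d : R) :
  (forall i, F i <= d) -> \sum_i F i <= #|I|%:R * d.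
Proof.
move=> h; apply: le_trans (ler_sum _ (fun i _ => h i)) _.
by rewrite sumr_const mulr_natl.
Qed.

(** * Norms on R^n: comparison with coordinates and integrability along controls *)

Section NormOnRn.
Local Open Scope classical_set_scope.
Variables (R : realType) (n : nat) (N : 'rV[R]_n -> R).
Notation mu := (@lebesgue_measure R).
Hypothesis hN : is_norm N.

Let N_sep x : N x = 0 -> x = 0. Proof. by case: hN => h _ _; exact: h. Qed.
Lemma sfnormZ a x : N (a *: x) = `|a| * N x. Proof. by case: hN. Qed.
Lemma sfnormD x y : N (x + y) <= N x + N y. Proof. by case: hN. Qed.

Lemma sfnorm0 : N 0 = 0.
Proof. by rewrite -(scale0r (0 : 'rV[R]_n)) sfnormZ normr0 mul0r. Qed.

Lemma sfnormN x : N (- x) = N x.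
Proof. by rewrite -scaleN1r sfnormZ normrN normr1 mul1r. Qed.

Lemma sfnorm_ge0 x : 0 <= N x.
Proof.
have := sfnormD x (- x); rewrite subrr sfnorm0 sfnormN; lra.
Qed.

Lemma sfnorm_sum (I : Type) (r : seq I) (F : I -> 'rV[R]_n) :
  N (\sum_(i <- r) F i) <= \sum_(i <- r) N (F i).
Proof.
elim: r => [|i r IH]; first by rewrite !big_nil sfnorm0.
by rewrite !big_cons; apply: le_trans (sfnormD _ _) _; rewrite lerD2l.
Qed.

Lemma sfnorm_le_l1 : exists2 C : R, 0 < C & forall x, N x <= C * \sum_i `|x 0 i|.
Proof.
exists (1 + \sum_i N (delta_mx 0 i)).
  by apply: ltr_pwDl => //; apply: sumr_ge0 => i _; apply: sfnorm_ge0.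
move=> x; rewrite {1}(row_sum_delta x); apply: le_trans (sfnorm_sum _ _) _.
rewrite mulr_sumr; apply: ler_sum => i _.
rewrite sfnormZ mulrC; apply: ler_wpM2r => //.
rewrite (bigD1 i) //= addrCA lerDl; apply: addr_ge0 => //.
by apply: sumr_ge0 => j _; apply: sfnorm_ge0.
Qed.

Lemma sfnorm_lip : exists2 C, 0 < C & forall x y, `|N x - N y| <= C * \sum_i `|x 0 i - y 0 i|.
Proof.
have [C C0 hC] := sfnorm_le_l1; exists C => // x y.
have h z w : N z - N w <= C * \sum_i `|z 0 i - w 0 i|.
  apply: le_trans (_ : N (z - w) <= _).
    by have := sfnormD (z - w) w; rewrite subrK; lra.
  apply: le_trans (hC _) _; rewrite ler_pM2l //.
  by apply: ler_sum => i _; rewrite !mxE.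
rewrite ler_norml; apply/andP; split; last exact: h.
rewrite lerNl opprB; apply: le_trans (h _ _) _; rewrite ler_pM2l //.
by apply: ler_sum => i _; rewrite distrC.
Qed.

Lemma coord_le_mxnorm (x : 'rV[R]_n) i : `|x 0 i| <= `|x|.
Proof.
rewrite [leRHS](_ : _ = mx_norm x) // mx_normrE.
by apply: (le_bigmax _ (fun ij : 'I_1 * 'I_n => `|x ij.1 ij.2|) (0, i)).
Qed.

Lemma sfnorm_continuous : continuous N.
Proof.
have [C C0 hC] := sfnorm_lip => x.
have FF : ProperFilter (nbhs x) := nbhs_pfilter x.
apply/(@cvgrPdist_le _ _ _ (nbhs x) FF) => e e0.
(* [n.+1] instead of [n] keeps the denominator positive when n = 0. *)
have d0 : 0 < e / (C * n.+1%:R) by rewrite divr_gt0 // mulr_gt0.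
apply: filterS (nbhsx_ballx x _ d0) => y; rewrite -ball_normE /= => /ltW hy.
apply: le_trans (hC _ _) _.
have : \sum_i `|x 0 i - y 0 i| <= n%:R * (e / (C * n.+1%:R)).
  rewrite -[X in X%:R * _ ](card_ord n); apply: sum_le_card => i; apply: le_trans hy.
  by have := coord_le_mxnorm (x - y) i; rewrite !mxE.
move=> h; apply: le_trans (ler_wpM2l (ltW C0) h) _.
set d := e / _ in h d0 *.
have -> : e = C * (n.+1%:R * d).
  by rewrite mulrA /d [RHS]mulrC divfK // gt_eqF // mulr_gt0.
by rewrite ler_pM2l // ler_pM2r // ler_nat.
Qed.

(** Equivalence of norms in finite dimension: [N] attains a positive minimum on the compact unit
    sphere of the sup norm, and [C] is its inverse. *)
Lemma sfnorm_lower : exists2 C : R, 0 < C & forall (x : 'rV[R]_n) i, `|x 0 i| <= C * N x.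
Proof.
pose A := [set x : 'rV[R]_n | `|x| = 1].
have cA : compact A.
  apply: bounded_closed_compact.
    exists 1; split; first exact: num_real.
    by move=> M M1 x /= ->; exact: ltW.
  have -> : A = Num.norm @^-1` [set 1] by [].
  apply: preimage_closed; first by move=> x _; exact: norm_continuous.
  exact: closed_eq.
have [A0|/set0P/negP/negPn/eqP A0] := pselect (A !=set0); last first.
  (* The sphere is empty only when n = 0, and then every vector is 0. *)
  exists 1 => // x i; have [->|x0] := eqVneq x 0; first by rewrite mxE normr0 sfnorm0 mulr0.
  have : A (`|x|^-1 *: x).
    by rewrite /A /= mx_normZ normfV normr_id mulVf // normr_eq0.
  by rewrite A0.
have [|c cA' cmin] := compact_EVT_min A0 cA (f := N).
  by apply: continuous_subspaceT => x; exact: sfnorm_continuous.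
rewrite inE /A /= in cA'.
have Nc : 0 < N c.
  rewrite lt_neqAle sfnorm_ge0 andbT eq_sym; apply/eqP => /N_sep c0.
  by move: cA'; rewrite c0 normr0 => /eqP; rewrite eq_sym oner_eq0.
exists (N c)^-1; first by rewrite invr_gt0.
move=> x i; have [->|x0] := eqVneq x 0; first by rewrite mxE normr0 sfnorm0 mulr0.
have xn : 0 < `|x| by rewrite normr_gt0.
apply: le_trans (coord_le_mxnorm x i) _.
have := cmin (`|x|^-1 *: x).
rewrite sfnormZ ger0_norm ?invr_ge0 // => /(_ _) h.
rewrite mulrC ler_pdivlMr //; rewrite mulrC.
rewrite -ler_pdivlMr // mulrC; apply: h.
by rewrite inE /A /= mx_normZ normfV normr_id mulVf // normr_eq0.
Qed.

(* N o u is the infimum over rational q of the functions N q + C |u - q|_1. *)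
Lemma sfnorm_comp_L1 (u : R -> 'rV[R]_n) : L1_control u -> L1_unit (fun t => N (u t)).
Proof.
move=> lu.
have mu_i i : measurable_fun (`[0%R, 1%R]%classic : set (measurableTypeR R)) (fun t => u t 0 i).
  by apply/measurable_EFinP; case/integrableP: (lu i).
have [C C0 hC] := sfnorm_lip.
(* An enumeration of the rational vectors; numbers that code no vector give 0. *)
pose q (m : nat) : 'rV[R]_n := \row_i ratr ((odflt (0 : 'rV[rat]_n) (unpickle m)) 0 i).
pose h m t := N (q m) + C * \sum_i `|u t 0 i - q m 0 i|.
have mh m : measurable_fun (`[0%R, 1%R]%classic : set (measurableTypeR R)) (h m).
  apply: measurable_funD => //; apply: measurable_funM => //.
  apply: measurable_sum => i; apply: measurableT_comp => //.
  exact: measurable_funB.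
have mN : measurable_fun (`[0%R, 1%R]%classic : set (measurableTypeR R)) (fun t => N (u t)).
  apply: (measurability _ (RGenInftyO.measurableE R)) => // _ [_ [x ->] <-].
  have -> : `[0%R, 1%R]%classic `&` (fun t => N (u t)) @^-1` `]-oo, x[ =
     \bigcup_m (`[0%R, 1%R]%classic `&` (h m) @^-1` `]-oo, x[).
    apply/seteqP; split => t /=.
      move=> [t01]; rewrite in_itv /= => Nx.
      (* The distance from [u t] to the rational vector is paid twice, in [N (q m)] and in the
         penalty term, hence the factor 2. *)
      have d0 : 0 < (x - N (u t)) / (2 * C * n.+1%:R).
        by rewrite divr_gt0 ?subr_gt0 // !mulr_gt0.
      set d := _ / _ in d0.
      have Hq i : {q : rat | `|u t 0 i - ratr q| <= d}.
        have /rat_in_itvoo/cid[p hp] : u t 0 i - d < u t 0 i + d by lra.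
        exists p; move: hp; rewrite in_itv /= => /andP[h1 h2].
        by rewrite ler_norml; apply/andP; split; lra.
      exists (pickle (\row_i sval (Hq i) : 'rV[rat]_n)) => //; split => //.
      rewrite /preimage /= ?in_itv /= /h.
      have hS : \sum_i `|u t 0 i - q (pickle (\row_i sval (Hq i) : 'rV[rat]_n)) 0 i| <= n%:R * d.
        rewrite -[X in X%:R](card_ord n); apply: sum_le_card => i; rewrite /q pickleK /= !mxE; exact: svalP (Hq i).
      set qq := q _ in hS *.
      have := hC (u t) qq; rewrite ler_norml => /andP[h1 _].
      have h2 : C * (n%:R * d) < C * (n.+1%:R * d) by rewrite ltr_pM2l // ltr_pM2r // ltr_nat.
      have h3 : C * (n.+1%:R * d) = (x - N (u t)) / 2.
        have M0 : (n.+1%:R : R) != 0 by rewrite pnatr_eq0.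
        have CN0 : C != 0 by rewrite gt_eqF.
        rewrite /d; set M := n.+1%:R in M0 *; by field; do ?[apply/andP; split].
      have h4 := ler_wpM2l (ltW C0) hS.
      lra.
    move=> [m _ [t01]]; rewrite !in_itv /= => hx; split => //.
    apply: le_lt_trans hx; rewrite /h.
    by have := hC (u t) (q m); rewrite ler_norml => /andP[h1 h2]; lra.
  by apply: bigcup_measurable => m _; apply: mh => //; exact: measurable_itv.
have [K K0 hK] := sfnorm_le_l1.
apply: (@le_integrable _ _ _ mu _ _ _ (EFin \o (fun t => \sum_i `|u t 0 i| * K))) => //.
- exact/measurable_EFinP.
- move=> t _ /=; rewrite lee_fin ger0_norm ?sfnorm_ge0 // ger0_norm; last first.
    by apply: sumr_ge0 => i _; apply: mulr_ge0 => //; exact: ltW.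
  by rewrite -mulr_suml mulrC.
- apply: integrable_lincomb => // i.
  exact: (@integrable_norm _ (measurableTypeR R) R mu `[0%R, 1%R]%classic (fun t => u t 0 i) (lu i)).
Qed.

End NormOnRn.

(** * Algebra of the group: inverses, automorphisms, commutators *)

Section WedgeAlgebra.
Local Open Scope classical_set_scope.
Variables (R : realType) (n : nat).
Implicit Types (v w x : 'rV[R]_n) (g h : 'rV[R]_n * 'M[R]_n).

Lemma wedgeE v w i j : wedge v w i j = v 0 i * w 0 j - w 0 i * v 0 j.
Proof. by rewrite !mxE !big_ord1 !mxE. Qed.

Definition gopp g : 'rV[R]_n * 'M[R]_n := (- g.1, - g.2).

(** Vectors are rows, so [A] acts on the right, and Y, a sum of terms v^T w, changes by
    congruence. *)
Definition gact (A : 'M[R]_n) g : 'rV[R]_n * 'M[R]_n := (g.1 *m A, A^T *m g.2 *m A).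

Lemma gmul1E g h j : (gmul g h).1 0 j = g.1 0 j + h.1 0 j.
Proof. by rewrite mxE. Qed.

Lemma gmul2E g h i j : (gmul g h).2 i j =
  g.2 i j + h.2 i j + 2^-1 * (g.1 0 i * h.1 0 j - h.1 0 i * g.1 0 j).
Proof. by rewrite !mxE !big_ord1 !mxE. Qed.

Lemma gmul_eq_gid g h : (gmul g h = gid R n) <-> h = gopp g.
Proof.
have z v : wedge v (- v) = 0 by apply/matrixP => i j; rewrite wedgeE !mxE; ring.
case: g h => [x Y] [x' Y'] /=; split.
  move=> [e1 e2]; have E1 : x' = - x by apply/eqP; rewrite -addr_eq0 addrC e1.
  move: e2; rewrite E1 z scaler0 addr0 => e2; congr (_, _).
  by apply/eqP; rewrite -addr_eq0 addrC e2.
by move=> [-> ->]; rewrite /gmul /gid /= z scaler0 addr0 !subrr.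
Qed.

Lemma gopp_mul g h : gopp (gmul g h) = gmul (gopp h) (gopp g).
Proof.
rewrite /gopp /gmul /=; congr (_, _); first by rewrite opprD addrC.
by apply/matrixP => i j; rewrite !mxE !big_ord1 !mxE; ring.
Qed.

Lemma gopp_act A g : gopp (gact A g) = gact A (gopp g).
Proof. by rewrite /gopp /gact /= mulNmx mulmxN mulNmx. Qed.

Lemma Gset_mul g h : Gset g -> Gset h -> Gset (gmul g h).
Proof.
rewrite /Gset /antisym /= => eg eh.
apply/matrixP => i j; move/matrixP: eg => /(_ i j); move/matrixP: eh => /(_ i j).
by rewrite !mxE !big_ord1 !mxE => -> ->; ring.
Qed.

Lemma Gset_opp g : Gset g -> Gset (gopp g).
Proof. by rewrite /Gset /antisym /gopp /= linearN /= => ->. Qed.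

Lemma Gset_act A g : Gset g -> Gset (gact A g).
Proof. by rewrite /Gset /antisym /gact /= !trmx_mul trmxK => ->; rewrite mulNmx mulmxN mulmxA. Qed.

Lemma Gset_vec x : Gset (x, 0 : 'M[R]_n).
Proof. by rewrite /Gset /antisym /= trmx0 oppr0. Qed.

(** The commutator of two horizontal elements gives access to the second layer by four horizontal
    segments. *)
Lemma commutatorE v w :
  gmul (gmul (v, 0) (w, 0)) (gmul (- v, 0) (- w, 0)) = (0 : 'rV[R]_n, wedge v w).
Proof.
rewrite /gmul /=; congr (_, _); first by rewrite addrACA !subrr addr0.
by apply/matrixP => i j; rewrite !mxE !big_ord1 !mxE; field.
Qed.

(** Summation over all ordered pairs meets every unordered pair twice, hence the halves. *)
Lemma antisym_sum_wedge (Y : 'M[R]_n) : antisym Y ->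
  Y = \sum_i \sum_j wedge ((Y i j / 2) *: delta_mx 0 i) (delta_mx 0 j : 'rV[R]_n).
Proof.
move=> aY; apply/matrixP => a b; rewrite summxE.
have E i j : wedge ((Y i j / 2) *: delta_mx 0 i) (delta_mx 0 j : 'rV[R]_n) a b =
   (Y i j / 2) * ((a == i)%:R * (b == j)%:R) - (Y i j / 2) * ((a == j)%:R * (b == i)%:R).
  by rewrite wedgeE !mxE /=; ring.
transitivity (\sum_i \sum_j ((Y i j / 2) * ((a == i)%:R * (b == j)%:R) - (Y i j / 2) * ((a == j)%:R * (b == i)%:R))); last first.
  by apply: eq_bigr => i _; rewrite summxE; apply: eq_bigr => j _; rewrite E.
have D (F : 'I_n -> R) c : \sum_j F j * (c == j)%:R = F c.
  rewrite (bigD1 c) //= eqxx mulr1 big1 ?addr0 // => j jc.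
  by rewrite eq_sym (negbTE jc) mulr0.
transitivity (\sum_i (Y i b / 2 * (a == i)%:R - Y i a / 2 * (b == i)%:R)); last first.
  apply: eq_bigr => i _; rewrite sumrB; congr (_ - _).
    by rewrite -(D (fun j => Y i j / 2 * (a == i)%:R) b); apply: eq_bigr => j _; ring.
  by rewrite -(D (fun j => Y i j / 2 * (b == i)%:R) a); apply: eq_bigr => j _; ring.
rewrite sumrB (D (fun i => Y i b / 2)) (D (fun i => Y i a / 2)).
by move/matrixP: aY => /(_ a b); rewrite !mxE => ->; field.
Qed.

End WedgeAlgebra.

(** * Lengths of curves reaching a point, and the distance from the identity *)

Section Distance.
Local Open Scope classical_set_scope.
Variables (R : realType) (n : nat) (N : 'rV[R]_n -> R).
Notation mu := (@lebesgue_measure R).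
Hypothesis hN : is_norm N.
Implicit Types (v w x : 'rV[R]_n) (g h : 'rV[R]_n * 'M[R]_n) (u : R -> 'rV[R]_n).

Lemma hcurve1E u j : (hcurve u 1).1 0 j = primitive (fun s => u s 0 j) 1.
Proof. by rewrite mxE. Qed.

Lemma hcurve2E u i j : L1_control u -> (hcurve u 1).2 i j =
  2^-1 * (iterated_integral (fun s => u s 0 i) (fun s => u s 0 j) - iterated_integral (fun s => u s 0 j) (fun s => u s 0 i)).
Proof.
move=> lu; rewrite !mxE; congr (_ * _).
have l i' : L1_unit (fun s => u s 0 i') := lu i'.
rewrite /iterated_integral -RintegralB //; [|exact: iterated_integral_integrable|exact: iterated_integral_integrable].
by apply: eq_Rintegral => s _; rewrite wedgeE !mxE; congr (_ - _); rewrite mulrC.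
Qed.

(** Attained lengths are kept as a relation, so that concatenation and automorphisms act on actual
    curves before any infimum is taken. *)
Definition reach g (l : R) := exists u,
  [/\ L1_control u, hcurve u 1 = g & l = primitive (fun s => N (u s)) 1].

Lemma reach_ge0 g l : reach g l -> 0 <= l.
Proof. by move=> [u [_ _ ->]]; apply: Rintegral_ge0 => s _; exact: sfnorm_ge0. Qed.

Lemma reach_vec v : reach (v, 0) (N v).
Proof.
have c (a : R) t : 0 <= t -> primitive (fun _ => a) t = a * t.
  move=> t0; rewrite /primitive Rintegral_cst //; congr (_ * _).
  have := @lebesgue_measure_itv R `[0, t]%R; rewrite /= lte_fin oppr0 adde0 => ->.
  by case: ltP => // t0'; apply/eqP; rewrite eq_le t0 t0'.
have lc : L1_control (fun _ => v).
  move=> i; apply: (@measurable_bounded_integrable _ _ _ _ (fun _ => v 0 i)) => //.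
    by have := @lebesgue_measure_itv R `[0, 1]%R; rewrite /= lte_fin ltr01 oppr0 adde0 => ->; rewrite ltry.
  exists `|v 0 i|; split; first exact: num_real.
  by move=> M hM t _ /=; exact: ltW.
exists (fun _ => v); split => //; last by rewrite c // mulr1.
apply/pair_equal_spec; split.
  by apply/rowP => j; rewrite hcurve1E c // mulr1.
apply/matrixP => i j; rewrite hcurve2E // [RHS]mxE.
suff -> : iterated_integral (fun _ => v 0 i) (fun _ => v 0 j) = iterated_integral (fun _ => v 0 j) (fun _ => v 0 i) by rewrite subrr mulr0.
apply: eq_Rintegral => s; rewrite inE /= in_itv /= => /andP[s0 _].
by rewrite !c //; ring.
Qed.

(** Concatenation of the controls; the second layers match by [iterated_integral_concat]. *)
Lemma reach_mul g h l m : reach g l -> reach h m -> reach (gmul g h) (l + m).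
Proof.
move=> [u1 [l1 <- ->]] [u2 [l2 <- ->]].
have l1' i : L1_unit (fun s => u1 s 0 i) := l1 i.
have l2' i : L1_unit (fun s => u2 s 0 i) := l2 i.
pose u t := if t <= 2^-1 then 2 *: u1 (2 * t) else 2 *: u2 (2 * t - 1).
have E i : (fun s => u s 0 i) = concat_control (fun s => u1 s 0 i) (fun s => u2 s 0 i).
  by apply/funext => s; rewrite /u /concat_control; case: ifP => _; rewrite mxE.
have lu : L1_control u.
  by move=> i; have := (concat_L1_primitive (l1' i) (l2' i)).1; rewrite -E.
exists u; split => //.
  apply/pair_equal_spec; split.
    apply/rowP => j; apply: etrans (hcurve1E u j) _.
    rewrite (E j) gmul1E; apply: etrans (concat_L1_primitive (l1' j) (l2' j)).2 _.
    by congr (_ + _); apply/esym/hcurve1E.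
  apply/matrixP => i j; rewrite hcurve2E // (E i) (E j) (iterated_integral_concat (l1' i) (l2' i) (l1' j) (l2' j)) (iterated_integral_concat (l1' j) (l2' j) (l1' i) (l2' i)).
  move: (hcurve2E i j l1) (hcurve2E i j l2) (hcurve1E u1 i) (hcurve1E u1 j) (hcurve1E u2 i) (hcurve1E u2 j).
  by move: (hcurve u1 1) (hcurve u2 1) => H1 H2; rewrite gmul2E => -> -> -> -> -> ->; ring.
have -> : (fun s => N (u s)) = concat_control (fun s => N (u1 s)) (fun s => N (u2 s)).
  by apply/funext => s; rewrite /u /concat_control; case: ifP => _; rewrite sfnormZ // ger0_norm.
by rewrite (concat_L1_primitive (sfnorm_comp_L1 hN l1) (sfnorm_comp_L1 hN l2)).2.
Qed.

Lemma reach_act A K g l : (forall x, N (x *m A) <= K * N x) -> reach g l ->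
  exists2 l', l' <= K * l & reach (gact A g) l'.
Proof.
move=> hA [u [lu <- ->]].
have l' i : L1_unit (fun s => u s 0 i) := lu i.
pose u' t := u t *m A.
have E i : (fun s => u' s 0 i) = (fun s => \sum_k u s 0 k * A k i).
  by apply/funext => s; rewrite /u' mxE.
have lu' : L1_control u'.
  move=> i; suff : L1_unit (fun s => u' s 0 i) by [].
  by rewrite E; apply: integrable_lincomb.
exists (primitive (fun s => N (u' s)) 1).
  rewrite /primitive -RintegralZl //; last exact: sfnorm_comp_L1.
  apply: le_Rintegral => //; [exact: sfnorm_comp_L1|apply: integrable_EFinZl => //; exact: sfnorm_comp_L1|].
  by move=> x _; exact: hA.
exists u'; split => //; apply/pair_equal_spec; split.
  by apply/rowP => j; rewrite hcurve1E (E j) primitive_sum // [RHS]mxE; apply: eq_bigr => k _; rewrite hcurve1E.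
apply/matrixP => i j; rewrite hcurve2E // (E i) (E j) !iterated_integral_sum // [RHS]mxE.
rewrite [X in _ - X]exchange_big /= -sumrB mulr_sumr [LHS](eq_bigr (fun k => \sum_l (A k i * (hcurve u 1).2 k l * A l j))); last first.
  move=> k _; rewrite -sumrB mulr_sumr; apply: eq_bigr => m _.
  by rewrite hcurve2E //; ring.
rewrite exchange_big /=; apply: eq_bigr => m _; rewrite !mxE mulr_suml.
by apply: eq_bigr => k _; rewrite !mxE.
Qed.

(** The L1 norm of each coordinate of the control is at most C l, and an iterated integral is at
    most the product of two such norms. The constant C + C^2 serves both layers. *)
Lemma reach_bound : exists2 C, 0 < C & forall g l, reach g l ->
  (forall i, `|g.1 0 i| <= C * l) /\ (forall i j, `|g.2 i j| <= C * l ^+ 2).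
Proof.
have [C C0 hC] := sfnorm_lower hN.
exists (C + C ^+ 2); first by rewrite addr_gt0 // exprn_gt0.
move=> g l rl; have l0 := reach_ge0 rl; case: rl => u [lu <- el].
have H i : primitive (fun s => `|u s 0 i|) 1 <= C * l.
  rewrite el /primitive -RintegralZl //; last exact: sfnorm_comp_L1.
  apply: le_Rintegral => //.
  - exact: (@integrable_norm _ (measurableTypeR R) R mu `[0%R, 1%R]%classic (fun t => u t 0 i) (lu i)).
  - by apply: integrable_EFinZl => //; exact: sfnorm_comp_L1.
have P i : 0 <= primitive (fun s => `|u s 0 i|) 1 by apply: Rintegral_ge0.
split.
  move=> i; rewrite hcurve1E; apply: le_trans (primitive_bound (lu i) (lexx 1)) _.
  by apply: le_trans (H i) _; rewrite ler_wpM2r // lerDl exprn_ge0 // ltW.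
move=> i j; rewrite hcurve2E //.
have A a b : `|iterated_integral (fun s => u s 0 a) (fun s => u s 0 b)| <= C ^+ 2 * l ^+ 2.
  apply: le_trans (iterated_integral_bound (lu a) (lu b)) _.
  by rewrite -exprMn expr2; apply: ler_pM.
rewrite normrM ger0_norm //.
apply: le_trans (_ : 2^-1 * (C ^+ 2 * l ^+ 2 + C ^+ 2 * l ^+ 2) <= _).
  by rewrite ler_pM2l //; apply: le_trans (ler_normB _ _) _; apply: lerD.
have : 0 <= C * l ^+ 2 by rewrite mulr_ge0 ?exprn_ge0 // ltW.
lra.
Qed.

Lemma reach_wedge v w : reach (0, wedge v w) (2 * N v + 2 * N w).
Proof.
rewrite -commutatorE.
have -> : 2 * N v + 2 * N w = (N v + N w) + (N (- v) + N (- w)) by rewrite !sfnormN //; ring.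
by do 2?apply: reach_mul; apply: reach_vec.
Qed.

Lemma reach_sum (I : Type) (r : seq I) (F : I -> 'M[R]_n) (l : I -> R) :
  (forall i, reach (0, F i) (l i)) -> reach (0, \sum_(i <- r) F i) (\sum_(i <- r) l i).
Proof.
move=> h; elim: r => [|i r IH].
  by rewrite !big_nil -(sfnorm0 hN); exact: reach_vec.
rewrite !big_cons; have := reach_mul (h i) IH.
rewrite /gmul /= add0r (_ : wedge 0 0 = 0) ?scaler0 ?addr0 //.
by apply/matrixP => a b; rewrite wedgeE !mxE; ring.
Qed.

(** Y is split into commutators. The explicit length shows that every point is reached and, in
    [dist0_box], that the distance is bounded on a box. *)
Lemma reach_exists g : Gset g ->
  reach g (N g.1 + \sum_i \sum_j (2 * N ((g.2 i j / 2) *: delta_mx 0 i) + 2 * N (delta_mx 0 j))).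
Proof.
case: g => x Y /= aY.
have -> : (x, Y) = gmul (x, 0) (0, \sum_i \sum_j wedge ((Y i j / 2) *: delta_mx 0 i) (delta_mx 0 j : 'rV[R]_n)).
  rewrite /gmul /= -antisym_sum_wedge // add0r addr0.
  rewrite (_ : wedge x 0 = 0) ?scaler0 ?addr0 //.
  by apply/matrixP => a b; rewrite wedgeE !mxE; ring.
apply: reach_mul; first exact: reach_vec.
by apply: reach_sum => i; apply: reach_sum => j; apply: reach_wedge.
Qed.

(* The curves of [dcc N g gid] lead from g to the identity, so their controls reach g^-1. *)
Definition dist0 g : R := inf [set l | reach (gopp g) l].

Lemma dist0_has_inf g : Gset g -> has_inf [set l | reach (gopp g) l].
Proof.
move=> Gg; split; first by eexists; exact: (reach_exists (Gset_opp Gg)).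
by exists 0 => l; exact: reach_ge0.
Qed.

Lemma dist0_le g l : reach (gopp g) l -> dist0 g <= l.
Proof. by move=> rl; apply: ge_inf => //; exists 0 => m; exact: reach_ge0. Qed.

Lemma dist0_approx g e : Gset g -> 0 < e -> exists2 l, reach (gopp g) l & l < dist0 g + e.
Proof. by move=> Gg e0; have [l] := inf_adherent e0 (dist0_has_inf Gg); exists l. Qed.

Lemma dcc_dist0 g : Gset g -> dcc N g (gid R n) = (dist0 g)%:E.
Proof.
move=> Gg; have [h1 h2] := dist0_has_inf Gg.
rewrite -ereal_inf_EFin //; congr ereal_inf; apply/seteqP; split => y /=.
  move=> [u [lu /gmul_eq_gid eu] <-].
  exists (primitive (fun s => N (u s)) 1); first by exists u.
  rewrite /primitive /Rintegral fineK //; exact: (integrable_fin_num _ (sfnorm_comp_L1 hN lu)).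
move=> [l [u [lu eu ->]] <-]; exists u; first by split => //; apply/gmul_eq_gid.
rewrite /hlength /primitive /Rintegral fineK //; exact: (integrable_fin_num _ (sfnorm_comp_L1 hN lu)).
Qed.

Lemma dist0_ge0 g : Gset g -> 0 <= dist0 g.
Proof. by move=> Gg; apply: lb_le_inf (dist0_has_inf Gg).1 _ => l; exact: reach_ge0. Qed.

Lemma dist0_mul g h : Gset g -> Gset h -> dist0 (gmul g h) <= dist0 g + dist0 h.
Proof.
move=> Gg Gh; apply/ler_addgt0Pr => e e0.
have e2 : 0 < e / 2 by rewrite divr_gt0.
have [l rl hl] := dist0_approx Gg e2.
have [m rm hm] := dist0_approx Gh e2.
(* Inversion reverses the product, so the curve belonging to [h] comes first. *)
apply: le_trans (_ : m + l <= _); last lra.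
by apply: dist0_le; rewrite gopp_mul; apply: reach_mul.
Qed.

Lemma dist0_act A K g : 0 <= K -> (forall x, N (x *m A) <= K * N x) -> Gset g ->
  dist0 (gact A g) <= K * dist0 g.
Proof.
move=> K0 hA Gg; apply/ler_addgt0Pr => e e0.
(* The denominator is K + 1 because K may be 0. *)
have e2 : 0 < e / (K + 1) by rewrite divr_gt0 // ltr_wpDl.
have [l rl hl] := dist0_approx Gg e2.
have [l' hl' rl'] := reach_act hA rl.
rewrite -gopp_act in rl'; apply: le_trans (dist0_le rl') _.
apply: le_trans hl' _; apply: le_trans (ler_wpM2l K0 (ltW hl)) _.
rewrite mulrDr lerD2l mulrCA ger_pMr // ler_pdivrMr ?mul1r; [lra|lra].
Qed.

Lemma dist0_vec v : dist0 (v, 0) <= N v.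
Proof. by apply: dist0_le; rewrite /gopp /= oppr0 -(sfnormN hN v); apply: reach_vec. Qed.

Lemma dist0_coord_le : exists2 C, 0 < C & forall g, Gset g ->
  (forall i, `|g.1 0 i| <= C * dist0 g) /\ (forall i j, `|g.2 i j| <= C * dist0 g ^+ 2).
Proof.
have [C C0 hC] := reach_bound; exists C => // g Gg.
have d0 := dist0_ge0 Gg.
split => [i|i j]; apply/ler_addgt0Pr => e e0.
  have e2 : 0 < e / C by rewrite divr_gt0.
  have [l /hC[/(_ i) + _] hl] := dist0_approx Gg e2.
  rewrite /gopp /= mxE normrN => /le_trans; apply.
  have := ler_wpM2l (ltW C0) (ltW hl); rewrite mulrDr [C * (e / C)]mulrC divfK // gt_eqF //.
set d := dist0 g in d0 *.
(* For t at most 1, (d + t)^2 is at most d^2 + t (2 d + 1); the other argument of the minimum makes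
   C times this excess at most e. *)
pose t := Num.min 1 (e / (C * (2 * d + 1))).
have t0 : 0 < t.
  by rewrite lt_min ltr01 /= divr_gt0 // mulr_gt0 // ltr_wpDl // mulr_ge0.
have [l rl hl] := dist0_approx Gg t0; have l0 := reach_ge0 rl.
have [_ /(_ i j)] := hC _ _ rl.
rewrite /gopp /= mxE normrN => /le_trans; apply.
rewrite -/d in hl.
have t1 : t <= 1 by rewrite ge_min lexx.
have : t * (C * (2 * d + 1)) <= e.
  rewrite -ler_pdivlMr; first by rewrite ge_min lexx orbT.
  by rewrite mulr_gt0 // ltr_wpDl // mulr_ge0.
have : l ^+ 2 <= d ^+ 2 + t * (2 * d + 1).
  have : l ^+ 2 <= (d + t) ^+ 2 by rewrite ler_sqr ?nnegrE //; lra.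
  have : t * t <= t by rewrite ger_pMr.
  lra.
move/(ler_wpM2l (ltW C0)); lra.
Qed.

Lemma dist0_box : exists2 C, 0 < C & forall g, Gset g ->
  (forall i, `|g.1 0 i| <= 1) -> (forall i j, `|g.2 i j| <= 1) -> dist0 g <= C.
Proof.
have [C C0 hC] := sfnorm_le_l1 hN.
pose M := C * n%:R + \sum_(i < n) \sum_(j < n) (2 * N (delta_mx 0 i) + 2 * N (delta_mx 0 j)).
have M0 : 0 <= M.
  apply: addr_ge0; first by rewrite mulr_ge0 // ltW.
  by apply: sumr_ge0 => i _; apply: sumr_ge0 => j _; rewrite addr_ge0 // mulr_ge0 // sfnorm_ge0.
exists (M + 1); first lra.
move=> g Gg h1 h2; apply: le_trans (dist0_le (reach_exists (Gset_opp Gg))) _.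
apply: le_trans (_ : M <= _); last lra.
apply: lerD.
  rewrite sfnormN //; apply: le_trans (hC _) _; rewrite ler_pM2l //.
  by apply: le_trans (sum_le_card h1) _; rewrite card_ord mulr1.
apply: ler_sum => i _; apply: ler_sum => j _; rewrite lerD2r ler_pM2l // sfnormZ //.
apply: ler_piMl; first exact: sfnorm_ge0.
by rewrite normrM normfV [`|2|]ger0_norm // mxE normrN ler_pdivrMr // mul1r; apply: le_trans (h2 i j) _; lra.
Qed.

End Distance.

(** * Directions of Lipschitz regularity *)

Section Moves.
Variables (R : realType) (n : nat) (N : 'rV[R]_n -> R).
Hypothesis hN : is_norm N.
Implicit Types (v w x : 'rV[R]_n) (Y : 'M[R]_n).
Notation D := (dist0 N).

(** Multiplication by v / 2 on both sides moves x alone, because the two second-layer corrections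
    cancel. *)
Lemma dist0_addx x v Y : antisym Y -> D (x + v, Y) <= D (x, Y) + N v.
Proof.
move=> aY; have G1 := Gset_vec (2^-1 *: v).
have G2 : Gset (x, Y) by [].
have := dist0_mul hN (Gset_mul G1 G2) G1.
have -> : gmul (gmul (2^-1 *: v, 0) (x, Y)) (2^-1 *: v, 0) = (x + v, Y).
  apply/pair_equal_spec; split; first by apply/rowP => i; rewrite !mxE; field.
  by apply/matrixP => i j; rewrite !mxE !big_ord1 !mxE; field.
have := dist0_mul hN G1 G2; have := dist0_vec hN (2^-1 *: v).
rewrite sfnormZ // ger0_norm //; lra.
Qed.

Lemma dist0_conj x v Y : antisym Y -> D (x, Y + wedge v x) <= D (x, Y) + 2 * N v.
Proof.
move=> aY; have G1 := Gset_vec v; have G1' := Gset_vec (- v).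
have G2 : Gset (x, Y) by [].
have := dist0_mul hN (Gset_mul G1 G2) G1'.
have -> : gmul (gmul (v, 0) (x, Y)) (- v, 0) = (x, Y + wedge v x).
  apply/pair_equal_spec; split; first by apply/rowP => i; rewrite !mxE; ring.
  by apply/matrixP => i j; rewrite !mxE !big_ord1 !mxE; field.
have := dist0_mul hN G1 G2; have := dist0_vec hN v; have := dist0_vec hN (- v).
rewrite sfnormN //; lra.
Qed.

Lemma antisym_quad Y (a : 'cV[R]_n) : antisym Y -> a^T *m Y *m a = 0.
Proof.
move=> aY; set q := _ *m a.
have qT : q^T = - q by rewrite /q !trmx_mul trmxK aY mulNmx mulmxN mulmxA.
apply/matrixP => i j; rewrite !ord1 mxE.
by move/matrixP: qT => /(_ 0 0); rewrite !mxE; lra.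
Qed.

(** The quadratic term w^T (a^T Y a) w vanishes by antisymmetry, so the displacement is exact and
    not only correct to first order. *)
Lemma act_transvection Y (a : 'cV[R]_n) w : antisym Y ->
  (1%:M + a *m w)^T *m Y *m (1%:M + a *m w) = Y + wedge (Y *m a)^T w.
Proof.
move=> aY; rewrite /wedge trmxK.
have -> : (1%:M + a *m w)^T = 1%:M + w^T *m a^T by rewrite linearD /= tr_scalar_mx trmx_mul.
rewrite mulmxDl mul1mx mulmxDr mulmx1.
have E0 : w^T *m a^T *m Y *m (a *m w) = 0.
  by rewrite -!mulmxA (mulmxA Y) (mulmxA a^T) (mulmxA a^T) antisym_quad // mul0mx mulmx0.
have E1 : w^T *m a^T *m Y = - (w^T *m (Y *m a)^T).
  by rewrite trmx_mul aY mulmxN mulmxN opprK mulmxA.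
by rewrite mulmxDl E0 addr0 E1 mulmxA -addrA; congr (_ + _); rewrite addrC.
Qed.

(* The automorphism induced by 1 + a w changes the distance by a factor 1 + O(|a| |w|);
   the induced displacement of x is undone at a cost of the same order. *)
Lemma dist0_transvection : exists2 C : R, 0 < C & forall x Y (a : 'cV[R]_n) (b : R) w,
  antisym Y -> 0 <= b -> (forall i, `|a i 0| <= b) ->
  D (x, Y + wedge (Y *m a)^T w) <= D (x, Y) + C * b * N w * (D (x, Y) + \sum_i `|x 0 i|).
Proof.
have [C C0 hC] := sfnorm_lower hN.
have CC : 0 <= n%:R * C by rewrite mulr_ge0 // ltW.
exists (1 + n%:R * C) => [|x Y a b w aY b0 ha]; first lra.
have Gg : Gset (x, Y) by [].
have d0 := dist0_ge0 hN Gg; have w0 := sfnorm_ge0 hN w.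
have xa (y : 'rV[R]_n) : `|(y *m a) 0 0| <= b * \sum_i `|y 0 i|.
  rewrite mxE; apply: le_trans (ler_norm_sum _ _ _) _; rewrite mulr_sumr.
  by apply: ler_sum => i _; rewrite normrM mulrC ler_wpM2r.
have E (y : 'rV[R]_n) : y *m (1%:M + a *m w) = y + (y *m a) 0 0 *: w.
  by rewrite mulmxDr mulmx1 mulmxA; congr (_ + _); rewrite {1}[y *m a]mx11_scalar mul_scalar_mx.
(* Operator norm bound for 1 + a w: |y a| is at most b times the l1 norm of y, hence at most b n C N
   y. *)
pose K := 1 + b * N w * (n%:R * C).
have K0 : 0 <= K by rewrite addr_ge0 // mulr_ge0 // mulr_ge0.
have hK (y : 'rV[R]_n) : N (y *m (1%:M + a *m w)) <= K * N y.
  rewrite E; apply: le_trans (sfnormD hN _ _) _; rewrite sfnormZ // /K mulrDl mul1r lerD2l.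
  apply: le_trans (ler_wpM2r w0 (xa y)) _.
  have h : \sum_i `|y 0 i| <= n%:R * C * N y.
    have := sum_le_card (hC y); by rewrite card_ord mulrA.
  have := ler_wpM2l (mulr_ge0 b0 w0) h; lra.
have := dist0_act hN K0 hK Gg.
rewrite /gact /= act_transvection // E => h.
have aY' : antisym (Y + wedge (Y *m a)^T w).
  rewrite /antisym -act_transvection //; exact: (Gset_act (1%:M + a *m w) Gg).
have := dist0_addx (x + (x *m a) 0 0 *: w) (- ((x *m a) 0 0 *: w)) aY'.
rewrite addrK sfnormN // sfnormZ // => h2.
have h3 := ler_wpM2r w0 (xa x).
have S0 : 0 <= \sum_i `|x 0 i| by apply: sumr_ge0.
have h4 : 0 <= b * N w * D (x, Y) by rewrite !mulr_ge0.
have h5 : 0 <= n%:R * C * (b * N w * \sum_i `|x 0 i|) by rewrite !mulr_ge0 // ltW.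
rewrite /K in h; lra.
Qed.

Definition inbox (g : 'rV[R]_n * 'M[R]_n) :=
  [/\ antisym g.2, forall i, `|g.1 0 i| <= 1 & forall i j, `|g.2 i j| <= 1].

(** With w = z e_l, the transvection adds (Y a)^T /\ w and conjugation by - t w adds t x /\ w. So f
    = Y a + t x runs through the whole column space of [x | Y], at a cost linear in the coefficients
    since the distance is bounded on the box. *)
Lemma dist0_move : exists2 C : R, 0 < C & forall x Y (a : 'cV[R]_n) (t b z : R) l,
  inbox (x, Y) -> 0 <= b -> (forall i, `|a i 0| <= b) -> `|t| <= b ->
  D (x, Y + z *: wedge ((Y *m a)^T + t *: x) (delta_mx 0 l)) <= D (x, Y) + C * b * `|z|.
Proof.
have [C C0 hC] := dist0_transvection.
have [M M0 hM] := dist0_box hN.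
pose S := \sum_i N (delta_mx 0 i).
have hS l : N (delta_mx 0 l) <= S.
  rewrite /S (bigD1 l) //= lerDl; apply: sumr_ge0 => i _; exact: sfnorm_ge0.
have S0 : 0 <= S by apply: sumr_ge0 => i _; exact: sfnorm_ge0.
have K1 : 0 <= C * S * (M + n%:R) by rewrite !mulr_ge0 // ?addr_ge0 // ltW.
exists (C * S * (M + n%:R) + 2 * S + 1) => [|x Y a t b z l [/= aY x1 Y1] b0 ha ht]; first lra.
pose w : 'rV[R]_n := z *: delta_mx 0 l.
have Nw : N w <= `|z| * S by rewrite sfnormZ // ler_wpM2l.
have -> : Y + z *: wedge ((Y *m a)^T + t *: x) (delta_mx 0 l) =
  Y + wedge (Y *m a)^T w + wedge (- t *: w) x.
  by apply/matrixP => i j; rewrite !mxE !big_ord1 !mxE; ring.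
have aY' : antisym (Y + wedge (Y *m a)^T w).
  rewrite /antisym -act_transvection //; exact: (Gset_act (1%:M + a *m w) (aY : Gset (x, Y))).
apply: le_trans (dist0_conj _ _ aY') _.
have h1 := hC x Y a b w aY b0 ha.
have h2 : D (x, Y) + \sum_i `|x 0 i| <= M + n%:R.
  apply: lerD; first exact: hM.
  by apply: le_trans (sum_le_card x1) _; rewrite card_ord mulr1.
have w0 := sfnorm_ge0 hN w.
have h3 : C * b * N w * (D (x, Y) + \sum_i `|x 0 i|) <= C * b * (`|z| * S) * (M + n%:R).
  apply: ler_pM => //.
  - by rewrite !mulr_ge0 // ltW.
  - by rewrite addr_ge0 ?dist0_ge0 // sumr_ge0.
  - by apply: ler_wpM2l => //; rewrite mulr_ge0 // ltW.
have h4 : N (- t *: w) <= b * (`|z| * S).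
  by rewrite sfnormZ // normrN; apply: ler_pM.
have h5 : 0 <= b * `|z| by rewrite mulr_ge0.
lra.
Qed.

Lemma dist0_xmove : exists2 C : R, 0 < C & forall x Y (z : R) l,
  antisym Y -> D (x + z *: delta_mx 0 l, Y) <= D (x, Y) + C * `|z|.
Proof.
exists (1 + \sum_i N (delta_mx 0 i)).
  by apply: ltr_pwDl => //; apply: sumr_ge0 => i _; exact: sfnorm_ge0.
move=> x Y z l aY; apply: le_trans (dist0_addx _ _ aY) _.
rewrite lerD2l sfnormZ // mulrC ler_wpM2r //.
rewrite (bigD1 l) //= addrCA lerDl addr_ge0 // sumr_ge0 // => i _; exact: sfnorm_ge0.
Qed.

(** The dilation is the automorphism induced by a scalar matrix; applying the inequality to c^-1 as
    well gives equality. *)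
Lemma dist0_scale (x : 'rV[R]_n) Y (c : R) : 0 < c -> antisym Y ->
  D (c *: x, c ^+ 2 *: Y) = c * D (x, Y).
Proof.
have h (y : 'rV[R]_n) Z (k : R) : 0 < k -> antisym Z -> D (k *: y, k ^+ 2 *: Z) <= k * D (y, Z).
  move=> k0 aZ; have Gg : Gset (y, Z) by [].
  have := @dist0_act _ _ _ hN (k%:M) k _ (ltW k0) _ Gg; rewrite /gact /=.
  rewrite mul_mx_scalar tr_scalar_mx mul_scalar_mx mul_mx_scalar scalerA -expr2; apply => w.
  by rewrite mul_mx_scalar sfnormZ // gtr0_norm.
move=> c0 aY; apply/eqP; rewrite eq_le h //= -ler_pdivlMl //.
have := h (c *: x) (c ^+ 2 *: Y) c^-1; rewrite !scalerA -exprMn mulVf ?gt_eqF // expr1n !scale1r.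
apply; first by rewrite invr_gt0.
by rewrite /antisym linearZ /= aY scalerN.
Qed.

End Moves.

(** * Quantitative rank of a matrix by complete pivoting *)

Section Pivoting.
Variables (R : realFieldType) (n q : nat).
Implicit Types (M : 'I_n -> 'I_q -> R) (s K : R).

Definition pairing M (b : 'I_q -> R) (i : 'I_n) := \sum_c M i c * b c.

Definition residual_small M s K (P : {set 'I_n}) := exists k : 'I_n -> 'I_n -> R,
  (forall i l, `|k i l| <= K) /\
  forall i c, i \notin P -> `|M i c - \sum_(l in P) k i l * M l c| <= s.

(* Complete pivoting: the vectors b l are dual to the pivot rows, and the third bound, on the
   projection of the basis vectors along the pivot columns, keeps K independent of s. *)
Definition pivoted M s K (P : {set 'I_n}) := exists b : 'I_n -> 'I_q -> R,
  [/\ forall l l', l \in P -> l' \in P -> pairing M (b l) l' = (l' == l)%:R,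
      forall i l, `|pairing M (b l) i| <= K,
      forall c c', `|(c' == c)%:R - \sum_(l in P) M l c * b l c'| <= K
    & forall l c, `|b l c| <= K / s].

Lemma pairingB M b b' i : pairing M (fun c => b c - b' c) i = pairing M b i - pairing M b' i.
Proof. by rewrite /pairing -sumrB; apply: eq_bigr => c _; rewrite mulrBr. Qed.

Lemma pairingZ M b k i : pairing M (fun c => k * b c) i = k * pairing M b i.
Proof. by rewrite /pairing mulr_sumr; apply: eq_bigr => c _; rewrite mulrCA. Qed.

Lemma pairing_delta M c i : pairing M (fun c' => (c' == c)%:R) i = M i c.
Proof.
rewrite /pairing (bigD1 c) //= eqxx mulr1 big1 ?addr0 // => c' /negbTE ->.
by rewrite mulr0.
Qed.

Lemma pairing_sum M (P : {set 'I_n}) (k : 'I_n -> R) b i :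
  pairing M (fun c => \sum_(l in P) k l * b l c) i = \sum_(l in P) k l * pairing M (b l) i.
Proof.
rewrite /pairing (eq_bigr (fun c => \sum_(l in P) k l * (M i c * b l c))).
  by rewrite exchange_big /=; apply: eq_bigr => l _; rewrite -mulr_sumr.
by move=> c _; rewrite mulr_sumr; apply: eq_bigr => l _; rewrite mulrCA.
Qed.

(** Elimination on the largest residual entry, provided it exceeds s. Maximality keeps all quotients
    by the pivot at most 1 in absolute value, so only the entries of the dual vectors pay 1 / s. The
    new bounds are 1 or 2 K for the pairings, 2 K for the projection and (K + K^2) / s for the
    vectors; 2 K + K^2 + 1 dominates all the constants. *)
Lemma pivot_step M s K (P : {set 'I_n}) : 0 < s -> 0 <= K -> pivoted M s K P ->
  residual_small M s K P \/
  exists2 i0, i0 \notin P & pivoted M s (2 * K + K ^+ 2 + 1) (i0 |: P).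
Proof.
move=> s0 K0 [b [b1 b2 b3 b4]].
(* [g c] is the basis vector c projected so that every pivot row annihilates it; [m] is the residual
   matrix, a Schur complement. *)
pose g c c' := (c' == c)%:R - \sum_(l in P) M l c * b l c'.
pose m i c := M i c - \sum_(l in P) pairing M (b l) i * M l c.
have gm i c : pairing M (g c) i = m i c.
  rewrite /g pairingB pairing_delta pairing_sum; congr (_ - _).
  by apply: eq_bigr => l _; rewrite mulrC.
have mP i c : i \in P -> m i c = 0.
  move=> iP; rewrite /m (bigD1 i) //= b1 // eqxx mul1r big1 ?addr0 ?subrr // => l /andP[lP li].
  by rewrite b1 // eq_sym (negbTE li) mul0r.
have [/forallP h|] := boolP [forall p : 'I_n * 'I_q, (p.1 \notin P) ==> (`|m p.1 p.2| <= s)].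
  left; exists (fun i l => pairing M (b l) i); split => // i c iP.
  by have /implyP := h (i, c); apply.
rewrite negb_forall => /existsP[p0]; rewrite negb_imply => /andP[p0P hp0]; right.
rewrite -ltNge in hp0.
case: (@Order.TotalTheory.arg_maxP _ _ _ p0 (fun p : 'I_n * 'I_q => p.1 \notin P) (fun p => `|m p.1 p.2|) p0P).
move=> [i0 c0] /= i0P mx.
have sv : s < `|m i0 c0| by apply: lt_le_trans hp0 (mx _ p0P).
set v := m i0 c0 in sv.
have v0 : v != 0 by rewrite -normr_gt0; apply: lt_trans sv.
(* The new dual vector is the projected basis vector of the pivot column, normalised on row [i0];
   the old dual vectors are corrected so that row [i0] annihilates them. *)
pose bi := fun c => v^-1 * g c0 c.
pose b' l := if l == i0 then bi else fun c => b l c - pairing M (b l) i0 * bi c.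
have pbi i : pairing M bi i = v^-1 * m i c0 by rewrite pairingZ gm.
have b'i0 : b' i0 = bi by rewrite /b' eqxx.
have b'l l : l \in P -> b' l = fun c => b l c - pairing M (b l) i0 * bi c.
  by move=> lP; rewrite /b' ifF //; apply/negbTE; apply: contraNneq i0P => <-.
have pbi1 i : `|pairing M bi i| <= 1.
  rewrite pbi; have [iP|iP] := boolP (i \in P); first by rewrite mP // mulr0 normr0.
  rewrite normrM normfV mulrC ler_pdivrMr ?mul1r ?normr_gt0 //; exact: (mx (i, c0) iP).
have pbl l i : pairing M (fun c => b l c - pairing M (b l) i0 * bi c) i =
   pairing M (b l) i - pairing M (b l) i0 * (v^-1 * m i c0).
  by rewrite pairingB pairingZ pbi.
have nP l : l \in P -> l != i0 by move=> lP; apply: contraNneq i0P => <-.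
have bic c : `|bi c| <= K / s.
  rewrite /bi normrM mulrC normfV; apply: ler_pM => //; first exact: b3.
  by rewrite lef_pV2 ?posrE ?normr_gt0 // ltW.
have K2 : 0 <= K ^+ 2 by rewrite exprn_ge0.
have si : 0 < s^-1 by rewrite invr_gt0.
exists i0 => //; exists b'; split.
- move=> l l'; rewrite !inE => /orP[/eqP ->|lP] /orP[/eqP ->|lP'].
  + by rewrite b'i0 pbi -/v mulVf // eqxx.
  + by rewrite b'i0 pbi mP // mulr0 (negbTE (nP _ lP')).
  + by rewrite b'l // pbl -/v mulVf // mulr1 subrr eq_sym (negbTE (nP _ lP)).
  + by rewrite b'l // pbl mP // !mulr0 subr0 b1.
- move=> i l; rewrite /b'; case: ifP => _; first by apply: le_trans (pbi1 i) _; lra.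
  rewrite pairingB pairingZ; apply: le_trans (ler_normB _ _) _; rewrite normrM.
  have := b2 i l; have : `|pairing M (b l) i0| * `|pairing M bi i| <= K * 1 by apply: ler_pM.
  lra.
- move=> c c'.
  rewrite big_setU1 //= b'i0.
  rewrite (eq_bigr (fun l => M l c * b l c' - (pairing M (b l) i0 * M l c) * bi c')); last first.
    by move=> l lP; rewrite b'l //; ring.
  rewrite sumrB -mulr_suml.
  have -> : (c' == c)%:R - (M i0 c * bi c' + (\sum_(l in P) M l c * b l c' - (\sum_(l in P) pairing M (b l) i0 * M l c) * bi c'))
    = g c c' - (m i0 c / v) * g c0 c'.
    by rewrite /g /m /bi /g; ring.
  apply: le_trans (ler_normB _ _) _.
  have : `|m i0 c / v * g c0 c'| <= 1 * K.
    rewrite normrM; apply: ler_pM => //; last exact: b3.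
    rewrite normrM normfV ler_pdivrMr ?mul1r ?normr_gt0 //; exact: (mx (i0, c) i0P).
  have := b3 c c'; rewrite -/(g c c'); lra.
- move=> l c; rewrite /b'; case: ifP => _.
    apply: le_trans (bic c) _; rewrite ler_pM2r //; lra.
  apply: le_trans (ler_normB _ _) _; rewrite normrM.
  have h1 : `|pairing M (b l) i0| * `|bi c| <= K * (K / s) by apply: ler_pM.
  apply: le_trans (lerD (b4 l c) h1) _.
  rewrite mulrA -mulrDl ler_pM2r // -expr2; lra.
Qed.

(** One step changes the bound K to 2 K + K^2 + 1 for every matrix and every s, so the final K
    depends only on the number of steps. The induction starts without pivots, where the projection
    is the identity. *)
Lemma pivoting r : (r <= n)%N -> exists2 K : R, 0 < K & forall M s, 0 < s ->
  (exists2 P : {set 'I_n}, (#|P| < r)%N & residual_small M s K P) \/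
  (exists2 P : {set 'I_n}, #|P| = r & pivoted M s K P).
Proof.
elim: r => [_|r IH rn].
  exists 1 => // M s s0; right; exists finset.set0; first by rewrite cards0.
  exists (fun _ _ => 0); split.
  - by move=> l l'; rewrite inE.
  - by move=> i l; rewrite /pairing big1 ?normr0 // => c _; rewrite mulr0.
  - by move=> c c'; rewrite big_set0 subr0 normr_nat; case: eqP => _; rewrite ?lexx ?ler01.
  - by move=> l c; rewrite normr0 divr_ge0 // ltW.
have [K K0 hK] := IH (ltnW rn).
have K2 : 0 <= K ^+ 2 by rewrite exprn_ge0 // ltW.
exists (2 * K + K ^+ 2 + 1) => [|M s s0]; first lra.
have mono P : residual_small M s K P -> residual_small M s (2 * K + K ^+ 2 + 1) P.
  by move=> [k [k1 k2]]; exists k; split => // i l; apply: le_trans (k1 i l) _; lra.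
case: (hK M s s0) => [[P Pr /mono h]|[P Pr h]].
  by left; exists P => //; apply: ltnW.
case: (pivot_step s0 (ltW K0) h) => [/mono h'|[i0 i0P h']].
  by left; exists P => //; rewrite Pr.
by right; exists (i0 |: P) => //; rewrite cardsU1 i0P Pr.
Qed.

(** Quantitative form of rank at most n - 2. The normalisation on rows i and j, together with the
    bound K, keeps the two relations uniformly independent as s tends to 0. *)
Definition degenerate M s K := exists i j (a b : 'I_n -> R),
  [/\ i != j, [/\ a i = 1, a j = 0, b i = 0 & b j = 1],
      forall l, `|a l| <= K /\ `|b l| <= K
    & forall c, `|\sum_l a l * M l c| <= s /\ `|\sum_l b l * M l c| <= s].

(* The two displayed forms of the combination both generate e_k /\ e_l, as
   f /\ e_l and - f /\ e_k respectively. *)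
Definition wedge_spanning M (C : R) := forall k l : 'I_n, k != l ->
  exists (b : 'I_q -> R) (r : R), (forall c, `|b c| <= C) /\
  ((forall i, pairing M b i = (i == k)%:R + r * (i == l)%:R) \/
   (forall i, pairing M b i = (i == l)%:R + r * (i == k)%:R)).

(** Pivoting aims at n - 1 pivots. If it stops earlier, two rows are left over and their residuals
    are the two relations. Otherwise a single row [i0] is left over, and the dual vector of e pairs
    to e_e + r e_i0; for k and l different from [i0], the component along [i0] is eliminated between
    two such vectors. *)
Lemma degenerate_or_spanning : (0 < n)%N -> exists2 K : R, 0 < K & forall M s, 0 < s ->
  degenerate M s K \/ wedge_spanning M (K / s).
Proof.
move=> n0; have [K K0 hK] := pivoting (leq_pred n).
(* Covers the coefficients, at most 1 + K, of the relations and the entries, at most 2 K / s, of the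
   combined dual vectors. *)
exists (2 * K + 1) => [|M s s0]; first lra.
have si : 0 < s^-1 by rewrite invr_gt0.
case: (hK M s s0) => [[P Pn [k [k1 k2]]]|[P Pn [b [b1 b2 _ b4]]]].
  left.
  have : (1 < #|~: P|)%N by rewrite cardsCs finset.setCK card_ord; lia.
  move=> /card_gt1P[i [j [iP jP ij]]]; rewrite !inE in iP jP.
  pose a i l : R := (l == i)%:R - (l \in P)%:R * k i l.
  exists i, j, (a i), (a j); split => //.
  - rewrite /a !eqxx (negbTE iP) (negbTE jP) !mul0r !subr0 [j == i]eq_sym (negbTE ij).
    by split.
  - have h e l : `|a e l| <= 2 * K + 1.
      rewrite /a; apply: le_trans (ler_normB _ _) _.
      have : `|(l == e)%:R| <= (1 : R) by rewrite normr_nat; case: eqP => _; rewrite ?lexx ?ler01.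
      have : `|(l \in P)%:R * k e l| <= K.
        by case: (l \in P); rewrite ?mul1r // mul0r normr0 ltW.
      lra.
    by move=> l; split.
  - have h e : e \notin P -> forall c, `|\sum_l a e l * M l c| <= s.
      move=> eP c; rewrite (_ : \sum_l _ = M e c - \sum_(l in P) k e l * M l c); first exact: k2.
      rewrite (eq_bigr (fun l => (l == e)%:R * M l c - (if l \in P then k e l * M l c else 0))); last first.
        by move=> l _; rewrite mulrBl; congr (_ - _); case: (l \in P); rewrite ?mul1r ?mul0r.
      rewrite sumrB -big_mkcond /= (bigD1 e) //= eqxx mul1r big1 ?addr0 // => l /negbTE ->.
      by rewrite mul0r.
    by move=> c; split; apply: h.
right => k l kl.
have : #|~: P| == 1%N by rewrite cardsCs finset.setCK card_ord; lia.
move=> /cards1P[i0 eP].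
have inP i : (i \in P) = (i != i0) by rewrite -[P]finset.setCK eP !inE.
have KK : K / s <= (2 * K + 1) / s by rewrite ler_pM2r //; lra.
have single e i : e != i0 -> pairing M (b e) i = (i == e)%:R + pairing M (b e) i0 * (i == i0)%:R.
  move=> ee; have [->|ii] := eqVneq i i0.
    by rewrite eq_sym (negbTE ee) add0r mulr1.
  by rewrite mulr0 addr0 b1 // inP.
have [ek|ek] := eqVneq k i0.
  have el : l != i0 by rewrite -ek eq_sym.
  exists (b l), (pairing M (b l) i0); split; first by move=> c; apply: le_trans (b4 l c) KK.
  by right => i; rewrite single // ek.
have [el|el] := eqVneq l i0.
  exists (b k), (pairing M (b k) i0); split; first by move=> c; apply: le_trans (b4 k c) KK.
  by left => i; rewrite single // el.
(* The vector with the smaller component along [i0] is corrected by the other one, so the quotient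
   stays at most 1; if the larger component is 0, both vanish and nothing has to be eliminated. *)
have combine e e' : e != i0 -> e' != i0 -> `|pairing M (b e) i0| <= `|pairing M (b e') i0| ->
  exists (c : 'I_q -> R) (r : R), (forall i, `|c i| <= (2 * K + 1) / s) /\
    (forall i, pairing M c i = (i == e)%:R + r * (i == e')%:R).
  move=> he he' hle; have [z|z] := eqVneq (pairing M (b e') i0) 0.
    have z' : pairing M (b e) i0 = 0 by apply/eqP; rewrite -normr_le0 -(normr0 R) -z.
    exists (b e), 0; split; first by move=> c; apply: le_trans (b4 e c) KK.
    by move=> i; rewrite single // z' !mul0r.
  set r := pairing M (b e) i0 / pairing M (b e') i0.
  have r1 : `|r| <= 1 by rewrite normrM normfV ler_pdivrMr ?normr_gt0 // mul1r.
  exists (fun c => b e c - r * b e' c), (- r); split.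
    move=> c; apply: le_trans (ler_normB _ _) _; rewrite normrM.
    have : `|r| * `|b e' c| <= 1 * (K / s) by apply: ler_pM.
    have := b4 e c; rewrite mul1r mulrDl mul1r -mulrA; lra.
  move=> i; rewrite pairingB pairingZ (single _ i he) (single _ i he').
  have E : pairing M (b e) i0 = r * pairing M (b e') i0 by rewrite /r divfK.
  by rewrite E; ring.
have [hle|/ltW hle] := leP `|pairing M (b k) i0| `|pairing M (b l) i0|.
  by have [c [r [h1 h2]]] := combine _ _ ek el hle; exists c, r; split => //; left.
by have [c [r [h1 h2]]] := combine _ _ el ek hle; exists c, r; split => //; right.
Qed.

End Pivoting.

(* The pair (x, Y) is encoded as an antisymmetric matrix of size n + 1 with row 0 equal to
   (0, x): {0, i+1} indexes the coordinate x_i and {i+1, j+1} the coordinate Y_ij. *)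
Notation edge n := {A : {set 'I_n.+1} | #|A| == 2%N}.

Lemma set2_inj (T : finType) (a b i j : T) : a != b -> [set a; b] = [set i; j] ->
  (a = i /\ b = j) \/ (a = j /\ b = i).
Proof.
move=> ab S; have ha : a \in [set i; j] by rewrite -S !inE eqxx.
have hb : b \in [set i; j] by rewrite -S !inE eqxx orbT.
move: ha hb ab; rewrite !inE => /orP[] /eqP -> /orP[] /eqP -> //; rewrite ?eqxx //; first by left.
by right.
Qed.

(** * Coordinates on the group indexed by two-element sets *)

Section Coordinates.
Variables (R : realType) (n : nat).
Implicit Types (v : edge n -> R) (t : edge n) (i j : 'I_n.+1).

Lemma card_edge : #|{: edge n}| = (n + 'C(n, 2))%N.
Proof.
have := card_draws 'I_n.+1 2; rewrite card_ord => h.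
rewrite card_sig -[LHS]/(#|[pred A : {set 'I_n.+1} | #|A| == 2%N]|).
rewrite -(cardsE [pred A : {set 'I_n.+1} | #|A| == 2%N]) h binS bin1 addnC //.
Qed.

(** For i = j the set is a singleton, so [insub] fails and the diagonal entry is 0. *)
Definition entry v i j : R :=
  if insub [set i; j] is Some t then (if (i < j)%N then v t else - v t) else 0.

Lemma entry_diag v i : entry v i i = 0.
Proof. by rewrite /entry insubF // finset.setUid cards1. Qed.

Lemma entryC v i j : entry v j i = - entry v i j.
Proof.
rewrite /entry finset.setUC; case: insubP => [t tp e|_]; last by rewrite oppr0.
have : i != j by rewrite -(inj_eq val_inj); apply/eqP => ij; move: tp; rewrite (val_inj ij) finset.setUid cards1.
by rewrite neq_ltn => /orP[] h; rewrite h ltnNge (ltnW h) /= ?opprK.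
Qed.

Lemma edgeP t : exists i j, [/\ (i < j)%N, val t = [set i; j] & forall v, entry v i j = v t].
Proof.
have /cards2P[i [j [ij e]]] := valP t.
have h a b : val t = [set a; b] -> (a < b)%N -> forall v, entry v a b = v t.
  move=> e' ab v; rewrite /entry -e' ab.
  case: insubP => [u _ /val_inj -> //|]; by rewrite (valP t).
have : (i != j :> nat) by [].
rewrite neq_ltn => /orP[] ij'; first by exists i, j; split => //; apply: h.
exists j, i; split => //; first by rewrite e finset.setUC.
by apply: h => //; rewrite e finset.setUC.
Qed.

Definition shift_coord v t (z : R) : edge n -> R := fun t' => v t' + (if t' == t then z else 0).

Lemma entry_shift_coord v t z i j : (i < j)%N -> val t = [set i; j] -> forall a b,
  entry (shift_coord v t z) a b = entry v a b + z * ((a == i)%:R * (b == j)%:R - (a == j)%:R * (b == i)%:R).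
Proof.
move=> ij e a b.
have ij' : (j == i) = false by apply/negbTE; rewrite -(inj_eq val_inj) neq_ltn ij orbT.
rewrite /entry; case: insubP => [u ue eu|nu].
  have ab : a != b by apply/eqP => ab; move: ue; rewrite ab finset.setUid cards1.
  rewrite /shift_coord; case: eqP => [ut|ut].
    have /(set2_inj ab)[[-> ->]|[-> ->]] : [set a; b] = [set i; j] by rewrite -eu ut.
      by rewrite ij !eqxx ij' [i == j]eq_sym ij' /=; ring.
    by rewrite !eqxx [i == j]eq_sym !ij' ltnNge (ltnW ij) /=; ring.
  have : ~ ([set a; b] = [set i; j]) by rewrite -eu -e => /val_inj.
  have [->|ai] := eqVneq a i.
    have [-> //|bj] := eqVneq b j; rewrite [i == j]eq_sym ij' => _.
    by case: ifP => _ /=; ring.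
  have [->|aj] := eqVneq a j.
    have [->|bi] := eqVneq b i; first by rewrite finset.setUC.
    by move=> _; case: ifP => _ /=; ring.
  by move=> _; case: ifP => _ /=; ring.
have ab : a = b.
  by apply/eqP; apply: contraNT nu => ab; rewrite cards2 ab.
subst b; have [->|ai] := eqVneq a i; first by rewrite [i == j]eq_sym ij' /=; ring.
by case: (a == j) => /=; ring.
Qed.

Definition coord_pt v : 'rV[R]_n * 'M[R]_n :=
  (\row_i entry v ord0 (lift ord0 i), \matrix_(i, j) entry v (lift ord0 i) (lift ord0 j)).

Lemma coord_pt_Gset v : Gset (coord_pt v).
Proof. by apply/matrixP => i j; rewrite !mxE entryC. Qed.

Definition gentry (g : 'rV[R]_n * 'M[R]_n) i j : R :=
  match unlift ord0 i, unlift ord0 j with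
  | Some a, Some b => g.2 a b
  | Some a, None => - g.1 0 a
  | None, Some b => g.1 0 b
  | None, None => 0
  end.

Lemma coord_pt_surj g : Gset g -> exists v, g = coord_pt v.
Proof.
case: g => x Y; rewrite /Gset /antisym /= => aY.
have Z i j : gentry (x, Y) j i = - gentry (x, Y) i j.
  rewrite /gentry; case: (unlift _ i) => [a|]; case: (unlift _ j) => [b|]; rewrite /= ?opprK ?oppr0 //.
  by move/matrixP: aY => /(_ a b); rewrite !mxE.
(* Picking the pair in increasing order makes it unique and fixes the sign. *)
pose v t : R := if [pick p : 'I_n.+1 * 'I_n.+1 | (p.1 < p.2)%N && (val t == [set p.1; p.2])] is Some p
  then gentry (x, Y) p.1 p.2 else 0.
have E i j : (i < j)%N -> entry v i j = gentry (x, Y) i j.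
  move=> ij; have ij' : i != j by rewrite -(inj_eq val_inj) neq_ltn ij.
  rewrite /entry ij; case: insubP => [t _ et|]; last by rewrite cards2 ij'.
  rewrite /v; case: pickP => [[a b] /= /andP[ab /eqP e]|/(_ (i, j))]; last by rewrite /= ij et eqxx.
  have ab' : a != b by rewrite -(inj_eq val_inj) neq_ltn ab.
  have /(set2_inj ab')[[-> -> //]|[ai bj]] : [set a; b] = [set i; j] by rewrite -e et.
  by move: ab; rewrite ai bj ltnNge (ltnW ij).
have E' i j : entry v i j = gentry (x, Y) i j.
  have [ij|ji|/val_inj ->] := ltngtP i j; first exact: E.
    by rewrite entryC Z E.
  by rewrite entry_diag; have := Z j j; lra.
exists v; apply/pair_equal_spec; split.
  by apply/rowP => i; rewrite mxE E' /gentry unlift_none liftK.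
by apply/matrixP => i j; rewrite mxE E' /gentry !liftK.
Qed.

(** Degree of homogeneity under dilations: the edges through 0 are the coordinates of x. *)
Definition weight t := if ord0 \in val t then 1%N else 2%N.
Definition dilate (c : R) v : edge n -> R := fun t => c ^+ weight t * v t.

Lemma entry_dilate c v i j : entry (dilate c v) i j = c ^+ (if (i == ord0) || (j == ord0) then 1%N else 2%N) * entry v i j.
Proof.
rewrite /entry; case: insubP => [t _ et|]; last by rewrite mulr0.
have -> : dilate c v t = c ^+ (if (i == ord0) || (j == ord0) then 1%N else 2%N) * v t.
  by rewrite /dilate /weight et !inE ![ord0 == _]eq_sym.
by case: ifP => _; rewrite ?mulrN.
Qed.

Lemma coord_pt_dil c v : coord_pt (dilate c v) = (c *: (coord_pt v).1, c ^+ 2 *: (coord_pt v).2).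
Proof.
apply/pair_equal_spec; split; first by apply/rowP => i; rewrite !mxE entry_dilate eqxx /= expr1.
apply/matrixP => i j; by rewrite !mxE entry_dilate.
Qed.

Lemma entry_bound v c i j : 0 <= c -> (forall t, `|v t| <= c) -> `|entry v i j| <= c.
Proof.
move=> c0 h; rewrite /entry; case: insubP => [t _ _|_]; last by rewrite normr0.
by case: ifP => _; rewrite ?normrN.
Qed.

Lemma coord_pt_inbox v : (forall t, `|v t| <= 1) -> inbox (coord_pt v).
Proof.
move=> h; split; first exact: coord_pt_Gset.
  by move=> i; rewrite mxE; apply: entry_bound.
by move=> i j; rewrite mxE; apply: entry_bound.
Qed.

End Coordinates.

(** * The distance as a function of the coordinates *)

Section DistanceInCoordinates.
Variables (R : realType) (n : nat) (N : 'rV[R]_n -> R).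
Hypothesis hN : is_norm N.
Implicit Types (v : edge n -> R) (t : edge n).

Definition coord_dist v : R := dist0 N (coord_pt v).
Notation F := coord_dist.
(** The rows of [- x | Y]: below the diagonal, column 0 of the bordered matrix carries the opposite
    sign. *)
Definition rows v (i : 'I_n) (c : 'I_n.+1) : R := entry v (lift ord0 i) c.

Lemma coord_dist_dil c v : 0 < c -> F (dilate c v) = c * F v.
Proof.
move=> c0; rewrite /coord_dist coord_pt_dil; have := dist0_scale hN (coord_pt v).1 c0 (coord_pt_Gset v).
by case: (coord_pt v).
Qed.

(** A coordinate of absolute value 1 forces 1 <= C2 F or 1 <= C2 F^2, according to its layer; when F
    < 1, the second inequality implies the first. *)
Lemma coord_dist_bounds : exists2 C : R, 0 < C & forall v, (forall t, `|v t| <= 1) ->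
  F v <= C /\ ((exists t, `|v t| = 1) -> C^-1 <= F v).
Proof.
have [C1 C10 h1] := dist0_box hN.
have [C2 C20 h2] := dist0_coord_le hN.
exists (C1 + C2 + 1) => [|v hv]; first lra.
have [aY bx bY] := coord_pt_inbox hv.
split; first by apply: le_trans (h1 _ aY bx bY) _; lra.
move=> [t ht]; have [hx hy] := h2 _ aY; have d0 := dist0_ge0 hN aY.
rewrite -/(F v) in hx hy d0.
have [i [j [ij _ /(_ v) e]]] := edgeP R t.
have H : 1 <= C2 * F v \/ 1 <= C2 * F v ^+ 2.
  have [i0|i0] := unliftP ord0 i; last first.
    have [j0 ej|ej] := unliftP ord0 j; last by move: ij; rewrite i0 ej.
    by left; rewrite -ht -e i0 ej; have := hx j0; rewrite mxE.
  move=> ei; have [j0 ej|ej] := unliftP ord0 j; last by move: ij; rewrite ej.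
  by right; rewrite -ht -e ei ej; have := hy i0 j0; rewrite mxE.
have Cp : 0 < C1 + C2 + 1 by lra.
rewrite -(ler_pM2l Cp) divff ?gt_eqF //.
have h3 : 0 <= C1 * F v by rewrite mulr_ge0 // ltW.
have h4 : 0 <= C2 * F v by rewrite mulr_ge0 // ltW.
rewrite !mulrDl mul1r; case: H => h; first lra.
have [F1|F1] := leP 1 (F v); first lra.
have : C2 * F v ^+ 2 <= C2 * F v.
  by rewrite ler_pM2l // expr2 ler_piMl // ltW.
lra.
Qed.

(** A coordinate of x moves by translation, at a cost independent of s. For Y_ij, spanning yields a
    combination f of the columns of [x | Y] inside the plane of e_i and e_j, and f /\ e_j or - f /\
    e_i is exactly e_i /\ e_j. The price 1 / s is the size of the coefficients of f. *)
Lemma coord_dist_move : (0 < n)%N -> exists2 K : R, 0 < K & forall v s, (forall t, `|v t| <= 1) -> 0 < s -> s <= 1 ->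
  degenerate (rows v) s K \/ forall t z, F (shift_coord v t z) <= F v + K / s * `|z|.
Proof.
move=> n0; have [K1 K10 h1] := degenerate_or_spanning R n.+1 n0.
have [C2 C20 h2] := dist0_move hN.
have [C3 C30 h3] := dist0_xmove hN.
have P : 0 <= C2 * K1 by rewrite mulr_ge0 // ltW.
exists (K1 + C2 * K1 + C3) => [|v s hv s0 s1]; first lra.
have [|sp] := h1 (rows v) s s0.
  move=> [i [j [a [b [ij e hK hs]]]]]; left; exists i, j, a, b; split => // l.
  by have [ha hb] := hK l; split; lra.
right => t z.
(* As s is at most 1, costs independent of s are absorbed into those of order 1 / s. *)
have si : 1 <= s^-1 by rewrite invf_ge1.
have big C : 0 <= C -> C <= K1 + C2 * K1 + C3 -> C * `|z| <= (K1 + C2 * K1 + C3) / s * `|z|.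
  move=> C0 hC; rewrite ler_wpM2r //; apply: le_trans hC _.
  by rewrite ler_peMr //; lra.
have bx := coord_pt_inbox hv.
have [i [j [ij et _]]] := edgeP R t.
have [j0 ej|ej] := unliftP ord0 j; last by move: ij; rewrite ej.
have U1 := entry_shift_coord v z ij et.
have [i0 ei|ei] := unliftP ord0 i; last first.
  have -> : F (shift_coord v t z) = dist0 N ((coord_pt v).1 + z *: delta_mx 0 j0, (coord_pt v).2).
    rewrite /coord_dist; congr dist0; apply/pair_equal_spec; split.
      apply/rowP => a; rewrite !mxE U1 ei ej eqxx (inj_eq lift_inj).
      by rewrite [lift _ _ == _]eq_sym (negbTE (neq_lift _ _)) /=; ring.
    apply/matrixP => a b; rewrite !mxE U1 ei.
    by rewrite ![lift _ _ == ord0]eq_sym !(negbTE (neq_lift _ _)) /=; ring.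
  apply: le_trans (h3 _ _ _ _ (coord_pt_Gset v)) _.
  rewrite -surjective_pairing lerD2l; apply: big; lra.
have ij0 : i0 != j0 by apply/eqP => e; move: ij; rewrite ei ej e ltnn.
have [b [r [hb hf]]] := sp _ _ ij0.
pose a : 'cV[R]_n := \col_k b (lift ord0 k).
have Ef k : ((coord_pt v).2 *m a)^T 0 k + (- b ord0) * (coord_pt v).1 0 k = pairing (rows v) b k.
  rewrite /pairing big_ord_recl /rows entryC !mxE addrC; congr (_ + _); first ring.
  by apply: eq_bigr => c _; rewrite !mxE.
(* Treats both forms of f at once: z' = z with l = j, or z' = - z with l = i. The coefficient of x
   is - b_0 because column 0 of [rows] is - x. *)
have move_to (z' : R) l (f : 'I_n -> R) : (forall k, pairing (rows v) b k = f k) ->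
   (forall c d, z * ((c == i0)%:R * (d == j0)%:R - (c == j0)%:R * (d == i0)%:R) =
               z' * (f c * (d == l)%:R - (c == l)%:R * f d)) -> `|z'| = `|z| ->
   F (shift_coord v t z) <= F v + (K1 + C2 * K1 + C3) / s * `|z|.
  move=> hpf hz zz.
  have -> : F (shift_coord v t z) = dist0 N ((coord_pt v).1, (coord_pt v).2 + z' *: wedge (((coord_pt v).2 *m a)^T + (- b ord0) *: (coord_pt v).1) (delta_mx 0 l)).
    rewrite /coord_dist; congr dist0; apply/pair_equal_spec; split.
      apply/rowP => c; rewrite !mxE U1 ei ej !(negbTE (neq_lift _ _)) /=; ring.
    apply/matrixP => c d; rewrite mxE U1 ei ej !(inj_eq lift_inj) hz [RHS]mxE [X in _ = X + _]mxE; congr (_ + _).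
    have Ef' k : (((coord_pt v).2 *m a)^T + (- b ord0) *: (coord_pt v).1) 0 k = f k.
      by rewrite mxE [X in _ + X]mxE Ef hpf.
    rewrite mxE wedgeE !Ef'; have dl k : (delta_mx 0 l : 'rV[R]_n) 0 k = (k == l)%:R by rewrite mxE eqxx.
    by rewrite !dl.
  have b0 : 0 <= K1 / s by rewrite divr_ge0 // ltW.
  have := h2 (coord_pt v).1 (coord_pt v).2 a (- b ord0) (K1 / s) z' l.
  rewrite -surjective_pairing => /(_ bx b0) h.
  apply: le_trans (h _ _) _.
  - by move=> k; rewrite mxE.
  - by rewrite normrN.
  rewrite zz lerD2l ler_wpM2r // mulrA ler_pM2r; lra.
case: hf => hf.
  apply: (move_to z j0 _ hf) => // c d; ring.
apply: (move_to (- z) i0 _ hf) => [c d|]; [ring|exact: normrN].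
Qed.

End DistanceInCoordinates.

(** * Counting degenerate cells *)

Section Windows.
Variable R : realType.

(** The integer parts of j - b + W are distinct and lie between 0 and 2 W. *)
Lemma card_nat_window (m W : nat) (A : {set 'I_m}) (b : R) :
  (forall j, j \in A -> `|j%:R - b| <= W%:R) -> (#|A| <= W.*2.+1)%N.
Proof.
move=> h.
pose f (j : 'I_m) : 'I_W.*2.+1 := inord (Num.truncn ((j : nat)%:R - b + W%:R)).
have inj : {in A &, injective f}.
  move=> i j iA jA e.
  have bd k : k \in A -> 0 <= (k : nat)%:R - b + W%:R /\ (Num.truncn ((k : nat)%:R - b + W%:R) < W.*2.+1)%N.
    move=> /h; rewrite ler_norml => /andP[h1 h2].
    have h0 : 0 <= (k : nat)%:R - b + W%:R by lra.
    split=> //; rewrite ltnS -(ler_nat R).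
    have /andP[h3 _] := truncn_itv h0; apply: le_trans h3 _.
    rewrite -addnn natrD; lra.
  have [i0 it] := bd i iA; have [j0 jt] := bd j jA.
  have : Num.truncn ((i : nat)%:R - b + W%:R) = Num.truncn ((j : nat)%:R - b + W%:R).
    by have := congr1 (@nat_of_ord _) e; rewrite !inordK.
  have /andP[a1 a2] := truncn_itv i0; have /andP[b1 b2] := truncn_itv j0 => E.
  rewrite -natr1 in a2; rewrite -natr1 in b2; rewrite E in a1 a2.
  apply/val_inj/eqP; rewrite eqn_leq; apply/andP; split; rewrite -ltnS -(ltr_nat R) -natr1; lra.
rewrite -(card_in_imset inj); apply: leq_trans (max_card _) _.
by rewrite card_ord.
Qed.

(* The centre of the window of the coordinate t only depends on the coordinates of lower rank. *)
Lemma card_function_windows (T : finType) (m : nat) (A : {set {ffun T -> 'I_m}}) (rk : T -> nat)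
    (base : T -> {ffun T -> 'I_m} -> R) (W : T -> nat) :
  (forall t (f f' : {ffun T -> 'I_m}), (forall u, (rk u < rk t)%N -> f u = f' u) -> base t f = base t f') ->
  (forall (f : {ffun T -> 'I_m}) t, f \in A -> `|(f t : nat)%:R - base t f| <= (W t)%:R) ->
  (#|A| <= \prod_t (W t).*2.+1)%N.
Proof.
move=> hb hA.
pose B := \max_t (W t).*2.
pose off (f : {ffun T -> 'I_m}) t := Num.truncn ((f t : nat)%:R - base t f + (W t)%:R).
pose g (f : {ffun T -> 'I_m}) : {ffun T -> 'I_B.+1} := [ffun t => inord (off f t)].
have bd f t : f \in A -> 0 <= (f t : nat)%:R - base t f + (W t)%:R /\ (off f t <= (W t).*2)%N.
  move=> fA; have := hA f t fA; rewrite ler_norml => /andP[h1 h2].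
  have h0 : 0 <= (f t : nat)%:R - base t f + (W t)%:R by lra.
  split=> //; rewrite -(ler_nat R).
  have /andP[h3 _] := truncn_itv h0; apply: le_trans h3 _.
  rewrite -addnn natrD; lra.
have offB f t : f \in A -> (off f t < B.+1)%N.
  move=> fA; have [_ h] := bd f t fA; apply: leq_ltn_trans h _.
  by rewrite ltnS /B (leq_bigmax t).
have inj : {in A &, injective g}.
  move=> f f' fA fA' e; apply/ffunP.
  (* Induction on the rank: once the lower coordinates agree, the window centres agree, and equal
     offsets give equal values. *)
  suff h k : forall t, (rk t < k)%N -> f t = f' t by move=> t; exact: (h (rk t).+1).
  elim: k => // k IH t; rewrite ltnS => tk.
  have bb : base t f = base t f' by apply: hb => u ut; apply: IH; apply: leq_trans ut tk.
  have E : off f t = off f' t.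
    have := congr1 (fun x : {ffun T -> 'I_B.+1} => nat_of_ord (x t)) e.
    by rewrite !ffunE !inordK ?offB.
  have [i0 _] := bd f t fA; have [j0 _] := bd f' t fA'.
  have /andP[a1 a2] := truncn_itv i0; have /andP[b1 b2] := truncn_itv j0.
  rewrite /off in E; rewrite -natr1 in a2; rewrite -natr1 in b2; rewrite E bb in a1 a2.
  apply/val_inj/eqP; rewrite eqn_leq; apply/andP; split; rewrite -ltnS -(ltr_nat R) -natr1; lra.
rewrite -(card_in_imset inj).
pose Fam t := [pred o : 'I_B.+1 | (o <= (W t).*2)%N].
have sub : g @: A \subset family Fam.
  apply/fintype.subsetP => _ /imsetP[f fA ->]; apply/familyP => t; rewrite ffunE inE inordK ?offB //.
  by have [] := bd f t fA.
apply: leq_trans (subset_leq_card sub) _.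
rewrite card_family foldrE big_map big_enum /=.
apply: leq_prod => t _.
rewrite -[X in (_ <= X)%N]card_ord.
have h : injective (fun o : 'I_(W t).*2.+1 => inord o : 'I_B.+1).
  move=> o o' /(congr1 (@nat_of_ord _)).
  have lt (a : 'I_(W t).*2.+1) : (a < B.+1)%N.
    by apply: leq_trans (ltn_ord a) _; rewrite ltnS (leq_bigmax t).
  by rewrite !inordK // => /val_inj.
rewrite -(card_imset _ h); apply: subset_leq_card. apply/fintype.subsetP => o; rewrite unfold_in => ho.
apply/imsetP; exists (inord o) => //; apply/val_inj => /=.
by rewrite inordK inordK // ltnS.
Qed.

End Windows.

(** * Dyadic cells on the faces of the cube, and oscillation over a cell *)

Section Oscillation.
Variables (R : realType) (n : nat).
Notation T := (edge n).
Variable F : (T -> R) -> R.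
Implicit Types (p v : T -> R) (Q : T -> nat) (c t : T) (sg : bool).

Definition face sg : R := if sg then 1 else -1.
Definition corner (L : nat) (q : nat) : R := -1 + q%:R / 2 ^+ L.

(* On the face [p c = +-1] of the cube the value of Q at c plays no role. *)
Definition cell c sg L Q p := p c = face sg /\
  forall t, t != c -> corner L (Q t) <= p t /\ p t <= corner L (Q t) + (2 ^+ L)^-1.

Definition in_grid Q L := forall t, (Q t < 2 ^ L.+1)%N.

Lemma cell_box c sg L Q p : in_grid Q L -> cell c sg L Q p -> forall t, `|p t| <= 1.
Proof.
move=> sQ [pc coord_pt] t; have [->|tc] := eqVneq t c.
  by rewrite pc /face; case: sg {pc}; rewrite ?normrN normr1.
have [h1 h2] := coord_pt t tc.
have p2 : 0 < 2 ^+ L :> R by rewrite exprn_gt0.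
have := sQ t; rewrite -(ler_nat R) -natr1 natrX exprS => h3.
have h4 : ((Q t)%:R + 1) / 2 ^+ L <= 2 :> R by rewrite ler_pdivrMr.
have h5 : 0 <= (Q t)%:R / 2 ^+ L :> R by rewrite divr_ge0 // ltW.
rewrite /corner in h1 h2; rewrite mulrDl mul1r in h4.
rewrite ler_norml; apply/andP; split; lra.
Qed.

Lemma grid_exists L (x : R) : `|x| <= 1 ->
  exists q : 'I_(2 ^ L.+1), corner L q <= x /\ x <= corner L q + (2 ^+ L)^-1.
Proof.
rewrite ler_norml => /andP[x1 x2].
have p2 : 0 < 2 ^+ L :> R by rewrite exprn_gt0.
have y0 : 0 <= (x + 1) * 2 ^+ L by apply: mulr_ge0; [lra|exact: ltW].
have y1 : (x + 1) * 2 ^+ L <= 2 ^+ L.+1 by rewrite exprS ler_pM2r //; lra.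
have /andP[t1 t2] := truncn_itv y0.
set q := Num.truncn _ in t1 t2.
have corn (k : nat) : k%:R <= (x + 1) * 2 ^+ L -> (x + 1) * 2 ^+ L <= k%:R + 1 ->
   corner L k <= x /\ x <= corner L k + (2 ^+ L)^-1.
  move=> h1 h2; have h3 : k%:R / 2 ^+ L <= x + 1 by rewrite ler_pdivrMr.
  have h4 : x + 1 <= (k%:R + 1) / 2 ^+ L by rewrite ler_pdivlMr.
  by rewrite mulrDl mul1r in h4; rewrite /corner; split; lra.
have [qm|qm] := ltnP q (2 ^ L.+1).
  by exists (Ordinal qm); apply: corn => //=; rewrite natr1 ltW.
(* Only x = 1 remains; its integer part is one too large, and it is put into the last closed
   interval. *)
have m0 : (0 < 2 ^ L.+1)%N by rewrite expn_gt0.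
have lt : ((2 ^ L.+1).-1 < 2 ^ L.+1)%N by rewrite prednK.
exists (Ordinal lt); apply: corn => /=.
  by apply: le_trans t1; rewrite ler_nat; apply: leq_trans qm; apply: leq_pred.
by rewrite natr1 prednK // natrX.
Qed.

Lemma cell_exists c sg L p : p c = face sg -> (forall t, `|p t| <= 1) ->
  exists Q : {ffun T -> 'I_(2 ^ L.+1)}, Q c = 0%N :> nat /\ cell c sg L (fun t => Q t) p.
Proof.
move=> pc hp; have m0 : (0 < 2 ^ L.+1)%N by rewrite expn_gt0.
have [q hq] := choice (fun t => grid_exists L (hp t)).
(* Fixing the index at c to 0 gives each cell of the face one index; otherwise it would be counted
   2^(L + 1) times. *)
exists [ffun t => if t == c then Ordinal m0 else q t]; split; first by rewrite ffunE eqxx.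
by split => // t tc; rewrite ffunE (negbTE tc).
Qed.

Definition splice (r : seq T) p p' : T -> R := fun t => if t \in r then p' t else p t.

(** The coordinates are exchanged one at a time. A cell is a box, so all intermediate points stay in
    it and the one-coordinate bound applies at each of them. *)
Lemma cell_osc c sg L Q (k : R) : 0 <= k ->
  (forall p, cell c sg L Q p -> forall t z, F (shift_coord p t z) <= F p + k * `|z|) ->
  forall p p', cell c sg L Q p -> cell c sg L Q p' ->
  `|F p' - F p| <= k * \sum_t `|p' t - p t|.
Proof.
move=> k0 hF.
have one p p' : cell c sg L Q p -> cell c sg L Q p' -> F p' <= F p + k * \sum_t `|p' t - p t|.
  move=> hp hp'.
  have hm r : cell c sg L Q (splice r p p').
    split; first by rewrite /splice; case: ifP => _; [exact: hp'.1|exact: hp.1].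
    by move=> t tc; rewrite /splice; case: ifP => _; [exact: hp'.2|exact: hp.2].
  have H r : uniq r -> F (splice r p p') <= F p + k * \sum_(t <- r) `|p' t - p t|.
    elim: r => [_|t r IH /= /andP[tr /IH h]].
      by rewrite big_nil mulr0 addr0.
    have -> : splice (t :: r) p p' = shift_coord (splice r p p') t (p' t - p t).
      apply/funext => u; rewrite /splice /shift_coord inE; have [->|ut] := eqVneq u t.
        by rewrite /= (negbTE tr) addrC subrK.
      by rewrite /= addr0.
    apply: le_trans (hF _ (hm r) t _) _.
    by rewrite big_cons mulrDr; lra.
  have E : splice (enum {: T}) p p' = p' by apply/funext => t; rewrite /splice mem_enum.
  by rewrite -{1}E; apply: le_trans (H _ (enum_uniq _)) _; rewrite big_enum.
move=> p p' hp hp'; rewrite ler_norml; apply/andP; split; last by have := one _ _ hp hp'; lra.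
have := one _ _ hp' hp; rewrite (eq_bigr (fun t => `|p' t - p t|)); first lra.
by move=> t _; rewrite distrC.
Qed.

End Oscillation.

Lemma card_le_cover (Q X : finType) (A : {set Q}) (P : pred X) (B : X -> {set Q}) (m : nat) :
  (forall q, q \in A -> exists2 x, P x & q \in B x) -> (forall x, P x -> (#|B x| <= m)%N) ->
  (#|A| <= #|P| * m)%N.
Proof.
move=> hc hB; rewrite -sum1_card -sum_nat_const.
apply: (@leq_trans (\sum_(q in A) \sum_(x | P x) (q \in B x))).
  apply: leq_sum => q /hc[x Px qx]; rewrite (bigD1 x) //= qx; lia.
rewrite exchange_big /=; apply: leq_sum => x Px.
apply: leq_trans (hB x Px); rewrite -sum1_card big_mkcond [X in (_ <= X)%N]big_mkcond /=.
by apply: leq_sum => q _; case: (q \in A); case: (q \in B x).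
Qed.

Lemma leq_exp_mono (a b e : nat) : (a <= b)%N -> (a ^ e <= b ^ e)%N.
Proof. by move=> ab; elim: e => // e IH; rewrite !expnS leq_mul. Qed.

(** * From approximate relations between rows to the number of cells *)

Section Counting.
Variables (R : realType) (n : nat).
Notation T := (edge n).
Implicit Types (p v : T -> R) (c t : T) (sg : bool) (e i j l : 'I_n) (x u : 'I_n.+1).

Definition row_comb (a' : 'I_n -> R) e e' v u : R :=
  \sum_(l | (l != e) && (l != e')) a' l * entry v (lift ord0 l) u.

Lemma entryB p v x u : entry p x u - entry v x u = entry (fun t => p t - v t) x u.
Proof. by rewrite /entry; case: insubP => [t _ _|_]; [case: ifP => _; ring|ring]. Qed.

(** As a e = 1 and a e' = 0, the relation expresses the entry (e, u) through the other rows. The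
    relation itself costs s; in each other row, replacing a by a' costs s since entries are at most
    1, and replacing p by v costs K d, at most K s. *)
Lemma row_comb_close (K s d : R) a a' e e' p v u : 0 <= K -> 0 <= s -> 0 <= d -> d <= s ->
  e != e' -> a e = 1 -> a e' = 0 ->
  (forall l, l != e -> l != e' -> `|a l - a' l| <= s) -> (forall l, `|a' l| <= K) ->
  (forall t, `|p t| <= 1) -> (forall t, `|p t - v t| <= d) ->
  `|\sum_l a l * rows p l u| <= s ->
  `|entry p (lift ord0 e) u + row_comb a' e e' v u| <= (1 + n%:R * (1 + K)) * s.
Proof.
move=> K0 s0 d0 ds ee' ae ae' aa ha hp hv.
rewrite (bigD1 e) //= (bigD1 e') 1?eq_sym //= ae ae' mul1r mul0r add0r /rows => h.
set S := \sum_(_ | _) _ in h.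
have hS : `|row_comb a' e e' v u - S| <= n%:R * (1 + K) * s.
  rewrite /row_comb /S -sumrB; apply: le_trans (ler_norm_sum _ _ _) _.
  apply: (@le_trans _ _ (\sum_(l | (l != e) && (l != e')) (1 + K) * s)).
    apply: ler_sum => l /andP[le le'].
    have -> : a' l * entry v (lift ord0 l) u - a l * entry p (lift ord0 l) u =
       - ((a l - a' l) * entry p (lift ord0 l) u + a' l * (entry p (lift ord0 l) u - entry v (lift ord0 l) u)) by ring.
    rewrite normrN; apply: le_trans (ler_normD _ _) _; rewrite !normrM mulrDl mul1r.
    apply: lerD.
      rewrite -[leRHS]mulr1; apply: ler_pM => //; first exact: aa.
      exact: entry_bound.
    apply: ler_pM => //; rewrite entryB; apply: le_trans ds; exact: entry_bound.
  rewrite sumr_const -[leLHS]mulr_natl -[leRHS]mulrA; apply: ler_wpM2r; first by rewrite mulr_ge0 ?addr_ge0.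
  by rewrite ler_nat; apply: leq_trans (max_card _) _; rewrite card_ord.
have -> : entry p (lift ord0 e) u + row_comb a' e e' v u = (entry p (lift ord0 e) u + S) + (row_comb a' e e' v u - S) by ring.
apply: le_trans (ler_normD _ _) _; rewrite mulrDl mul1r; exact: lerD.
Qed.

Definition order_sign x u : R := if (x < u)%N then 1 else -1.

Lemma entry_sgn p t x u : val t = [set x; u] -> entry p x u = order_sign x u * p t.
Proof.
move=> e; rewrite /entry -e; case: insubP => [w _ /val_inj ->|]; last by rewrite (valP t).
by rewrite /order_sign; case: ifP => _; ring.
Qed.

Definition other_end t x : 'I_n.+1 := odflt ord0 [pick u in val t | u != x].

Lemma other_endP t x : x \in val t -> val t = [set x; other_end t x] /\ other_end t x != x.
Proof.
have /cards2P[a [b [ab e]]] := valP t.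
rewrite /other_end e !inE => /orP[] /eqP ->.
  case: pickP => [w /=|/(_ b)]; last by rewrite !inE eqxx orbT eq_sym ab.
  rewrite !inE => /andP[/orP[/eqP ->|/eqP ->]] wx //=; first by rewrite eqxx in wx.
case: pickP => [w /=|/(_ a)]; last by rewrite !inE eqxx ab.
rewrite !inE => /andP[/orP[/eqP ->|/eqP ->]] wx //=; last by rewrite eqxx in wx.
by rewrite finset.setUC.
Qed.

Definition degenerate_cell c sg L (Q : T -> nat) (s K : R) := exists2 p, cell c sg L Q p & degenerate (rows p) s K.

Section OneWindow.
Variables (c : T) (sg : bool) (l L Kn : nat) (i j : 'I_n) (a' b' : 'I_n -> R).
Hypotheses (lL : (l <= L)%N) (ij : i != j).
Hypotheses (ha' : forall k, `|a' k| <= Kn%:R) (hb' : forall k, `|b' k| <= Kn%:R).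

Let I : 'I_n.+1 := lift ord0 i.
Let J : 'I_n.+1 := lift ord0 j.
(* If a and b almost annihilate the antisymmetric matrix Z, with a_I = b_J = 1 and
   a_J = b_I = 0, then Z_Iu and Z_Ju are determined up to O(s) by the entries avoiding I and J,
   and Z_IJ by these. *)
Let rk t := ((I \in val t) + (J \in val t))%N.
Let corner_point (Q : T -> nat) : T -> R := fun t => if t == c then face R sg else corner R L (Q t).
(** The real index q for which - 1 + q / 2^L is the value that the relation predicts for the
    coordinate t. *)
Let base t (Q : {ffun T -> 'I_(2 ^ L.+1)}) : R :=
  if t == c then 0 else
  if I \in val t then (1 - order_sign I (other_end t I) * row_comb a' i j (corner_point (fun t => Q t)) (other_end t I)) * 2 ^+ L else
  if J \in val t then (1 - order_sign J (other_end t J) * row_comb b' j i (corner_point (fun t => Q t)) (other_end t J)) * 2 ^+ L else 0.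
(** In units of 2^-L. The constant is 1 + n (1 + Kn) from [row_comb_close], plus 1 for the distance
    between the point and the corner of its cell. Coordinates avoiding I and J keep their full
    range, and c is frozen. *)
Let W t : nat := if t == c then 0%N else
  if (I \in val t) || (J \in val t) then ((2 + n * (1 + Kn)) * 2 ^ (L - l))%N else (2 ^ L.+1)%N.

Lemma row_comb_local (a : 'I_n -> R) e e' (Q Q' : T -> nat) u k :
  (forall w, (rk w < k)%N -> Q w = Q' w) ->
  (forall m w, m != e -> m != e' -> val w = [set lift ord0 m; u] -> (rk w < k)%N) ->
  row_comb a e e' (corner_point Q) u = row_comb a e e' (corner_point Q') u.
Proof.
move=> hQ hr; apply: eq_bigr => m /andP[me me']; congr (_ * _).
rewrite /entry; case: insubP => [w _ ew|//].
by rewrite /corner_point (hQ w) // (hr m).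
Qed.

Definition window_set (A : {set {ffun T -> 'I_(2 ^ L.+1)}}) := forall Q, Q \in A -> Q c = 0%N :> nat /\
  exists p (a b : 'I_n -> R), [/\ cell c sg L (fun t => Q t) p,
    [/\ a i = 1, a j = 0, b i = 0 & b j = 1],
    forall k, k != i -> k != j -> `|a k - a' k| <= (2 ^+ l)^-1 /\ `|b k - b' k| <= (2 ^+ l)^-1
  & forall u, `|\sum_k a k * rows p k u| <= (2 ^+ l)^-1 /\ `|\sum_k b k * rows p k u| <= (2 ^+ l)^-1].

Lemma card_window_set (A : {set {ffun T -> 'I_(2 ^ L.+1)}}) : window_set A ->
  (#|A| <= \prod_t (W t).*2.+1)%N.
Proof.
move=> hA; apply: (@card_function_windows R _ _ _ rk base W).
  move=> t Q Q' hQ; rewrite /base; case: ifP => // _.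
  have hQ' w : (rk w < rk t)%N -> (Q w : nat) = Q' w by move=> /hQ ->.
  case: ifP => It.
    have [et ut] := other_endP It; congr ((1 - _ * _) * _).
    apply: (@row_comb_local _ _ _ _ _ _ (rk t)) => // m w mi mj ew.
    have E k : lift ord0 k \in val w = (k == m) || (lift ord0 k == other_end t I).
      by rewrite ew !inE (inj_eq lift_inj).
    have E' k : lift ord0 k \in val t = (k == i) || (lift ord0 k == other_end t I).
      by rewrite {1}et !inE (inj_eq lift_inj).
    rewrite /rk /I /J !E !E' !eqxx ![_ == m]eq_sym (negbTE mi) (negbTE mj) /= [j == i]eq_sym (negbTE ij) /=.
    by rewrite eq_sym (negbTE ut) /=; lia.
  case: ifP => Jt //.
  have [et ut] := other_endP Jt; congr ((1 - _ * _) * _).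
  apply: (@row_comb_local _ _ _ _ _ _ (rk t)) => // m w mj mi ew.
  have E k : lift ord0 k \in val w = (k == m) || (lift ord0 k == other_end t J).
    by rewrite ew !inE (inj_eq lift_inj).
  have uI : (I == other_end t J) = false.
    by apply/negbTE; apply: contraFneq It => ->; rewrite et !inE eqxx orbT.
  rewrite /rk It Jt /I /J !E ![_ == m]eq_sym (negbTE mi) (negbTE mj) /= uI.
  by rewrite eq_sym (negbTE ut).
move=> Q t /hA[Qc [p [a [b [hp [ai aj bi bj] hab hs]]]]]; rewrite /base /W.
have [->|tc] := eqVneq t c; first by rewrite Qc subrr normr0.
have p2 k : 0 < 2 ^+ k :> R by rewrite exprn_gt0.
have qs : in_grid (fun t => Q t : nat) L by move=> w; exact: ltn_ord.
have hp1 := cell_box qs hp.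
have hv w : `|p w - corner_point (fun t => Q t) w| <= (2 ^+ L)^-1.
  rewrite /corner_point; have [->|wc] := eqVneq w c; first by rewrite hp.1 subrr normr0 invr_ge0 ltW.
  have [h1 h2] := hp.2 w wc; rewrite ler_norml; apply/andP; split; last lra.
  have : 0 <= (2 ^+ L)^-1 :> R by rewrite invr_ge0 ltW.
  lra.
have d0 : 0 <= (2 ^+ L)^-1 :> R by rewrite invr_ge0 ltW.
have s0 : 0 <= (2 ^+ l)^-1 :> R by rewrite invr_ge0 ltW.
have ds : (2 ^+ L)^-1 <= (2 ^+ l)^-1 :> R.
  by rewrite lef_pV2 ?posrE // ler_eXn2l // ltr1n.
have Wn : ((2 + n * (1 + Kn)) * 2 ^ (L - l))%:R = (2 + n%:R * (1 + Kn%:R)) * ((2 ^+ l)^-1 * 2 ^+ L) :> R.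
  rewrite natrM natrD natrM natrD natrX; congr (_ * _).
  rewrite -{2}(subnK lL) exprD [_ * 2 ^+ l]mulrC mulKf // gt_eqF //.
have fin x (z : R) : x \in val t -> `|entry p x (other_end t x) + z| <= (1 + n%:R * (1 + Kn%:R)) * (2 ^+ l)^-1 ->
   `|(Q t)%:R - (1 - order_sign x (other_end t x) * z) * 2 ^+ L| <= ((2 + n * (1 + Kn)) * 2 ^ (L - l))%:R.
  move=> xt; have [et ut] := other_endP xt; rewrite (entry_sgn p et) => hz.
  have [h1 h2] := hp.2 t tc.
  have h3 : `|p t + order_sign x (other_end t x) * z| <= (1 + n%:R * (1 + Kn%:R)) * (2 ^+ l)^-1.
    move: hz; rewrite /order_sign; case: ifP => _; first by rewrite !mul1r.
    by rewrite !mulN1r -[X in _ -> X <= _]normrN opprB addrC.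
  have -> : (Q t)%:R = (corner R L (Q t) + 1) * 2 ^+ L.
    by rewrite /corner addrAC addNr add0r divfK // gt_eqF.
  rewrite -mulrBl normrM [X in _ * X]gtr0_norm // Wn mulrA ler_pM2r //.
  set q := corner R L (Q t) in h1 h2 *.
  have -> : q + 1 - (1 - order_sign x (other_end t x) * z) = (q - p t) + (p t + order_sign x (other_end t x) * z) by ring.
  apply: le_trans (ler_normD _ _) _.
  have : `|q - p t| <= (2 ^+ L)^-1 by rewrite ler_norml; apply/andP; split; lra.
  lra.
case: ifP => It /=.
  apply: fin => //.
  apply: (@row_comb_close Kn%:R _ (2 ^+ L)^-1 a a' i j) => //; [by move=> k ki kj; exact: (hab k ki kj).1|exact: (hs _).1].
case: ifP => Jt /=.
  apply: fin => //.
  apply: (@row_comb_close Kn%:R _ (2 ^+ L)^-1 b b' j i) => //; [by rewrite eq_sym|by move=> k kj ki; exact: (hab k ki kj).2|exact: (hs _).2].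
rewrite subr0 normr_nat ler_nat; apply: ltnW; exact: ltn_ord.
Qed.

(** Counted through the complement: the edges avoiding I and J are the pairs of n - 1 indices. *)
Lemma card_meeting : (#|[pred t : T | (I \in val t) || (J \in val t)]| = 2 * n - 1)%N.
Proof.
have IJ : I != J by rewrite (inj_eq lift_inj).
have n2 : (2 <= n)%N.
  by have := max_card [set i; j]; rewrite cards2 ij card_ord.
have h := cardC [pred t : T | (I \in val t) || (J \in val t)].
have e : #|[predC [pred t : T | (I \in val t) || (J \in val t)]]| = 'C(n.-1, 2).
  have : #|~: [set I; J]| = n.-1.
    by have := cardsC [set I; J]; rewrite cards2 IJ card_ord; lia.
  move=> <-; rewrite -cards_draws -(card_imset _ val_inj); apply: eq_card => B.
  rewrite !inE; apply/imsetP/andP => [[t]|[/fintype.subsetP sB cB]].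
    rewrite !inE negb_or => /andP[It Jt] ->; split; last exact: (valP t).
    apply/fintype.subsetP => x xt; rewrite !inE negb_or; apply/andP; split.
      by apply: contraNneq It => <-.
    by apply: contraNneq Jt => <-.
  exists (Sub B cB : T); last by rewrite SubK.
  rewrite !inE SubK negb_or; apply/andP; split; apply/negP => /sB; rewrite !inE eqxx ?orbT //.
rewrite e card_edge in h.
have : ('C(n, 2) = 'C(n.-1, 2) + n.-1)%N.
  by case: n n2 {h e} => // m _; rewrite binS bin1.
by move=> hC; rewrite hC in h; move: h; set X := #|_| => h; lia.
Qed.

(** All coordinates but c have windows of length O(2^L), and those meeting I or J gain a factor
    2^-l. There are 2 n - 1 of the latter, one of which may be c, so at least 2 n - 2 count. *)
Lemma prod_window :
  (\prod_t (W t).*2.+1 <= (5 + 2 * (2 + n * (1 + Kn))) ^ #|{: T}| * 2 ^ (L * #|{: T}|.-1 - l * (2 * n - 2)))%N.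
Proof.
set D := (5 + _)%N.
pose mt t := (I \in val t) || (J \in val t).
pose E t : nat := if t == c then 0%N else if mt t then (L - l)%N else L.
apply: (@leq_trans (\prod_(t : T) (D * 2 ^ E t))).
  apply: leq_prod => t _; rewrite /W /E -/(mt t); case: ifP => _; first by rewrite /D; lia.
  case: ifP => _.
    have : (0 < 2 ^ (L - l))%N by rewrite expn_gt0.
    rewrite /D -muln2; nia.
  have : (0 < 2 ^ L)%N by rewrite expn_gt0.
  rewrite /D expnS -muln2; nia.
rewrite big_split /= prod_nat_const -expn_sum leq_mul2l; apply/orP; right.
rewrite leq_pexp2l //.
have h1 : (\sum_(t : T) E t + l * (\sum_(t : T | t != c) mt t) = L * #|{: T}|.-1)%N.
  have -> : #|{: T}|.-1 = (\sum_(t : T | t != c) 1)%N.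
    by rewrite sum1_card cardC1.
  rewrite (bigD1 c) //= {1}/E eqxx add0n !big_distrr /= -big_split /=.
  apply: eq_bigr => t tc; rewrite /E (negbTE tc); case: (mt t) => /=; lia.
have h2 : (2 * n - 2 <= \sum_(t : T | t != c) mt t)%N.
  have := card_meeting; rewrite -sum1_card big_mkcond /= (bigD1 c) //=.
  rewrite (eq_bigr (fun t => mt t : nat)); first by case: ifP; lia.
  by move=> t _; rewrite inE -/(mt t); case: (mt t).
have : (l * (2 * n - 2) <= l * (\sum_(t : T | t != c) mt t))%N by rewrite leq_mul2l h2 orbT.
move: h1; set M := (l * \sum_(_ | _) _)%N; set d := (L * _)%N; set f := (l * (_ - _))%N; set S := (\sum_t _)%N.
lia.
Qed.

End OneWindow.

(** Only n - 2 values are free. The window count around 0 gives 2 m + 1 for each, within a factor 2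
    of the true number. *)
Lemma card_vanishing_family (m : nat) (i j : 'I_n) : i != j ->
  (#|[set f : {ffun 'I_n -> 'I_m.+1} | (f i == 0%N :> nat) && (f j == 0%N :> nat)]| <= (m.*2.+1) ^ (n - 2))%N.
Proof.
move=> ij.
pose W (k : 'I_n) := if (k == i) || (k == j) then 0%N else m.
apply: (@leq_trans (\prod_k (W k).*2.+1)%N).
  apply: (@card_function_windows R _ _ _ (fun _ => 0%N) (fun _ _ => 0) W) => // f k.
  rewrite inE => /andP[fi fj]; rewrite subr0 normr_nat ler_nat /W.
  have [->|_] := eqVneq k i; first by rewrite (eqP fi).
  have [->|_] := eqVneq k j; first by rewrite (eqP fj).
  by rewrite /= -ltnS.
rewrite (eq_bigr (fun k => if (k != i) && (k != j) then m.*2.+1 else 1%N)); last first.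
  by move=> k _; rewrite /W -negb_or; case: ((k == i) || (k == j)).
rewrite -big_mkcond /= prod_nat_const leq_pexp2l //.
have := cardC (pred2 i j); rewrite card2 ij card_ord.
rewrite (eq_card (A := [predC pred2 i j]) (B := fun k : 'I_n => (k != i) && (k != j))); last first.
  by move=> k; rewrite !inE negb_or.
by set X := #|_|; lia.
Qed.

(** For fixed i and j, the two relations have 2 (n - 2) free coefficients, so O(2^(2 l (n - 2)))
    discretised families; each accounts for O(2^(L (d - 1) - l (2 n - 2))) cells. The product is
    O(2^(L (d - 1) - 2 l)). *)
Lemma count_degenerate_cells (K : R) : (2 <= n)%N -> 0 <= K -> exists C : nat, forall c sg (l L : nat) (A : {set {ffun T -> 'I_(2 ^ L.+1)}}),
  (l <= L)%N -> (forall Q, Q \in A -> Q c = 0%N :> nat /\ degenerate_cell c sg L (fun t => Q t) (2 ^+ l)^-1 K) ->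
  (#|A| * 2 ^ (2 * l) <= C * 2 ^ (L * #|{: T}|.-1))%N.
Proof.
move=> n2 K0; pose Kn := (Num.truncn K).+1.
have KKn : K <= Kn%:R by have /andP[_ h] := truncn_itv K0; exact: ltW.
pose G := (4 * Kn + 3)%N; pose D := (5 + 2 * (2 + n * (1 + Kn)))%N.
exists (n ^ 2 * ((G ^ (n - 2)) ^ 2 * D ^ #|{: T}|))%N => c sg l L A lL hA.
(* The indices 0 to m describe the grid of mesh 2^-l on [- Kn, Kn], where the coefficients are
   rounded. *)
pose m := (Kn.*2 * 2 ^ l)%N.
pose coef (f : {ffun 'I_n -> 'I_m.+1}) (k : 'I_n) : R := (f k : nat)%:R / 2 ^+ l - Kn%:R.
have p2 k : 0 < 2 ^+ k :> R by rewrite exprn_gt0.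
have coefK f k : `|coef f k| <= Kn%:R.
  have : (f k : nat)%:R / 2 ^+ l <= (Kn.*2)%:R :> R.
    by rewrite ler_pdivrMr // -natrX -natrM ler_nat -ltnS.
  have : 0 <= (f k : nat)%:R / 2 ^+ l :> R by rewrite divr_ge0 // ltW.
  rewrite /coef -addnn natrD ler_norml => h1 h2; apply/andP; split; lra.
have approx (a : 'I_n -> R) (i j : 'I_n) : (forall k, `|a k| <= K) ->
    exists2 f : {ffun 'I_n -> 'I_m.+1}, (f i == 0%N :> nat) && (f j == 0%N :> nat) &
      forall k, k != i -> k != j -> `|a k - coef f k| <= (2 ^+ l)^-1.
  move=> ha.
  exists [ffun k => if (k == i) || (k == j) then ord0 else inord (Num.truncn ((a k + Kn%:R) * 2 ^+ l))].
    by rewrite !ffunE !eqxx ?orbT.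
  move=> k ki kj; rewrite /coef ffunE (negbTE ki) (negbTE kj) /=.
  have := ha k; rewrite ler_norml => /andP[a1 a2].
  have y0 : 0 <= (a k + Kn%:R) * 2 ^+ l by apply: mulr_ge0; [lra|exact: ltW].
  have /andP[t1 t2] := truncn_itv y0.
  rewrite inordK; last first.
    rewrite ltnS -(ler_nat R); apply: le_trans t1 _.
    rewrite /m natrM natrX ler_pM2r // -addnn natrD; lra.
  set z := Num.truncn _ in t1 t2 *.
  have t3 : z%:R / 2 ^+ l <= a k + Kn%:R by rewrite ler_pdivrMr.
  have t4 : a k + Kn%:R <= (z%:R + 1) / 2 ^+ l by rewrite ler_pdivlMr // natr1 ltW.
  have z0 : 0 <= (2 ^+ l)^-1 :> R by rewrite invr_ge0 ltW.
  rewrite mulrDl mul1r in t4; rewrite ler_norml; apply/andP; split; lra.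
pose degenerate_at (Q : {ffun T -> 'I_(2 ^ L.+1)}) (i j : 'I_n) (a' b' : 'I_n -> R) :=
  exists p (a b : 'I_n -> R), [/\ cell c sg L (fun t => Q t) p,
    [/\ a i = 1, a j = 0, b i = 0 & b j = 1],
    forall k, k != i -> k != j -> `|a k - a' k| <= (2 ^+ l)^-1 /\ `|b k - b' k| <= (2 ^+ l)^-1
  & forall u, `|\sum_k a k * rows p k u| <= (2 ^+ l)^-1 /\ `|\sum_k b k * rows p k u| <= (2 ^+ l)^-1].
pose fam (i j : 'I_n) := [set f : {ffun 'I_n -> 'I_m.+1} | (f i == 0%N :> nat) && (f j == 0%N :> nat)].
pose B1 (ij : 'I_n * 'I_n) := [set Q in A | `[< exists f g, [/\ f \in fam ij.1 ij.2, g \in fam ij.1 ij.2 & degenerate_at Q ij.1 ij.2 (coef f) (coef g)] >]].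
pose E := (L * #|{: T}|.-1 - l * (2 * n - 2))%N.
have hB1 ij : ij.1 != ij.2 -> (#|B1 ij| <= ((G * 2 ^ l) ^ (n - 2)) ^ 2 * (D ^ #|{: T}| * 2 ^ E))%N.
  case: ij => i j /= ij.
  pose B2 (fg : {ffun 'I_n -> 'I_m.+1} * {ffun 'I_n -> 'I_m.+1}) := [set Q in A | `[< degenerate_at Q i j (coef fg.1) (coef fg.2) >]].
  have cover : forall Q, Q \in B1 (i, j) -> exists2 fg, (fg \in finset.setX (fam i j) (fam i j)) & Q \in B2 fg.
    move=> Q; rewrite inE => /andP[QA /asboolP[f [g [hf hg hb]]]].
    by exists (f, g); rewrite !inE; [rewrite inE in hf; rewrite inE in hg; rewrite hf hg|rewrite QA; apply/asboolP].
  have hB2 fg : fg \in finset.setX (fam i j) (fam i j) -> (#|B2 fg| <= D ^ #|{: T}| * 2 ^ E)%N.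
    move=> _; apply: leq_trans (prod_window c Kn lL ij).
    apply: (card_window_set (sg := sg) lL ij (coefK fg.1) (coefK fg.2)) => Q.
    by rewrite inE => /andP[/hA[Qc _] /asboolP hb]; split.
  apply: leq_trans (card_le_cover cover hB2) _.
  rewrite leq_mul2r; apply/orP; right; rewrite cardsX -mulnn.
  have hfam : (#|fam i j| <= (G * 2 ^ l) ^ (n - 2))%N.
    apply: leq_trans (card_vanishing_family m ij) _.
    apply: leq_exp_mono; rewrite /m /G -!muln2.
    have : (0 < 2 ^ l)%N by rewrite expn_gt0.
    nia.
  exact: leq_mul.
have cover1 : forall Q, Q \in A -> exists2 ij : 'I_n * 'I_n, ij.1 != ij.2 & Q \in B1 ij.
  move=> Q QA; have [_ [p hp [i [j [a [b [ij e hK hs]]]]]]] := hA Q QA.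
  have [f hf fa] := approx a i j (fun k => (hK k).1).
  have [g hg gb] := approx b i j (fun k => (hK k).2).
  exists (i, j) => //; rewrite inE QA; apply/asboolP; exists f, g; split; rewrite ?inE //.
  exists p, a, b; split => // k ki kj; split; [exact: fa|exact: gb].
have h1 := card_le_cover cover1 hB1.
have h2 : (#|[pred ij : 'I_n * 'I_n | ij.1 != ij.2]| <= n ^ 2)%N.
  by apply: leq_trans (max_card _) _; rewrite card_prod card_ord mulnn.
(* Ensures that the truncated subtraction in the exponent E is a true one. *)
have h3 : (l * (2 * n - 2) <= L * #|{: T}|.-1)%N.
  apply: leq_mul => //.
  have ij : Ordinal (ltnW n2) != Ordinal n2 by [].
  have := card_meeting lL ij; set X := #|_| => hX.
  have : (X <= #|{: T}|)%N by apply: max_card.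
  lia.
apply: (@leq_trans (n ^ 2 * (((G * 2 ^ l) ^ (n - 2)) ^ 2 * (D ^ #|{: T}| * 2 ^ E)) * 2 ^ (2 * l))%N).
  rewrite leq_mul2r; apply/orP; right; apply: leq_trans h1 _; rewrite leq_mul2r; apply/orP; right; exact: h2.
have -> : (L * #|{: T}|.-1 = l * (n - 2) * 2 + E + 2 * l)%N.
  rewrite /E; have e : (l * (2 * n - 2) = l * (n - 2) * 2 + 2 * l)%N by nia.
  by move: h3; rewrite e; set X := (_ * _.-1)%N; set Y := (l * _ * _)%N; lia.
have -> : (((G * 2 ^ l) ^ (n - 2)) ^ 2 = (G ^ (n - 2)) ^ 2 * 2 ^ (l * (n - 2) * 2))%N.
  by rewrite (expnM 2 (l * (n - 2)) 2) (expnM 2 l (n - 2)) !expnMn.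
rewrite 2![in X in (_ <= X)%N]expnD.
set u := (2 ^ (l * (n - 2) * 2))%N; set w := (2 ^ E)%N; set x := ((G ^ _) ^ 2)%N; set y := (D ^ _)%N; set z := (2 ^ (2 * l))%N.
by rewrite (_ : n ^ 2 * (x * u * (y * w)) * z = n ^ 2 * (x * y) * (u * w * z))%N //; ring.
Qed.

End Counting.

(** * Hausdorff measure and charts of the sphere *)

Section HausdorffCovers.
Local Open Scope classical_set_scope.
Variables (R : realType) (T : Type) (dist : T -> T -> R) (k : nat).
Hypothesis k0 : (0 < k)%N.
Implicit Types S A : set T.

Lemma diam_ge0 A : (0 <= diam dist A)%E.
Proof. by apply: ereal_sup_ubound; right. Qed.

Lemma diam_le A (e : R) : 0 <= e -> (forall x y, A x -> A y -> dist x y <= e) -> (diam dist A <= e%:E)%E.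
Proof.
move=> e0 h; apply: ge_ereal_sup => _ /= [[x Ax [y Ay] <-]|->]; rewrite lee_fin //; exact: h.
Qed.

Lemma hausdorff_delta_ge0 d S : (0 <= hausdorff_delta dist k d S)%E.
Proof.
apply: le_ereal_inf_tmp => _ [C [_ hC] <-].
by apply: nneseries_ge0 => i _ _; rewrite lee_fin exprn_ge0 // fine_ge0 // diam_ge0.
Qed.

Lemma hausdorff_delta_finite_cover (W : finType) (P : W -> set T) S (e d : R) (X : nat) :
  0 <= e -> e <= d -> S `<=` \bigcup_w P w ->
  (forall w x y, P w x -> P w y -> dist x y <= e) ->
  (#|[set w | `[< P w !=set0 >]]%SET| <= X)%N ->
  (hausdorff_delta dist k d S <= (X%:R * e ^+ k)%:E)%E.
Proof.
move=> e0 ed SP hP hX.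
(* Only nonempty sets are listed. Beyond the list the cover continues with the empty set, whose
   diameter 0 contributes 0 because k is positive. *)
pose r := [seq P w | w <- enum [set w | `[< P w !=set0 >]]%SET].
have sr : (size r <= X)%N by rewrite size_map -cardE.
have dC i : (diam dist (nth set0 r i) <= e%:E)%E.
  have [ir|ir] := ltnP i (size r).
    have /mapP[w _ ->] := mem_nth set0 ir.
    by apply: diam_le => // x y; apply: hP.
  by rewrite nth_default //; apply: diam_le.
apply: (@le_trans _ _ (\sum_(0 <= i <oo) ((fine (diam dist (nth set0 r i))) ^+ k)%:E)%E).
  apply: ereal_inf_lbound; exists (nth set0 r) => //; split.
    move=> x /SP[w _ Pwx].
    have wr : P w \in r.
      by apply: map_f; rewrite mem_enum inE; apply/asboolP; exists x.
    by exists (index (P w) r) => //; rewrite nth_index.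
  by move=> i; apply: le_trans (dC i) _; rewrite lee_fin.
apply: lime_le.
  by apply: is_cvg_nneseries => i _ _; rewrite lee_fin exprn_ge0 // fine_ge0 // diam_ge0.
apply: nearW => m.
have fin i : (fine (diam dist (nth set0 r i))) ^+ k <= e ^+ k.
  rewrite lerXn2r ?nnegrE ?fine_ge0 ?diam_ge0 //.
  by rewrite -lee_fin fineK // ge0_fin_numE ?diam_ge0 //; apply: le_lt_trans (dC i) (ltry _).
have H : (\sum_(0 <= i < m) ((fine (diam dist (nth set0 r i))) ^+ k)%:E <= ((minn m (size r))%:R * e ^+ k)%:E)%E.
  elim: m => [|m IH]; first by rewrite big_geq // min0n mul0r.
  rewrite big_nat_recr //=; have [mr|mr] := ltnP m (size r).
    rewrite (minn_idPl mr); rewrite (minn_idPl (ltnW mr)) in IH.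
    apply: (@le_trans _ _ ((m%:R * e ^+ k)%:E + (e ^+ k)%:E)%E).
      by apply: leeD => //; rewrite lee_fin; exact: fin.
    by rewrite -EFinD lee_fin -natr1 mulrDl mul1r.
  rewrite (minn_idPr mr) in IH; rewrite (minn_idPr (leqW mr)).
  have -> : diam dist (nth set0 r m) = 0%E.
    by rewrite nth_default //; apply/eqP; rewrite eq_le diam_ge0 andbT; apply: diam_le.
  by rewrite fine0 expr0n (gtn_eqF k0) adde0.
apply: le_trans H _; rewrite lee_fin ler_wpM2r ?exprn_ge0 // ler_nat.
by apply: leq_trans (geq_minr _ _) sr.
Qed.

Lemma hausdorff_le S (B : \bar R) : (forall d, 0 < d -> (hausdorff_delta dist k d S <= B)%E) ->
  (hausdorff dist k S <= B)%E.
Proof. by move=> h; apply: ge_ereal_sup => _ [d d0 <-]; exact: h. Qed.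

Lemma hausdorff_eq0 S : (forall d e, 0 < d -> 0 < e -> (hausdorff_delta dist k d S <= e%:E)%E) ->
  hausdorff dist k S = 0%E.
Proof.
move=> h; apply/eqP; rewrite eq_le; apply/andP; split.
  by apply: hausdorff_le => d d0; apply/lee_addgt0Pr => e e0; rewrite add0e; exact: h.
apply: (le_trans (hausdorff_delta_ge0 1 S)); apply: ereal_sup_ubound; exists 1 => //=.
Qed.

Lemma hausdorff_set0 : hausdorff dist k set0 = 0%E.
Proof.
apply: hausdorff_eq0 => d e d0 e0.
apply: le_trans (@hausdorff_delta_finite_cover void (fun _ => set0) set0 0 d 0 _ _ _ _ _) _ => //.
- exact: ltW.
- by rewrite leqn0 cards_eq0; apply/eqP/setP => -[].
- by rewrite mul0r lee_fin ltW.
Qed.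

Lemma hausdorff_measurableT : hausdorff_measurable dist k setT.
Proof. by move=> A; rewrite setIT setDT hausdorff_set0 adde0. Qed.

End HausdorffCovers.

(** * The sphere as a radial graph over the boundary of the cube *)

Section SphereParametrization.
Variables (R : realType) (n : nat) (N : 'rV[R]_n -> R).
Hypotheses (hN : is_norm N) (n2 : (2 <= n)%N).
Notation T := (edge n).
Implicit Types (p v : T -> R) (c t : T) (sg : bool).
Notation F := (coord_dist N).

(** There are n + n^2 squared differences, fewer than (n + 1)^2. *)
Lemma Gdist_coord_pt v v' (e : R) : 0 <= e -> (forall t, `|v t - v' t| <= e) ->
  Gdist (coord_pt v) (coord_pt v') <= n.+1%:R * e.
Proof.
move=> e0 h.
have E x u : (entry v x u - entry v' x u) ^+ 2 <= e ^+ 2.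
  by rewrite entryB -real_normK ?num_real // lerXn2r ?nnegrE //; apply: entry_bound.
have ne0 : 0 <= n.+1%:R * e by rewrite mulr_ge0.
rewrite -[leRHS]ger0_norm // -sqrtr_sqr ler_sqrt ?exprn_ge0 //.
have S1 : \sum_(i < n) ((coord_pt v).1 0 i - (coord_pt v').1 0 i) ^+ 2 <= n%:R * e ^+ 2.
  rewrite -[X in X%:R * _](card_ord n); apply: sum_le_card => i; rewrite !mxE; exact: E.
have S2 : \sum_(i < n) \sum_(j < n) ((coord_pt v).2 i j - (coord_pt v').2 i j) ^+ 2 <= n%:R * (n%:R * e ^+ 2).
  rewrite -[X in X%:R * (_ * _)](card_ord n); apply: sum_le_card => i.
  rewrite -[X in X%:R * _](card_ord n); apply: sum_le_card => j; rewrite !mxE; exact: E.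
apply: le_trans (lerD S1 S2) _; rewrite exprMn -natr1.
have h1 : 0 <= n%:R * e ^+ 2 by rewrite mulr_ge0 // exprn_ge0.
have h2 : 0 <= e ^+ 2 by rewrite exprn_ge0.
have -> : (n%:R + 1) ^+ 2 * e ^+ 2 = n%:R * (n%:R * e ^+ 2) + (n%:R * e ^+ 2) + (n%:R * e ^+ 2) + e ^+ 2 by ring.
lra.
Qed.

Definition cube_boundary p := (forall t, `|p t| <= 1) /\ exists t, `|p t| = 1.

Definition radial p : 'rV[R]_n * 'M[R]_n := coord_pt (dilate (F p)^-1 p).

(** F is bounded away from 0 on the boundary of the cube, so 1 / F and its square are Lipschitz in
    F. This isolates F as the only source of irregularity, both for the diameters of the pieces and
    for the charts. *)
Lemma radial_close : exists2 C : R, 0 < C & forall p p', cube_boundary p -> cube_boundary p' ->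
  Gdist (radial p) (radial p') <= C * (`|F p - F p'| + \sum_t `|p t - p' t|).
Proof.
have [C C0 hC] := coord_dist_bounds hN.
have low v : cube_boundary v -> 0 < F v /\ (F v)^-1 <= C.
  move=> [v1 v2]; have [_ /(_ v2) h] := hC v v1.
  have Fv : 0 < F v by apply: lt_le_trans h; rewrite invr_gt0.
  by split => //; rewrite -[C]invrK lef_pV2 // posrE invr_gt0.
pose M := (1 + 2 * C) * C ^+ 2 + C + C ^+ 2.
have C20 : 0 < C ^+ 2 by rewrite exprn_gt0.
have C30 : 0 < C * C ^+ 2 by rewrite mulr_gt0.
have M0 : 0 < M by rewrite /M mulrDl; lra.
exists (n.+1%:R * M) => [|p p' hp hp']; first by rewrite mulr_gt0.
have [Fp ip] := low p hp; have [Fp' ip'] := low p' hp'.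
set S := \sum_t _; have S0 : 0 <= S by apply: sumr_ge0.
rewrite -mulrA; apply: Gdist_coord_pt => [|t].
  by apply: mulr_ge0; [exact: ltW|exact: addr_ge0].
have tS : `|p t - p' t| <= S.
  by rewrite /S (bigD1 t) //= lerDl sumr_ge0.
set m := (F p)^-1 in ip *; set m' := (F p')^-1 in ip' *.
have m0 : 0 <= m by rewrite invr_ge0 ltW.
have m'0 : 0 <= m' by rewrite invr_ge0 ltW.
set dF := `|F p - F p'|.
have dF0 : 0 <= dF by exact: normr_ge0.
have mm : `|m - m'| <= C ^+ 2 * dF.
  have -> : m - m' = (m * m') * (F p' - F p).
    by rewrite /m /m'; field; rewrite !gt_eqF.
  rewrite normrM distrC ger0_norm ?mulr_ge0 // ler_wpM2r // expr2; exact: ler_pM.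
have pt1 : `|p t| <= 1 by case: hp.
have A : `|m * p t - m' * p' t| <= C ^+ 2 * dF + C * S.
  have -> : m * p t - m' * p' t = (m - m') * p t + m' * (p t - p' t) by ring.
  apply: le_trans (ler_normD _ _) _; rewrite !normrM; apply: lerD.
    by rewrite -[leRHS]mulr1; apply: ler_pM.
  by apply: ler_pM => //; rewrite ger0_norm.
have q1 : 0 <= C ^+ 2 * dF by rewrite mulr_ge0 // ltW.
have q2 : 0 <= C * C ^+ 2 * dF by rewrite mulr_ge0 // ltW.
have q3 : 0 <= C * S by rewrite mulr_ge0 // ltW.
have q4 : 0 <= C ^+ 2 * S by rewrite mulr_ge0 // ltW.
have q5 : 0 <= C * C ^+ 2 * S by rewrite mulr_ge0 // ltW.
have q6 : 0 <= C * dF by rewrite mulr_ge0 // ltW.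
rewrite /dilate /M; case: (weight t) / (erefl : weight t = weight t); rewrite /weight; case: ifP => _.
  rewrite !expr1; apply: le_trans A _; rewrite mulrDr !mulrDl !mul1r; lra.
(* Weight 2 is reduced to the estimate [A] for weight 1 by splitting off one factor. *)
have -> : m ^+ 2 * p t - m' ^+ 2 * p' t = m * (m * p t - m' * p' t) + (m - m') * (m' * p' t) by ring.
apply: le_trans (ler_normD _ _) _; rewrite !normrM.
have B1 : `|m| * `|m * p t - m' * p' t| <= C * (C ^+ 2 * dF + C * S).
  by apply: ler_pM => //; rewrite ger0_norm.
have B2 : `|m - m'| * (`|m'| * `|p' t|) <= (C ^+ 2 * dF) * (C * 1).
  apply: ler_pM => //; apply: ler_pM => //; first by rewrite ger0_norm.
  by case: hp'.
apply: le_trans (lerD B1 B2) _; rewrite mulrDr !mulrDl !mul1r mulr1.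
have -> : C * (C * S) = C ^+ 2 * S by ring.
lra.
Qed.

(** [r t] is the homogeneous modulus |v_t|^(1 / weight). Dilating by the inverse of its maximum r_c
    puts the point on the face of c, and F p = 1 / r_c there because F v = 1; hence [radial]
    restores v. *)
Lemma sphere_radial g : cc_sphere N g ->
  exists p c sg, [/\ p c = face R sg, forall t, `|p t| <= 1 & g = radial p].
Proof.
move=> [Gg]; rewrite dcc_dist0 // => -[dg].
have [v gv] := coord_pt_surj Gg.
have Fv : F v = 1 by rewrite /coord_dist -gv.
pose r t : R := if weight t == 1%N then `|v t| else Num.sqrt `|v t|.
have rw t : r t ^+ weight t = `|v t|.
  by rewrite /r /weight; case: (ord0 \in _) => /=; rewrite ?expr1 ?sqr_sqrtr.
have r0 t : 0 <= r t by rewrite /r; case: ifP => // _; exact: sqrtr_ge0.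
have h : #|[set ord0; ord_max : 'I_n.+1]| == 2%N.
  by rewrite cards2; case: n n2.
pose T0 : T := Sub [set ord0; ord_max : 'I_n.+1] h.
case: (@Order.TotalTheory.arg_maxP _ _ _ T0 (fun=> true) r isT) => c _ mx.
have rc : 0 < r c.
  rewrite lt_neqAle r0 andbT eq_sym; apply/eqP => rc0.
  have v0 : v = fun=> 0.
    apply/funext => t; apply/eqP; rewrite -normr_eq0 -rw.
    have -> : r t = 0 by apply/eqP; rewrite eq_le r0 -rc0 andbT; exact: mx.
    by rewrite expr0n /weight; case: ifP.
  (* If the maximum were 0, v would be the origin, which the dilation by 2 fixes; then F v = 0,
     against F v = 1. *)
  have : F v = 2 * F v.
    rewrite -coord_dist_dil //; congr coord_dist; apply/funext => t; by rewrite /dilate v0 mulr0.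
  by rewrite Fv; lra.
pose p := dilate (r c)^-1 v.
have np t : `|p t| = ((r c)^-1 * r t) ^+ weight t.
  by rewrite /p /dilate normrM exprMn rw ger0_norm // exprn_ge0 // invr_ge0.
have pc1 : `|p c| = 1 by rewrite np mulVf ?gt_eqF // expr1n.
have Fp : F p = (r c)^-1 by rewrite /p coord_dist_dil // ?invr_gt0 // Fv mulr1.
exists p, c, (0 <= p c); split.
- by rewrite /face; move: pc1; case: ger0P => // _ <-; rewrite opprK.
- move=> t; rewrite np; apply: exprn_ile1; first by rewrite mulr_ge0 // invr_ge0.
  by rewrite mulrC ler_pdivrMr // mul1r; exact: mx.
- rewrite gv /radial; congr coord_pt; apply/funext => t.
  by rewrite Fp invrK /p /dilate mulrA -exprMn divff ?gt_eqF // expr1n mul1r.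
Qed.

Lemma cell_boundary c sg L (Q : T -> nat) p : in_grid Q L -> cell c sg L Q p -> cube_boundary p.
Proof.
move=> sQ hp; split; first exact: cell_box hp.
by exists c; rewrite hp.1 /face; case: ifP; rewrite ?normrN normr1.
Qed.

Lemma cell_dist c sg L (Q : T -> nat) p p' : cell c sg L Q p -> cell c sg L Q p' ->
  \sum_t `|p t - p' t| <= #|{: T}|%:R / 2 ^+ L.
Proof.
move=> hp hp'; apply: sum_le_card => t.
have d0 : 0 <= (2 ^+ L)^-1 :> R by rewrite invr_ge0 exprn_ge0.
have [->|tc] := eqVneq t c; first by rewrite hp.1 hp'.1 subrr normr0.
have [h1 h2] := hp.2 t tc; have [h3 h4] := hp'.2 t tc.
rewrite ler_norml; apply/andP; split; lra.
Qed.

Definition nondeg_lipschitz (K : R) := forall c sg L (Q : T -> nat) s,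
  in_grid Q L -> 0 < s -> s <= 1 -> ~ degenerate_cell c sg L Q s K ->
  forall p p', cell c sg L Q p -> cell c sg L Q p' ->
  `|F p' - F p| <= K / s * \sum_t `|p' t - p t|.

Lemma exists_nondeg_lipschitz : exists2 K : R, 0 < K & nondeg_lipschitz K.
Proof.
have [K K0 hK] := coord_dist_move hN (ltnW n2).
exists K => // c sg L Q s sQ s0 s1 nb.
apply: cell_osc; first by rewrite divr_ge0 // ltW.
move=> p hp; have [hd|//] := hK p s (cell_box sQ hp) s0 s1.
by case: nb; exists p.
Qed.

End SphereParametrization.

Lemma card_le_fibers (X Y : finType) (A : {set X * Y}) (P : pred X) (f : X -> nat) :
  (forall x y, (x, y) \in A -> P x) -> (forall x, P x -> (#|[set y | (x, y) \in A]| <= f x)%N) ->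
  (#|A| <= \sum_(x | P x) f x)%N.
Proof.
move=> hP hf; apply: (@leq_trans (\sum_(x | P x) #|[set y | (x, y) \in A]|)%N); last exact: leq_sum.
have -> : (\sum_(x | P x) #|[set y | (x, y) \in A]| = \sum_(x | P x) \sum_y ((x, y) \in A))%N.
  apply: eq_bigr => x _; rewrite -sum1_card [RHS]big_mkcond /= [LHS]big_mkcond /=.
  by apply: eq_bigr => y _; rewrite inE; case: (_ \in A).
rewrite -sum1_card big_mkcond pair_big_dep /= [X in (_ <= X)%N]big_mkcond /=.
by apply: leq_sum => -[x y] _; case e: ((x, y) \in A); rewrite ?(hP _ _ e) /= ?e.
Qed.

Lemma sum_inv_pow2 (R : realFieldType) (L : nat) : \sum_(l < L) (2 ^+ l)^-1 <= 2 :> R.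
Proof.
suff H : \sum_(l < L) (2 ^+ l)^-1 = 2 - 2 * (2 ^+ L)^-1 :> R.
  by rewrite H lerBlDr lerDl mulr_ge0 // invr_ge0 exprn_ge0.
elim: L => [|L IH]; first by rewrite big_ord0 expr0 invr1 mulr1 subrr.
rewrite big_ord_recr /= IH exprS invfM mulrA divff // mul1r; ring.
Qed.

(** * Number of pieces of size 2^-L that cover the sphere *)

Section Counts.
Variables (R : realType) (n : nat) (N : 'rV[R]_n -> R).

Notation T := (edge n).
Notation k := (#|{: T}|.-1).
Implicit Types (p v : T -> R) (c t : T) (sg : bool) (l L : nat).
Notation F := (coord_dist N).

Variables (K : R) (Cb : nat).
Hypotheses (K0 : 0 < K) (hK : nondeg_lipschitz N K).
Hypothesis hCb : forall v, (forall t, `|v t| <= 1) -> 0 <= F v <= Cb%:R.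

(** The values of F 2^L range from 0 to Cb 2^L; the successor accommodates the upper end. *)
Definition levels L := (Cb * 2 ^ L).+1.

Definition at_level L p (j : nat) : Prop := j%:R <= F p * 2 ^+ L /\ F p * 2 ^+ L <= j%:R + 1.

Definition level_set c sg L (Q : T -> nat) : {set 'I_(levels L)} :=
  [set j : 'I_(levels L) | `[< exists2 p, cell c sg L Q p & at_level L p j >]].

Definition degenerate_at c sg L (Q : T -> nat) l := `[< degenerate_cell c sg L Q (2 ^+ l)^-1 K >].

Let W := (Num.truncn (K * #|{: T}|%:R)).+2.

Let hW : 1 + K * #|{: T}|%:R <= W%:R.
Proof.
have h (y : R) : 0 <= y -> 1 + y <= (Num.truncn y).+2%:R.
  by move=> y0; have /andP[_ h] := truncn_itv y0; rewrite -natr1; lra.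
by apply: h; rewrite mulr_ge0 // ltW.
Qed.

Definition level_cst := (W.*2.+1 + Cb.+1)%N.

Lemma exists_level L p : (forall t, `|p t| <= 1) -> exists j : 'I_(levels L), at_level L p j.
Proof.
move=> /hCb /andP[F0 F1]; have p2 : 0 < 2 ^+ L :> R by rewrite exprn_gt0.
have y0 : 0 <= F p * 2 ^+ L by apply: mulr_ge0 => //; exact: ltW.
have /andP[t1 t2] := truncn_itv y0; set q := Num.truncn _ in t1 t2.
have ql : (q < levels L)%N.
  rewrite ltnS -(ler_nat R); apply: le_trans t1 _.
  by rewrite natrM natrX ler_pM2r.
by exists (Ordinal ql); split => //=; rewrite natr1 ltW.
Qed.

(** At scale 2^-l the Lipschitz constant is K 2^l, and the cell has l1 diameter at most |T| 2^-L. So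
    F 2^L stays within K |T| 2^l of its value at any chosen point, and rounding to a level adds at
    most 1. *)
Lemma level_count_nondeg c sg L Q l : in_grid Q L -> (l <= L)%N -> ~~ degenerate_at c sg L Q l ->
  (#|level_set c sg L Q| <= level_cst * 2 ^ l)%N.
Proof.
move=> sQ lL /asboolPn nb.
have [[p0 hp0]|none] := pselect (exists p0, cell c sg L Q p0); last first.
  rewrite (_ : level_set c sg L Q = finset.set0) ?cards0 //.
  apply/setP => j; rewrite !inE; apply/negbTE/asboolPn => -[p hp _]; apply: none; by exists p.
have p2 m : 0 < 2 ^+ m :> R by rewrite exprn_gt0.
have s1 : (2 ^+ l)^-1 <= 1 :> R by rewrite invf_le1 // exprn_ege1 // ler1n.
have s0 : 0 < (2 ^+ l)^-1 :> R by rewrite invr_gt0.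
apply: (@leq_trans (W * 2 ^ l).*2.+1); last first.
  have : (0 < 2 ^ l)%N by rewrite expn_gt0.
  by rewrite /level_cst -!muln2; nia.
apply: (@card_nat_window R _ _ _ (F p0 * 2 ^+ L)) => j; rewrite inE => /asboolP[p hp [j1 j2]].
have := hK sQ s0 s1 nb hp0 hp; rewrite invrK => h.
have h2 : `|F p - F p0| <= K * 2 ^+ l * (#|{: T}|%:R / 2 ^+ L).
  apply: le_trans h _; apply: ler_wpM2l; last exact: cell_dist hp hp0.
  by apply: mulr_ge0; exact: ltW.
have h3 : `|F p - F p0| * 2 ^+ L <= K * #|{: T}|%:R * 2 ^+ l.
  apply: le_trans (ler_wpM2r (ltW (p2 L)) h2) _.
  by rewrite mulrA divfK ?gt_eqF // mulrAC.
have h4 : `|F p * 2 ^+ L - F p0 * 2 ^+ L| <= K * #|{: T}|%:R * 2 ^+ l.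
  by rewrite -mulrBl normrM [`|2 ^+ L|]gtr0_norm.
have e1 : 1 <= 2 ^+ l :> R by rewrite exprn_ege1 // ler1n.
rewrite natrM natrX; apply: (@le_trans _ _ ((1 + K * #|{: T}|%:R) * 2 ^+ l)); last by rewrite ler_pM2r.
move: h4; rewrite !ler_norml mulrDl mul1r => /andP[a1 a2]; apply/andP; split; lra.
Qed.

(** Let m be the first scale below L at which the cell is not degenerate. Then O(2^m) levels occur,
    and 2^m is at most 1 plus the sum over the preceding, degenerate scales. If there is no such m,
    the total number of levels suffices. The bound is linear in the degeneracy indicators and can
    thus be summed over the cells. *)
Lemma level_count c sg L Q : in_grid Q L ->
  (#|level_set c sg L Q| <= level_cst * (1 + \sum_(l < L) 2 ^ l.+1 * degenerate_at c sg L Q l))%N.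
Proof.
move=> sQ; pose S m := (1 + \sum_(l < m) 2 ^ l.+1 * degenerate_at c sg L Q l)%N.
have Sm a b : (a <= b)%N -> (S a <= S b)%N.
  move=> /subnKC <-; elim: (b - a)%N => [|d IH]; first by rewrite addn0.
  by apply: leq_trans IH _; rewrite addnS /S big_ord_recr /= addnA leq_addr.
have H m : (m <= L)%N -> (#|level_set c sg L Q| <= level_cst * S L)%N \/ (2 ^ m <= S m)%N.
  elim: m => [_|m IH mL]; first by right; rewrite /S big_ord0.
  have [h|h] := IH (ltnW mL); first by left.
  have [b|nb] := boolP (degenerate_at c sg L Q m).
    by right; rewrite /S big_ord_recr /= b muln1; lia.
  left; apply: leq_trans (level_count_nondeg sQ (ltnW mL) nb) _.
  rewrite leq_mul2l; apply/orP; right; apply: leq_trans h _; exact: Sm (ltnW mL).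
have [//|h] := H L (leqnn L).
apply: leq_trans (max_card _) _; rewrite card_ord.
apply: leq_trans (_ : level_cst * 2 ^ L <= _)%N; last by rewrite leq_mul2l h orbT.
have : (0 < 2 ^ L)%N by rewrite expn_gt0.
by rewrite /levels /level_cst; nia.
Qed.

Notation grid L := {ffun T -> 'I_(2 ^ L.+1)}.

Lemma card_grid c L : (#|[set Q : grid L | Q c == 0%N :> nat]| <= (5 * 2 ^ L) ^ k)%N.
Proof.
pose w t := if t == c then 0%N else (2 ^ L.+1)%N.
apply: (@leq_trans (\prod_t (w t).*2.+1)%N).
  apply: (@card_function_windows R _ _ _ (fun _ => 0%N) (fun _ _ => 0) w) => // f t.
  rewrite inE => /eqP fc; rewrite subr0 normr_nat ler_nat /w.
  by have [->|_] := eqVneq t c; rewrite ?fc // ltnW.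
rewrite (bigD1 c) //= {1}/w eqxx mul1n.
have -> : k = #|[pred t : T | t != c]| by rewrite cardC1.
rewrite -prod_nat_const; apply: leq_prod => t tc; rewrite /w (negbTE tc).
have : (0 < 2 ^ L)%N by rewrite expn_gt0.
rewrite expnS -muln2; nia.
Qed.

Definition pieces L (P : pred (T * bool * grid L)) : {set (T * bool * grid L) * 'I_(levels L)} :=
  [set w | [&& P w.1, w.1.2 w.1.1.1 == 0%N :> nat & w.2 \in level_set w.1.1.1 w.1.1.2 L (fun t => w.1.2 t)]].

Variable C9 : nat.
Hypothesis hC9 : forall c sg (l L : nat) (A : {set grid L}),
  (l <= L)%N -> (forall Q, Q \in A -> Q c = 0%N :> nat /\ degenerate_cell c sg L (fun t => Q t) (2 ^+ l)^-1 K) ->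
  (#|A| * 2 ^ (2 * l) <= C9 * 2 ^ (L * k))%N.

Lemma degenerate_count c sg L l : (l <= L)%N ->
  (#|[set Q : grid L | (Q c == 0%N :> nat) && degenerate_at c sg L (fun t => Q t) l]|)%:R <= C9%:R * (2 ^+ L) ^+ k / 2 ^+ l / 2 ^+ l :> R.
Proof.
move=> lL; have p2 m : 0 < 2 ^+ m :> R by rewrite exprn_gt0.
rewrite !ler_pdivlMr // -mulrA -exprD addnn -mul2n -exprM -!natrX -!natrM ler_nat.
by apply: (@hC9 c sg l L _ lL) => Q; rewrite inE => /andP[/eqP Qc /asboolP].
Qed.

Lemma sum_faces_le (G : T * bool -> nat) (B : R) : (forall c sg, (G (c, sg))%:R <= B) ->
  (\sum_x G x)%:R <= (2 * #|{: T}|)%:R * B.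
Proof.
move=> h; have -> : (2 * #|{: T}|)%N = #|{: T * bool}| by rewrite card_prod card_bool mulnC.
by rewrite natr_sum; apply: sum_le_card => -[c sg]; exact: h.
Qed.

(** After exchanging the sums, scale l contributes 2^(l + 1) levels over C9 2^(L k) / 4^l cells. The
    geometric series is at most 2, hence 4 C9; the term 5^k counts all cells once. *)
Lemma pieces_count : exists2 C : R, 0 <= C & forall L,
  (#|pieces (fun _ : T * bool * grid L => true)|)%:R <= C * (2 ^+ L) ^+ k.
Proof.
pose B : R := level_cst%:R * (5 ^+ k + 4 * C9%:R).
have B0 : 0 <= B by rewrite mulr_ge0 // addr_ge0 ?exprn_ge0 // mulr_ge0.
exists ((2 * #|{: T}|)%:R * B) => [|L]; first by rewrite mulr_ge0.
have p2 m : 0 < 2 ^+ m :> R by rewrite exprn_gt0.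
pose f (x : T * bool * grid L) := (level_cst * (1 + \sum_(l < L) 2 ^ l.+1 * degenerate_at x.1.1 x.1.2 L (fun t => x.2 t) l))%N.
have h1 : (#|pieces (fun _ : T * bool * grid L => true)| <= \sum_(x : T * bool * grid L | x.2 x.1.1 == 0%N :> nat) f x)%N.
  apply: card_le_fibers => [x y|x xc]; first by rewrite inE /= => /andP[].
  apply: leq_trans (level_count x.1.1 x.1.2 (_ : in_grid (fun t => x.2 t : nat) L)); last by move=> t; exact: ltn_ord.
  by apply: subset_leq_card; apply/fintype.subsetP => y; rewrite !inE /= => /andP[_ /asboolP].
apply: le_trans (_ : (\sum_(x : T * bool * grid L | x.2 x.1.1 == 0%N :> nat) f x)%:R <= _); first by rewrite ler_nat.
rewrite (reindex (fun z : (T * bool) * grid L => (z.1, z.2))) /=; last by exists id => -[].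
pose G (x : T * bool) := (\sum_(Q : grid L | Q x.1 == 0%N :> nat) f (x, Q))%N.
have -> : (\sum_(z : T * bool * grid L | z.2 z.1.1 == 0%N :> nat) f (z.1, z.2) = \sum_x G x)%N.
  by rewrite /G pair_big_dep.
rewrite -mulrA; apply: sum_faces_le => c sg.
rewrite /G /f /= -big_distrr /= big_split /= natrM -mulrA ler_wpM2l //.
rewrite natrD mulrDl; apply: lerD.
  rewrite sum1_card -exprMn -(natrX R 2 L) -natrM -natrX ler_nat.
  by apply: leq_trans (card_grid c L); rewrite cardsE.
rewrite exchange_big /= natr_sum.
apply: (@le_trans _ _ (\sum_(l < L) (2 * C9%:R * (2 ^+ L) ^+ k) * (2 ^+ l)^-1)).
  apply: ler_sum => l _.
  rewrite -big_distrr /= natrM natrX exprS.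
  have -> : (\sum_(Q : grid L | Q c == 0%N :> nat) degenerate_at c sg L (fun t => Q t) l)%N =
     #|[set Q : grid L | (Q c == 0%N :> nat) && degenerate_at c sg L (fun t => Q t) l]|.
    rewrite -sum1_card big_mkcond [RHS]big_mkcond /=; apply: eq_bigr => Q _.
    by rewrite inE; case: (_ == _); case: degenerate_at.
  apply: le_trans (ler_wpM2l _ (degenerate_count c sg (ltnW (ltn_ord l)))) _; first by rewrite mulr_ge0 // ltW.
  have := gt_eqF (p2 l); move: (2 ^+ l : R) ((2 ^+ L) ^+ k : R) (C9%:R : R) => y z w /negbT y0.
  by rewrite le_eqVlt; apply/orP; left; apply/eqP; field.
rewrite -mulr_sumr; apply: le_trans (ler_wpM2l _ (sum_inv_pow2 R L)) _.
  by rewrite !mulr_ge0 // exprn_ge0 // exprn_ge0.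
move: ((2 ^+ L) ^+ k : R) (C9%:R : R) => z w.
by rewrite le_eqVlt; apply/orP; left; apply/eqP; ring.
Qed.

(** Even with all the O(2^L) levels over each cell, the proportion 4^-L leaves a gain of 2^-L. *)
Lemma degenerate_pieces_count : exists2 C : R, 0 <= C & forall L,
  (#|pieces (fun x : T * bool * grid L => degenerate_at x.1.1 x.1.2 L (fun t => x.2 t) L)|)%:R
    <= C * (2 ^+ L) ^+ k / 2 ^+ L.
Proof.
pose B : R := C9%:R * Cb.+1%:R.
exists ((2 * #|{: T}|)%:R * B) => [|L]; first by rewrite !mulr_ge0.
have p2 m : 0 < 2 ^+ m :> R by rewrite exprn_gt0.
pose P (x : T * bool * grid L) := (x.2 x.1.1 == 0%N :> nat) && degenerate_at x.1.1 x.1.2 L (fun t => x.2 t) L.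
have h1 : (#|pieces (fun x : T * bool * grid L => degenerate_at x.1.1 x.1.2 L (fun t => x.2 t) L)| <= \sum_(x | P x) levels L)%N.
  apply: card_le_fibers => [x y|x _]; first by rewrite inE /P /= => /and3P[-> ->].
  by apply: leq_trans (max_card _) _; rewrite card_ord.
apply: le_trans (_ : (\sum_(x | P x) levels L)%:R <= _); first by rewrite ler_nat.
rewrite (reindex (fun z : (T * bool) * grid L => (z.1, z.2))) /=; last by exists id => -[].
pose G (x : T * bool) := (\sum_(Q : grid L | P (x, Q)) levels L)%N.
have -> : (\sum_(z : T * bool * grid L | P (z.1, z.2)) levels L = \sum_x G x)%N.
  by rewrite /G pair_big_dep.
rewrite -!mulrA; apply: sum_faces_le => c sg.
rewrite /G /P /= sum_nat_const natrM.
have h2 : (levels L)%:R <= Cb.+1%:R * 2 ^+ L :> R.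
  rewrite -natrX -natrM ler_nat /levels mulSn -addn1 addnC leq_add2r expn_gt0 //.
have h3 := degenerate_count c sg (leqnn L).
have -> : #|(fun i : grid L => (i c == 0%N :> nat) && degenerate_at c sg L (fun t => i t) L)| =
  #|[set Q : grid L | (Q c == 0%N :> nat) && degenerate_at c sg L (fun t => Q t) L]| by rewrite cardsE.
apply: le_trans (ler_pM _ _ h3 h2) _ => //.
rewrite /B; have := gt_eqF (p2 L); move: (2 ^+ L : R) => y /negbT y0.
move: (y ^+ k : R) (C9%:R : R) (Cb.+1%:R : R) => z w u.
by rewrite le_eqVlt; apply/orP; left; apply/eqP; field.
Qed.

End Counts.

Lemma exists_pow2_small (R : realType) (C d : R) : 0 < d -> exists L : nat, C / 2 ^+ L <= d.
Proof.
move=> d0; pose L := (Num.truncn `|C / d|).+1; exists L; have p2 : 0 < 2 ^+ L :> R by rewrite exprn_gt0.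
have h : C / d <= 2 ^+ L.
  apply: le_trans (ler_norm _) _.
  have /andP[_ h] := truncn_itv (normr_ge0 (C / d)); apply: le_trans (ltW h) _.
  by rewrite -natrX ler_nat; apply: ltnW; exact: ltn_expl.
by move: h; rewrite ler_pdivrMr // => h; rewrite ler_pdivrMr // mulrC.
Qed.

(** * Lipschitz retraction of the line onto an interval *)

Section Clamp.
Variable R : realDomainType.
Definition clamp (a b y : R) := Num.max a (Num.min b y).

Lemma clamp_bounds a b y : a <= b -> a <= clamp a b y /\ clamp a b y <= b.
Proof. by move=> ab; rewrite /clamp le_max lexx ge_max ab ge_min lexx. Qed.

Lemma clamp_id a b y : a <= y -> y <= b -> clamp a b y = y.
Proof. by move=> ay yb; rewrite /clamp (min_idPr yb) (max_idPr ay). Qed.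

Lemma clamp_lip a b y z : a <= b -> `|clamp a b y - clamp a b z| <= `|y - z|.
Proof.
move=> ab; have H u v : u <= v -> `|clamp a b u - clamp a b v| <= `|u - v|.
  move=> uv; rewrite [in leRHS]distrC [`|v - u|]ger0_norm ?subr_ge0 //.
  rewrite /clamp; have [bu|ub] := leP b u; have [bv|vb] := leP b v.
  - by rewrite subrr normr0 subr_ge0.
  - lra.
  - rewrite (max_idPr ab); have [au|ua] := leP a u; rewrite ler_norml; apply/andP; split; lra.
  - have [au|ua] := leP a u; have [av|va] := leP a v; rewrite ler_norml; apply/andP; split; lra.
have [yz|/ltW zy] := leP y z; first exact: H.
by rewrite distrC [leRHS]distrC; exact: H.
Qed.
End Clamp.

(** * Finite measure, null remainder and Lipschitz charts *)

Section Rectifiability.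
Variables (R : realType) (n : nat) (N : 'rV[R]_n -> R).
Hypotheses (hN : is_norm N) (n2 : (2 <= n)%N).
Notation T := (edge n).
Notation k := (#|{: T}|.-1).
Notation G := ('rV[R]_n * 'M[R]_n)%type.
Notation grid L := {ffun T -> 'I_(2 ^ L.+1)}.
Implicit Types (p v : T -> R) (c t : T) (sg : bool) (l L : nat).
Notation F := (coord_dist N).

Lemma dim_gt0 : (0 < k)%N.
Proof. by rewrite card_edge; case: n n2 => // -[//|m _]; rewrite addSn. Qed.

Variables (K : R) (Cb : nat).
Hypotheses (K0 : 0 < K) (hK : nondeg_lipschitz N K).
Hypothesis hCb : forall v, (forall t, `|v t| <= 1) -> 0 <= F v <= Cb%:R.

Definition piece L (P : pred (T * bool * grid L)) (w : (T * bool * grid L) * 'I_(levels Cb L)) : set G :=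
  [set g | w \in pieces N Cb P /\ exists p, [/\ cell w.1.1.1 w.1.1.2 L (fun t => w.1.2 t) p,
     at_level N L p w.2 & g = radial N p]]%classic.

(** Fixing the level makes F vary by at most 2^-L over the piece, as the coordinates do over the
    cell; [radial_close] then bounds the diameter even over degenerate cells. *)
Lemma piece_diam : exists2 C : R, 0 < C & forall L P w x y, @piece L P w x -> @piece L P w y ->
  Gdist x y <= C / 2 ^+ L.
Proof.
have [C C0 hC] := radial_close hN.
exists (C * (1 + #|{: T}|%:R)); first by rewrite mulr_gt0 // ltr_pwDl.
move=> L P w x y [_ [p [hp [l1 l2] ->]]] [_ [p' [hp' [l3 l4] ->]]].
have sQ : in_grid (fun t => w.1.2 t : nat) L by move=> t; exact: ltn_ord.
apply: le_trans (hC _ _ (cell_boundary sQ hp) (cell_boundary sQ hp')) _.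
rewrite -mulrA ler_pM2l // mulrDl mul1r; apply: lerD; last exact: cell_dist hp hp'.
have p2 : 0 < 2 ^+ L :> R by rewrite exprn_gt0.
rewrite -[X in _ <= X]mul1r ler_pdivlMr // -[X in _ * X]gtr0_norm // -normrM mulrBl.
rewrite ler_norml; apply/andP; split; lra.
Qed.

Lemma piece_nonempty L (P : pred (T * bool * grid L)) :
  (#|[set w | `[< (piece P w !=set0)%classic >]]%SET| <= #|pieces N Cb P|)%N.
Proof.
apply: subset_leq_card; apply/fintype.subsetP => w; rewrite inE => /asboolP[g [hw _]]; exact: hw.
Qed.

(** The points that no chart reaches: every cell containing such a point, on any face and of any
    depth, is degenerate at its own scale. *)
Definition always_degenerate p := forall c sg L (Q : grid L), Q c = 0%N :> nat ->
  cell c sg L (fun t => Q t) p -> degenerate_at K c sg L (fun t => Q t) L.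

Lemma radial_in_piece L (P : pred (T * bool * grid L)) p c sg : p c = face R sg ->
  (forall t, `|p t| <= 1) ->
  (forall Q : grid L, Q c = 0%N :> nat -> cell c sg L (fun t => Q t) p -> P (c, sg, Q)) ->
  exists w, piece P w (radial N p).
Proof.
move=> pc hp hP; have [Q [Qc hQ]] := cell_exists L pc hp.
have [j hj] := exists_level hCb L hp.
exists ((c, sg, Q), j); split; last by exists p.
by rewrite inE /= hP // Qc eqxx /= inE; apply/asboolP; exists p.
Qed.

Variable C9 : nat.
Hypothesis hC9 : forall c sg (l L : nat) (A : {set grid L}),
  (l <= L)%N -> (forall Q, Q \in A -> Q c = 0%N :> nat /\ degenerate_cell c sg L (fun t => Q t) (2 ^+ l)^-1 K) ->
  (#|A| * 2 ^ (2 * l) <= C9 * 2 ^ (L * k))%N.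

(** O(2^(L k)) pieces of diameter O(2^-L) have a sum of k-th powers bounded independently of L. *)
Lemma cc_sphere_hausdorff_finite : (hausdorff (@Gdist R n) k (cc_sphere N) < +oo)%E.
Proof.
have [C1 C10 hC1] := piece_diam.
have [C C0 hC] := pieces_count Cb K0 hK hC9.
apply: (@le_lt_trans _ _ (C * C1 ^+ k)%:E); last exact: ltry.
apply: hausdorff_le => d d0.
have [L hL] := exists_pow2_small C1 d0.
have p2 : 0 < 2 ^+ L :> R by rewrite exprn_gt0.
have e0 : 0 <= C1 / 2 ^+ L by rewrite divr_ge0 // ltW.
apply: le_trans (hausdorff_delta_finite_cover dim_gt0 e0 hL _ _ (piece_nonempty (fun _ : T * bool * grid L => true))) _.
- move=> g /(sphere_radial hN n2)[p [c [sg [pc hp ->]]]].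
  by have [w hw] := @radial_in_piece L (fun=> true) p c sg pc hp (fun _ _ _ => isT); exists w.
- by move=> w x y; exact: hC1.
rewrite lee_fin exprMn exprVn mulrCA mulrC ler_pM2r ?exprn_gt0 //.
by rewrite ler_pdivrMr ?exprn_gt0 //.
Qed.

(** For every L the pieces over degenerate cells of depth L cover such points, and the sum of k-th
    powers of diameters is O(2^-L). *)
Lemma always_degenerate_null (S : set G) :
  (forall g, S g -> exists p c sg, [/\ p c = face R sg, forall t, `|p t| <= 1, g = radial N p & always_degenerate p]) ->
  hausdorff (@Gdist R n) k S = 0%E.
Proof.
move=> hS; have [C1 C10 hC1] := piece_diam.
have [C C0 hC] := degenerate_pieces_count N Cb hC9.
apply: hausdorff_eq0 => d e d0 e0.
have [L1_unit hL1] := exists_pow2_small C1 d0.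
have [L2 hL2] := exists_pow2_small (C * C1 ^+ k) e0.
(* The sum makes the depth large enough both for the diameters and for the total. *)
pose L := (L1_unit + L2)%N.
have p2 m : 0 < 2 ^+ m :> R by rewrite exprn_gt0.
have mono m (c : R) : 0 <= c -> (m <= L)%N -> c / 2 ^+ L <= c / 2 ^+ m.
  by move=> c0 mL; rewrite ler_wpM2l // lef_pV2 ?posrE // ler_eXn2l // ltr1n.
have hL : C1 / 2 ^+ L <= d by apply: le_trans (mono L1_unit _ (ltW C10) (leq_addr _ _)) hL1.
have e1 : 0 <= C1 / 2 ^+ L by rewrite divr_ge0 // ltW.
pose P (x : T * bool * grid L) := degenerate_at K x.1.1 x.1.2 L (fun t => x.2 t) L.
apply: le_trans (hausdorff_delta_finite_cover dim_gt0 e1 hL _ _ (piece_nonempty P)) _.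
- move=> g /hS[p [c [sg [pc hp -> ab]]]].
  have [w hw] := @radial_in_piece L P p c sg pc hp (fun Q Qc hQ => ab c sg L Q Qc hQ); by exists w.
- by move=> w x y; exact: hC1.
have CC : 0 <= C * C1 ^+ k by rewrite mulr_ge0 // exprn_ge0 // ltW.
rewrite lee_fin; apply: le_trans (le_trans (mono L2 _ CC (leq_addl _ _)) hL2).
have h := ler_wpM2r (exprn_ge0 k e1) (hC L).
apply: le_trans h _; rewrite le_eqVlt; apply/orP; left; apply/eqP.
rewrite expr_div_n; have := gt_eqF (exprn_gt0 k (p2 L)); have := gt_eqF (p2 L).
move: (2 ^+ L : R) => y /negbT y0; move: (y ^+ k : R) (C1 ^+ k : R) => z u /negbT z0.
by field; do ?[apply/andP; split].
Qed.

(* Clamping makes the charts Lipschitz on the whole space, the only subset whose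
   measurability is then needed. *)
Definition chart_point c sg L (Q : T -> nat) (y : 'rV[R]_k) : T -> R := fun t =>
  if unlift (enum_rank c) (enum_rank t) is Some i
  then clamp (corner R L (Q t)) (corner R L (Q t) + (2 ^+ L)^-1) (y 0 i) else face R sg.

Lemma chart_point_cell c sg L Q y : cell c sg L Q (chart_point c sg L Q y).
Proof.
have d0 : 0 <= (2 ^+ L)^-1 :> R by rewrite invr_ge0 exprn_ge0.
split; first by rewrite /chart_point unlift_none.
move=> t tc; rewrite /chart_point; case: unliftP => [i _|/enum_rank_inj e].
  by apply: clamp_bounds; lra.
by rewrite e eqxx in tc.
Qed.

Lemma chart_point_surj c sg L Q p : cell c sg L Q p -> exists y, chart_point c sg L Q y = p.
Proof.
move=> [pc hp]; exists (\row_i p (enum_val (lift (enum_rank c) i))).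
apply/funext => t; rewrite /chart_point; case: unliftP => [i e|/enum_rank_inj ->]; last by rewrite pc.
have tc : t != c.
  by apply/eqP => tc; move: e; rewrite tc => /eqP; rewrite (negbTE (neq_lift _ _)).
by rewrite mxE -e enum_rankK; have [h1 h2] := hp t tc; apply: clamp_id.
Qed.

Lemma coord_le_euclid_dist (y z : 'rV[R]_k) i : `|y 0 i - z 0 i| <= euclid_dist y z.
Proof.
rewrite /euclid_dist -sqrtr_sqr ler_sqrt.
  by rewrite (bigD1 i) //= lerDl; apply: sumr_ge0 => j _; exact: sqr_ge0.
by apply: sumr_ge0 => j _; exact: sqr_ge0.
Qed.

Lemma chart_point_lip c sg L Q (y z : 'rV[R]_k) :
  \sum_t `|chart_point c sg L Q y t - chart_point c sg L Q z t| <= #|{: T}|%:R * euclid_dist y z.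
Proof.
have d0 : 0 <= (2 ^+ L)^-1 :> R by rewrite invr_ge0 exprn_ge0.
apply: sum_le_card => t; rewrite /chart_point; case: unlift => [i|].
  by apply: le_trans (coord_le_euclid_dist y z i); apply: clamp_lip; lra.
by rewrite subrr normr0 sqrtr_ge0.
Qed.

(** Two chart points always lie in the same cell, which is not degenerate at scale 2^-L, so F has
    Lipschitz constant K 2^L there; the 1 accounts for the displacement of the coordinates. *)
Lemma radial_chart_lip c sg L Q : in_grid Q L -> ~~ degenerate_at K c sg L Q L -> exists M : R, forall y z,
  Gdist (radial N (chart_point c sg L Q y)) (radial N (chart_point c sg L Q z)) <= M * euclid_dist y z.
Proof.
move=> sQ /asboolPn nb; have [C C0 hC] := radial_close hN.
have p2 : 0 < 2 ^+ L :> R by rewrite exprn_gt0.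
exists (C * ((K * 2 ^+ L + 1) * #|{: T}|%:R)) => y z.
have hy := chart_point_cell c sg L Q y; have hz := chart_point_cell c sg L Q z.
apply: le_trans (hC _ _ (cell_boundary sQ hy) (cell_boundary sQ hz)) _.
rewrite -!mulrA ler_pM2l // mulrDl mul1r.
have s1 : (2 ^+ L)^-1 <= 1 :> R by rewrite invf_le1 // exprn_ege1 // ler1n.
have s0 : 0 < (2 ^+ L)^-1 :> R by rewrite invr_gt0.
have h1 := chart_point_lip c sg L Q y z.
have := hK sQ s0 s1 nb hz hy; rewrite invrK => h2.
apply: lerD => //; apply: le_trans h2 _; apply: ler_wpM2l => //.
by apply: mulr_ge0; exact: ltW.
Qed.

(** The type [grid L] depends on L; with indices in [nat] a single countable type codes all charts,
    and [in_grid] restores the range. Every other code gives a constant map, which is Lipschitz with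
    constant 0. *)
Definition chart (j : nat) : 'rV[R]_k -> G :=
  if unpickle j is Some (c, sg, L, Q) then
    (fun (c : T) (sg : bool) (L : nat) (Q : {ffun T -> nat}) =>
    if `[< in_grid (fun t => Q t) L >] && ~~ degenerate_at K c sg L (fun t => Q t) L
    then fun y => radial N (chart_point c sg L (fun t => Q t) y) else fun=> coord_pt (fun=> 0)) c sg L Q
  else fun=> coord_pt (fun=> 0).

(** By contraposition: a cell that contains p and is not degenerate at its own scale has a chart,
    and clamping leaves the coordinates of p unchanged. *)
Lemma radial_in_chart p c sg : p c = face R sg -> (forall t, `|p t| <= 1) ->
  ~ (exists j y, chart j y = radial N p) -> always_degenerate p.
Proof.
move=> pc hp nc c' sg' L Q Qc hQ; apply: contrapT => /negP nb; apply: nc.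
pose q : {ffun T -> nat} := [ffun t => (Q t : nat)].
have qE : (fun t => q t) = (fun t => Q t : nat) by apply/funext => t; rewrite ffunE.
have [y hy] := chart_point_surj hQ.
exists (pickle (c', sg', L, q)), y; rewrite /chart pickleK /= qE.
have -> : `[< in_grid (fun t => Q t : nat) L >] by apply/asboolP => t; exact: ltn_ord.
by rewrite nb /= hy.
Qed.

Lemma Gdist_refl (g : G) : Gdist g g = 0.
Proof.
rewrite /Gdist big1 ?add0r => [|i _]; last by rewrite subrr expr0n.
rewrite big1 ?sqrtr0 // => i _; rewrite big1 // => j _; by rewrite subrr expr0n.
Qed.

Lemma cc_sphere_rectifiable : euclid_rectifiable k (cc_sphere N).
Proof.
split; first by move=> g [].
split; first exact: cc_sphere_hausdorff_finite.
have cG j y : Gset (chart j y).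
  rewrite /chart; case: (unpickle j) => [[[[c sg] L] Q]|]; last exact: coord_pt_Gset.
  by case: ifP => _; exact: coord_pt_Gset.
exists (fun=> setT), chart; split.
- by move=> _; apply: hausdorff_measurableT; exact: dim_gt0.
- by move=> j _ [y _ <-].
- move=> j; rewrite /chart; case: (unpickle j) => [[[[c sg] L] Q]|]; last first.
    by exists 0 => x y _ _; rewrite Gdist_refl mul0r.
  case: ifP => [/andP[/asboolP sQ nb]|_]; last by exists 0 => x y _ _; rewrite Gdist_refl mul0r.
  by have [M hM] := radial_chart_lip sQ nb; exists M => x y _ _.
- apply: always_degenerate_null => g [/(sphere_radial hN n2)[p [c [sg [pc hp ->]]]] nc].
  exists p, c, sg; split => //; apply: radial_in_chart pc hp _ => -[j [y e]].
  by apply: nc; exists j => //; exists y.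
Qed.

End Rectifiability.

Local Close Scope ring_scope.
Unset Implicit Arguments.

Theorem mainTheorem1 (R : realType) (n : nat) (N : 'rV[R]_n -> R) :
  (2 <= n)%N -> is_norm N ->
  euclid_rectifiable (n + 'C(n, 2)).-1 (cc_sphere N).
Proof.
move=> n2 hN; rewrite -card_edge.
have [K K0 hK] := exists_nondeg_lipschitz hN n2.
have [C C0 hC] := coord_dist_bounds hN.
have [C9 hC9] := count_degenerate_cells n2 (ltW K0).
(* The bound of the distance on the cube is rounded up to an integer, since it serves to number the
   levels. *)
apply: (@cc_sphere_rectifiable R n N hN n2 K (Num.truncn C).+1 K0 hK _ C9 hC9) => v hv.
apply/andP; split; first exact: (dist0_ge0 hN (coord_pt_Gset v)).
have [h _] := hC v hv; apply: le_trans h _.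
by have /andP[_ h] := truncn_itv (ltW C0); exact: ltW.
Qed.
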